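(* Let $p_2>3$ be a prime number and let $d_3\ge p_2$ be an integer. Then $(3,p_2,d_3)\in\operatorname{mdeg}(\operatorname{Tame}(\mathbb{C}^3))$ if and only if $d_3\notin\{\,2p_2-3k : k=1,\dots,\lfloor p_2/3\rfloor\,\}$.
   Context: For a polynomial mapping $F=(F_1,\dots,F_n):\mathbb{C}^n\to\mathbb{C}^n$, its multidegree is $\operatorname{mdeg}F=(\deg F_1,\dots,\deg F_n)$. A triangular automorphism of $\mathbb{C}^n$ is a map of the form $(x_1,\dots,x_n)\mapsto (x_1,\,x_2+f_2(x_1),\,\dots,\,x_n+f_n(x_1,\dots,x_{n-1}))$ with polynomials $f_i$. The group $\operatorname{Tame}(\mathbb{C}^n)$ of tame automorphisms is the group generated by the affine linear automorphisms and the triangular automorphisms of $\mathbb{C}^n$. $\operatorname{mdeg}(\operatorname{Tame}(\mathbb{C}^3))$ denotes the set of multidegrees of tame automorphisms of $\mathbb{C}^3$. *)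

(* Defs.v *)
(* Polynomials in 3 variables are represented as iterated
   univariate polynomials: P3 R := {poly {poly {poly R}}}, with
   x1 = innermost variable, x2 = middle, x3 = outermost. *)
From HB Require Import structures.
From mathcomp Require Import all_boot all_order all_algebra all_field.
Set Implicit Arguments. Unset Strict Implicit. Unset Printing Implicit Defensive.
Import Order.TTheory GRing.Theory Num.Theory.
Local Open Scope ring_scope.

Section Poly3.
Variable R : fieldType.

Definition P3 := {poly {poly {poly R}}}.

Definition C3 (c : R) : P3 := c%:P%:P%:P.
Definition X1 : P3 := 'X%:P%:P.
Definition X2 : P3 := 'X%:P.
Definition X3 : P3 := 'X.
Definition Xv (i : 'I_3) : P3 :=
  if val i == 0%N then X1 else if val i == 1%N then X2 else X3.

Definition eval3 (p : P3) (a b c : P3) : P3 :=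
  (map_poly (fun q : {poly {poly R}} =>
     (map_poly (fun r : {poly R} => (map_poly C3 r).[a]) q).[b]) p).[c].

(* total degree (of a nonzero polynomial; the zero polynomial gets 0) *)
Definition deg1 (r : {poly R}) : nat := (size r).-1.
Definition deg2 (q : {poly {poly R}}) : nat :=
  \max_(i < size q | q`_i != 0) (i + deg1 q`_i)%N.
Definition deg3 (p : P3) : nat :=
  \max_(i < size p | p`_i != 0) (i + deg2 p`_i)%N.

Definition pmap := {ffun 'I_3 -> P3}.
Definition pid : pmap := [ffun i => Xv i].
Definition pcomp (F G : pmap) : pmap :=
  [ffun i => eval3 (F i) (G ord0) (G (inord 1)) (G (inord 2))].

Definition mdeg (F : pmap) : nat * nat * nat :=
  (deg3 (F ord0), deg3 (F (inord 1)), deg3 (F (inord 2))).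

Definition affine_aut (F : pmap) : Prop :=
  exists (A : 'M[R]_3) (b : 'cV[R]_3), A \in unitmx /\
    F = [ffun i => \sum_(j < 3) C3 (A i j) * Xv j + C3 (b i ord0)].

Definition triangular_aut (F : pmap) : Prop :=
  exists (f2 : {poly R}) (f3 : {poly {poly R}}),
    F = [ffun i => if val i == 0%N then X1
                   else if val i == 1%N then X2 + f2%:P%:P
                   else X3 + f3%:P].

Inductive tame : pmap -> Prop :=
  | tame_affine F : affine_aut F -> tame F
  | tame_triangular F : triangular_aut F -> tame F
  | tame_comp F G : tame F -> tame G -> tame (pcomp F G)
  | tame_inv F G : tame F -> pcomp F G = pid -> pcomp G F = pid -> tame G.

Definition in_mdeg_tame (d : nat * nat * nat) : Prop :=
  exists F : pmap, tame F /\ mdeg F = d.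

End Poly3.

(* Main.v *)
(* Give the variables weights close to 1 that are linearly independent over the rationals.  Then the
   leading forms of a given weighted degree span a line, and for [x = phi(f, g)] whose leading
   monomials cancel there is a lower bound for the degree of [x] in terms of the degree of
   [df /\ dg] (Shestakov-Umirbaev, in the differential form of Kuroda).

   A triple is called reducible ([redtriple]) if it can be brought to [(X1, X2, X3)] by affine
   changes of basis, by elementary moves that lower the degree, and by one exceptional kind of
   reduction ([Kcond]).  Comparing an arbitrary elementary move with a known reduction, by induction
   on the sum of the degrees, one finds that the class of reducible triples is stable under all
   elementary moves, so that every tame automorphism is reducible.  If its degrees are 3, p and
   2p - 3k, then the arithmetic of these numbers excludes every possible first reduction.

   In the other direction [d = i p + 3 j], and composing [(X1 + X3^3, X2 + X3^p, X3)] with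
   [X3 + X1^j X2^i] gives the required automorphism. *)
Require Import Defs.
From Stdlib Require Import Reals Lra Classical.
From HB Require Import structures.
From mathcomp Require Import all_boot all_order all_algebra all_field.
From mathcomp Require Import perm zify ring.
Set Implicit Arguments. Unset Strict Implicit. Unset Printing Implicit Defensive.
Import Order.TTheory GRing.Theory Num.Theory.
Delimit Scope R_scope with Re.
Delimit Scope Z_scope with Zs.
Local Open Scope ring_scope.

(** * The weighted degree on univariate polynomials *)

(** Logarithmic derivatives do not raise degrees, so a wedge has degree at most the sum of the
    degrees; a nonzero minor is divisible by two variables, hence has degree at least 2. This
    constant 2 decides the last numerical case of the nonexistence part. What prevents a purely
    elementary theory is one pair of reductions that does not commute: [f3] is lowered to [y] with
    the help of [f1], [f2], where [2 d f1 = 3 d f2], and [f1] is changed by a quadratic polynomial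
    in [f3]. Once [f3] has become [y], the change of [f1] is no longer elementary; [Kcond] is made
    for this configuration. All other pairs either commute through triples of smaller degree or
    exclude each other numerically. To see the latter one passes to an element of least degree in
    its coset: its degree is no multiple of the degrees of the generators. The weights are so close
    to 1 that leading monomials also realize the total degree, and independence turns relations
    between weighted degrees into relations between total degrees. The reduction theory uses only
    the axioms of [ctx]; since degrees are real numbers, induction on them is one of these
    axioms. *)

Ltac rmax := repeat match goal with
  | H : context [Rmax ?x ?y] |- _ =>
      first [ rewrite (Rmax_left x y) in H; [| lra] | rewrite (Rmax_right x y) in H; [| lra]
            | move: H; rewrite /(Rmax x y); case: Rle_dec => ? H ]
  | |- context [Rmax ?x ?y] => rewrite /(Rmax x y); case: Rle_dec => ?
  end.

(* Terms produced by rewriting reach the ring operations through different canonical structure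
   paths; this makes the convertible arguments of [d] syntactically equal for [lra]. *)
Ltac reunify d :=
  repeat match goal with
  | |- context [d ?x] =>
     match goal with |- context [d ?y] =>
       tryif constr_eq x y then fail else (change (d y) with (d x))
     end
  end.
Ltac dlra d := repeat match goal with H : context [d _] |- _ => revert H end; reunify d; rmax; lra.

(** [V] contains the values taken on nonzero elements, so that independence of the next weight can
    be stated as a condition on [V] when a variable is adjoined. [deg_lead] says that leading forms
    of equal degree are proportional over [K]. Zero has degree 0, not minus infinity, which causes
    the many separate treatments of zero. *)
Record is_degree (B : idomainType) (K : fieldType) (cs : K -> B) (d : B -> R) (V : R -> Prop) : Prop :=
  IsDegree {
   deg_ge0 : forall x, (0 <= d x)%Re;
   deg_zero : d 0 = 0%Re;
   degD : forall x y, (d (x + y)%R <= Rmax (d x) (d y))%Re;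
   degM : forall x y, x != 0 -> y != 0 -> d (x * y) = (d x + d y)%Re;
   deg_lead : forall x y, x != 0 -> y != 0 -> d x = d y ->
     exists c, x - cs c * y = 0 \/ (d (x - cs c * y)%R < d x)%Re;
   deg_cst : forall c, d (cs c) = 0%Re;
   deg_val : forall x, x != 0 -> V (d x) }.

Section PolyDegree.
Variables (A : idomainType) (dA : A -> R) (w : R).

Definition tdeg (p : {poly A}) (i : nat) : R :=
  if p`_i == 0 then 0%Re else (INR i * w + dA p`_i)%Re.
Definition pdeg (p : {poly A}) : R :=
  foldr (fun i m => Rmax (tdeg p i) m) 0%Re (iota 0 (size p)).

Implicit Types p q : {poly A}.
Hypothesis w_gt0 : (0 < w)%Re.
Variables (K : fieldType) (cs : {rmorphism K -> A}) (V : R -> Prop).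
Hypothesis dAP : is_degree cs dA V.
Hypothesis V_indep : forall x y i j, V x -> V y -> (INR i * w + x = INR j * w + y)%Re -> i = j.

Lemma degN0 x : dA (- x) = dA x.
Proof.
have [->|x0] := eqVneq x 0; first by rewrite oppr0.
have H : dA (-1) = 0%Re by rewrite -(deg_cst dAP (-1)) rmorphN1.
rewrite -mulN1r (degM dAP) ?H ?oppr_eq0 ?oner_eq0 //; lra.
Qed.

Lemma foldmax_ge (F : nat -> R) s i : i \in s ->
  (F i <= foldr (fun i m => Rmax (F i) m) 0%Re s)%Re.
Proof.
elim: s => //= j s IH; rewrite inE => /orP [/eqP ->|/IH H]; first exact: Rmax_l.
exact: Rle_trans H (Rmax_r _ _).
Qed.

Lemma foldmax_ge0 (F : nat -> R) s : (0 <= foldr (fun i m => Rmax (F i) m) 0%Re s)%Re.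
Proof. elim: s => /= [|j s IH]; [lra | exact: Rle_trans IH (Rmax_r _ _)]. Qed.

Lemma foldmax_attain (F : nat -> R) s :
  (foldr (fun i m => Rmax (F i) m) 0%Re s = 0)%Re \/
  exists2 i, i \in s & (foldr (fun i m => Rmax (F i) m) 0%Re s = F i)%Re.
Proof.
elim: s => /= [|j s IH]; first by left.
rewrite /Rmax; case: Rle_dec => h.
  case: IH => [->|[i i1 i2]]; [by left|right; exists i => //].
  by rewrite inE i1 orbT.
by right; exists j => //; rewrite inE eqxx.
Qed.

Lemma pdeg_ge p i : p`_i != 0 -> (INR i * w + dA p`_i <= pdeg p)%Re.
Proof.
move=> h; have : i \in iota 0 (size p).
  rewrite mem_iota add0n leq0n /=.
  by rewrite ltnNge; apply: contra h => h; rewrite nth_default.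
by move/(foldmax_ge (tdeg p)); rewrite {1}/tdeg (negbTE h).
Qed.

Lemma pdeg_ge0 p : (0 <= pdeg p)%Re.
Proof. exact: foldmax_ge0. Qed.

Lemma pdeg_attain p : p != 0 -> exists i, p`_i != 0 /\ pdeg p = (INR i * w + dA p`_i)%Re.
Proof.
move=> p0; case: (foldmax_attain (tdeg p) (iota 0 (size p))) => [h|[i _]].
  exists (size p).-1; have l0 : p`_(size p).-1 != 0 by rewrite -lead_coefE lead_coef_eq0.
  split=> //; have := pdeg_ge l0; rewrite /pdeg h.
  have := deg_ge0 dAP p`_(size p).-1; have := pos_INR (size p).-1; nra.
rewrite -/(pdeg p) /tdeg; case: ifP => [_ h|/negbT n0 h]; last by exists i.
exists (size p).-1; have l0 : p`_(size p).-1 != 0 by rewrite -lead_coefE lead_coef_eq0.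
split=> //; have := pdeg_ge l0; rewrite h.
have := deg_ge0 dAP p`_(size p).-1; have := pos_INR (size p).-1; nra.
Qed.

Lemma pdeg0 : pdeg 0 = 0%Re.
Proof. by rewrite /pdeg size_poly0. Qed.

Lemma pdeg_le p v : (0 <= v)%Re ->
  (forall i, p`_i != 0 -> (INR i * w + dA p`_i <= v)%Re) -> (pdeg p <= v)%Re.
Proof.
move=> v0 H; have [->|p0] := eqVneq p 0; first by rewrite pdeg0.
by have [i [i0 ->]] := pdeg_attain p0; exact: H.
Qed.

Lemma pdegD p q : (pdeg (p + q)%R <= Rmax (pdeg p) (pdeg q))%Re.
Proof.
apply: pdeg_le; first exact: Rle_trans (pdeg_ge0 p) (Rmax_l _ _).
move=> i; rewrite coefD => h.
have h1 := degD dAP p`_i q`_i.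
have [p0|p0] := eqVneq p`_i 0; have [q0|q0] := eqVneq q`_i 0.
- by rewrite p0 q0 addr0 eqxx in h.
- have := pdeg_ge q0; rewrite p0 add0r; have := Rmax_r (pdeg p) (pdeg q); lra.
- have := pdeg_ge p0; rewrite q0 addr0; have := Rmax_l (pdeg p) (pdeg q); lra.
have := pdeg_ge q0; have := pdeg_ge p0; move: h1; dlra dA.
Qed.

Lemma pdeg_cst c : pdeg (cs c)%:P = 0%Re.
Proof.
apply: Rle_antisym; last exact: pdeg_ge0.
apply: pdeg_le; first lra.
move=> [|i]; rewrite coefC /= ?eqxx // => _; rewrite (deg_cst dAP) /=. lra.
Qed.

(** Independence of [w] from the values in [V] excludes ties between different powers of the
    variable, so a single coefficient carries the degree. Multiplicativity and proportionality of
    leading forms both reduce to that coefficient. *)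
Lemma pdeg_uniq p : p != 0 -> exists i, [/\ p`_i != 0, pdeg p = (INR i * w + dA p`_i)%Re &
  forall j, j != i -> p`_j != 0 -> (INR j * w + dA p`_j < pdeg p)%Re].
Proof.
move=> p0; have [i0 [n0 e0]] := pdeg_attain p0.
exists i0; split=> // j ji j0.
have := pdeg_ge j0; case: (Req_dec (INR j * w + dA p`_j) (pdeg p)); last lra.
rewrite e0 => /V_indep h; exfalso; move/eqP: ji; apply.
by apply: h; exact: (deg_val dAP).
Qed.

Lemma degB_eq x y : y != 0 -> (dA x < dA y)%Re \/ x = 0 -> x + y != 0 /\ dA (x + y) = dA y.
Proof.
move=> y0 [h|->]; last by rewrite add0r.
have e : dA (x + y) = dA y.
  apply: Rle_antisym; first by have := degD dAP x y; dlra dA.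
  have := degD dAP (x + y) (- x); rewrite addrC addKr degN0; dlra dA.
split=> //; apply/eqP => s0; move: h; have -> : x = - y by apply/eqP; rewrite -addr_eq0 s0.
by rewrite degN0; lra.
Qed.

Lemma pdegM p q : p != 0 -> q != 0 -> pdeg (p * q) = (pdeg p + pdeg q)%Re.
Proof.
move=> p0 q0; apply: Rle_antisym.
  apply: pdeg_le; first by have := pdeg_ge0 p; have := pdeg_ge0 q; lra.
  move=> k; rewrite coefM => h.
  suff : forall (r : seq 'I_k.+1), (\sum_(j <- r) p`_j * q`_(k - j))%R != 0 ->
     (INR k * w + dA (\sum_(j <- r) p`_j * q`_(k - j))%R <= pdeg p + pdeg q)%Re by apply.
  elim=> [|j r IH]; first by rewrite big_nil eqxx.
  rewrite big_cons => hs.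
  have hj : p`_j * q`_(k - j) != 0 ->
     (INR k * w + dA (p`_j * q`_(k - j))%R <= pdeg p + pdeg q)%Re.
    rewrite mulf_eq0 negb_or => /andP [pj qj]; rewrite (degM dAP) //.
    have -> : INR k = (INR j + INR (k - j))%Re.
      by rewrite -plus_INR; congr INR; rewrite plusE subnKC // -ltnS.
    have := pdeg_ge pj; have := pdeg_ge qj; lra.
  have [e|e] := eqVneq (p`_j * q`_(k - j)) 0; first by rewrite e add0r in hs *; exact: IH.
  have [e'|e'] := eqVneq (\sum_(j <- r) p`_j * q`_(k - j)) 0.
    by rewrite e' addr0; exact: hj.
  have := degD dAP (p`_j * q`_(k - j)) (\sum_(j <- r) p`_j * q`_(k - j)).
  have := hj e; have := IH e'; dlra dA.
have [i [pi ei ui]] := pdeg_uniq p0; have [j [qj ej uj]] := pdeg_uniq q0.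
have hij : (i < (i + j).+1)%N by lia.
have [n0 e] : (p * q)`_(i + j) != 0 /\ dA (p * q)`_(i + j) = dA (p`_i * q`_j).
  rewrite coefM (bigD1 (Ordinal hij)) //= addKn addrC; apply: degB_eq.
    by rewrite mulf_neq0.
  rewrite (degM dAP) //.
  set S := (X in (dA X < _)%Re).
  have H : S = 0 \/ (INR (i + j) * w + dA S < pdeg p + pdeg q)%Re.
    rewrite /S; elim/big_rec: _ => [|k x hk IH]; first by left.
    have hx : p`_k * q`_(i + j - k) = 0 \/
       (INR (i + j) * w + dA (p`_k * q`_(i + j - k))%R < pdeg p + pdeg q)%Re.
      have [->|z] := eqVneq (p`_k * q`_(i + j - k)) 0; [by left|right].
      move: z; rewrite mulf_eq0 negb_or => /andP [z1 z2].
      have ki : (k : nat) != i by apply: contra hk => /eqP h; apply/eqP/val_inj.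
      rewrite (degM dAP) //.
      have := ui _ ki z1; have := pdeg_ge z2.
      have -> : INR (i + j) = (INR k + INR (i + j - k))%Re.
        by rewrite -plus_INR; congr INR; rewrite plusE subnKC // -ltnS.
      lra.
    case: hx => [->|hx]; first by rewrite add0r.
    case: IH => [->|IH]; first by rewrite addr0; right.
    right; have := degD dAP (p`_k * q`_(i + j - k)) x; move: hx IH; dlra dA.
  case: H => [H|H]; [by right; exact: H|left].
  move: H; rewrite plus_INR ei ej; dlra dA.
have := pdeg_ge n0; rewrite e (degM dAP) // plus_INR ei ej; dlra dA.
Qed.

Lemma pdeg_lead p q : p != 0 -> q != 0 -> pdeg p = pdeg q ->
  exists c, p - (cs c)%:P * q = 0 \/ (pdeg (p - (cs c)%:P * q)%R < pdeg p)%Re.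
Proof.
move=> p0 q0 e.
have [i [pi ei ui]] := pdeg_uniq p0; have [j [qj ej uj]] := pdeg_uniq q0.
have ij : i = j.
  by apply: (@V_indep (dA p`_i) (dA q`_j)); rewrite -?ei -?ej //; apply: (deg_val dAP).
subst j; have [|c hc] := @deg_lead _ _ _ _ _ dAP p`_i q`_i pi qj; first by move: e; rewrite ei ej; dlra dA.
exists c; have [->|n0] := eqVneq (p - (cs c)%:P * q) 0; [by left|right].
have [k [rk -> _]] := pdeg_uniq n0.
have co : (p - (cs c)%:P * q)`_k = p`_k - cs c * q`_k by rewrite coefB coefCM.
move: rk; rewrite co => {co}.
have [->|ki] := eqVneq k i.
  case: hc => [->|hc _]; first by rewrite eqxx. rewrite ei; dlra dA.
have h1 : p`_k != 0 -> (INR k * w + dA p`_k < pdeg p)%Re by move=> z; apply: ui.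
have h2 : cs c * q`_k != 0 -> (INR k * w + dA (cs c * q`_k)%R < pdeg p)%Re.
  rewrite mulf_eq0 negb_or => /andP [z1 z2].
  rewrite (degM dAP) // (deg_cst dAP) e; have := uj _ ki z2; dlra dA.
have [->|z1] := eqVneq p`_k 0.
  by rewrite sub0r oppr_eq0 degN0.
have [->|z2 _] := eqVneq (cs c * q`_k) 0; first by rewrite subr0.
have := degD dAP p`_k (- (cs c * q`_k)); rewrite degN0.
have := h1 z1; have := h2 z2; dlra dA.
Qed.

Definition Vext (v : R) : Prop := exists i x, V x /\ v = (INR i * w + x)%Re.

Lemma pdeg_val p : p != 0 -> Vext (pdeg p).
Proof.
move=> /pdeg_uniq [i [pi ei _]]; exists i, (dA p`_i); split=> //; exact: (deg_val dAP).
Qed.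

Lemma pdegP : is_degree (fun c => (cs c)%:P) pdeg Vext.
Proof.
split; [exact: pdeg_ge0|exact: pdeg0|exact: pdegD|exact: pdegM|exact: pdeg_lead
       |exact: pdeg_cst|exact: pdeg_val].
Qed.

(* [E] is an Euler derivation: on a monomial it multiplies by the total degree.  The shift [n]
   makes the statement inductive over the number of variables. *)
Definition euler_like (B : idomainType) (d : B -> R) (E : B -> B) :=
  forall x (n : nat), (0 < n)%N \/ (0 < d x)%Re -> x != 0 ->
    E x + x *+ n != 0 /\ d (E x + x *+ n) = d x.

Definition peuler (E : A -> A) (p : {poly A}) : {poly A} :=
  \poly_(i < size p) (E p`_i + p`_i *+ i).

Lemma peuler_coef E p i : E 0 = 0 -> (peuler E p)`_i = E p`_i + p`_i *+ i.
Proof.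
move=> E0; rewrite coef_poly; case: ltnP => // h.
by rewrite nth_default // E0 mul0rn addr0.
Qed.

Lemma peulerP (E : A -> A) : E 0 = 0 -> (forall x, dA x = 0%Re -> E x = 0) ->
  euler_like dA E -> euler_like pdeg (peuler E).
Proof.
move=> E0 Ec EP p n hn p0.
have [i [pi ei ui]] := pdeg_uniq p0.
have co k : (peuler E p + p *+ n)`_k = E p`_k + p`_k *+ (k + n).
  by rewrite coefD coefMn peuler_coef // mulrnDr addrA.
have key k : p`_k != 0 -> (INR k * w + dA (E p`_k + p`_k *+ (k + n))%R <= INR k * w + dA p`_k)%Re.
  move=> pk; case: (posnP (k + n)) => [e|h].
    rewrite e mulr0n addr0; case: (Req_dec (dA p`_k) 0) => [/Ec -> |h].
      by rewrite (deg_zero dAP); have := deg_ge0 dAP p`_k; lra.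
    have := deg_ge0 dAP p`_k => h0.
    have [||_] := EP p`_k 0%N => //; first by right; lra.
    by rewrite mulr0n addr0 => ->; lra.
  by have [||_ ->] := EP p`_k (k + n)%N => //; [left | lra].
have [n0 en] : E p`_i + p`_i *+ (i + n) != 0 /\ dA (E p`_i + p`_i *+ (i + n)) = dA p`_i.
  apply: EP => //; case: hn => [h|h]; first by left; lia.
  case: i pi ei ui => [|i] pi ei ui; last by left; lia.
  by right; move: ei; rewrite /=; lra.
have s0 : peuler E p + p *+ n != 0.
  by apply: contra n0 => /eqP h; rewrite -co h coef0.
split=> //; apply: Rle_antisym.
  apply: pdeg_le; first exact: pdeg_ge0.
  move=> k; rewrite co => hk.
  have pk : p`_k != 0 by apply: contra hk => /eqP ->; rewrite E0 mul0rn addr0.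
  have := key _ pk; have := pdeg_ge pk; lra.
have := @pdeg_ge (peuler E p + p *+ n) i; rewrite co en -ei; exact.
Qed.

End PolyDegree.

(** * Weighted degrees on polynomials in three variables *)

Definition derivation (A : nzRingType) (T : A -> A) : Prop :=
  (forall x y, T (x + y) = T x + T y) /\ (forall x y, T (x * y) = T x * y + x * T y).

Section Derivation.
Variables (A : nzRingType) (T : A -> A).
Hypothesis TP : derivation T.

Lemma derivation0 : T 0 = 0.
Proof. by have := TP.1 0 0; rewrite addr0 => /(congr1 (fun z => z - T 0)); rewrite subrr addrK. Qed.

Lemma deriv_sum (I : Type) (r : seq I) (Q : pred I) (F : I -> A) :
  T (\sum_(i <- r | Q i) F i) = \sum_(i <- r | Q i) T (F i).
Proof.
elim: r => [|a r IH]; first by rewrite !big_nil derivation0.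
by rewrite !big_cons; case: ifP => _; rewrite ?TP.1 IH.
Qed.

Lemma coef_map_deriv (p : {poly A}) i : (map_poly T p)`_i = T p`_i.
Proof. by rewrite coef_map_id0 // derivation0. Qed.

Lemma derivation_map : derivation (map_poly T).
Proof.
split=> p q; apply/polyP => k; first by rewrite coefD !coef_map_deriv coefD TP.1.
rewrite coefD !coefM coef_map_deriv coefM deriv_sum -big_split /=.
by apply: eq_bigr => i _; rewrite TP.2 !coef_map_deriv.
Qed.
End Derivation.

(** The factor ['X] restores the degree lost by differentiation: each monomial is multiplied by its
    exponent. *)
Definition theta (A : comNzRingType) (p : {poly A}) : {poly A} := 'X * p^`().

Lemma theta_derivation (A : comNzRingType) : derivation (@theta A).
Proof.
by split=> p q; rewrite /theta; [rewrite derivD mulrDr | rewrite derivM; ring].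
Qed.

Lemma coef_theta (A : comNzRingType) (p : {poly A}) i : (theta p)`_i = p`_i *+ i.
Proof. by rewrite /theta coefXM coef_deriv; case: i. Qed.

Lemma theta_const (A : comNzRingType) (c : A) : theta c%:P = 0.
Proof. by rewrite /theta derivC mulr0. Qed.

Section DegreeContraction.
Variables (A : idomainType) (dA : A -> R) (w : R) (K : fieldType) (cs : {rmorphism K -> A}) (V : R -> Prop).
Hypothesis w_gt0 : (0 < w)%Re.
Hypothesis dAP : is_degree cs dA V.

Lemma degMn x n : (dA (x *+ n)%R <= dA x)%Re.
Proof.
elim: n => [|n IH]; first by rewrite mulr0n (deg_zero dAP); exact: (deg_ge0 dAP).
have := degD dAP (x *+ n) x; rewrite -mulrSr; dlra dA.
Qed.

Lemma pdeg_theta (p : {poly A}) : (pdeg dA w (theta p) <= pdeg dA w p)%Re.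
Proof.
apply: (pdeg_le w_gt0 dAP); first exact: pdeg_ge0.
move=> i; rewrite coef_theta => h.
have pi0 : p`_i != 0 by apply: contra h => /eqP ->; rewrite mul0rn.
have := @pdeg_ge A dA w p i pi0; have := degMn p`_i i; dlra dA.
Qed.

Lemma pdeg_map (T : A -> A) (p : {poly A}) : T 0 = 0 -> (forall x, (dA (T x) <= dA x)%Re) ->
  (pdeg dA w (map_poly T p) <= pdeg dA w p)%Re.
Proof.
move=> T0 HT; apply: (pdeg_le w_gt0 dAP); first exact: pdeg_ge0.
move=> i; rewrite coef_map_id0 // => h.
have pi0 : p`_i != 0 by apply: contra h => /eqP ->; rewrite T0.
have := @pdeg_ge A dA w p i pi0; have := HT p`_i; dlra dA.
Qed.

Lemma pdeg_eq0 (p : {poly A}) : pdeg dA w p = 0%Re -> p = (p`_0)%:P /\ dA p`_0 = 0%Re.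
Proof.
move=> h; have H i : p`_i != 0 -> i = 0%N /\ dA p`_i = 0%Re.
  move=> n0; have := @pdeg_ge A dA w p i n0; rewrite h.
  have := deg_ge0 dAP p`_i; case: i n0 => [|i] n0; first by rewrite /=; split=> //; dlra dA.
  rewrite S_INR; have := pos_INR i => h1 h2 h3.
  have : (0 <= INR i * w)%Re by apply: Rmult_le_pos; lra.
  move=> h4; exfalso; move: h2 h3; dlra dA.
split; last first.
  by have [->|/H []//] := eqVneq p`_0 0; rewrite (deg_zero dAP).
apply/polyP => -[|i]; rewrite coefC //=.
by apply/eqP/negP => /negP /H [].
Qed.
End DegreeContraction.

(* [wth i] is the logarithmic derivative x_i d/dx_i and [wmn] the monomial x_1 x_2 x_3.  Axiom
   [d_lead] says that the space of leading forms of a given degree is one dimensional: this is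
   what the rationally independent weights are for. *)
Record ctx (C : fieldType) (P : idomainType) := Ctx {
  wcst : {rmorphism C -> P};
  wd : P -> R;
  wth : 'I_3 -> P -> P;
  wmn : P;
  d_ge0 : forall x, (0 <= wd x)%Re;
  d0 : wd 0 = 0%Re;
  dD : forall x y, (wd (x + y)%R <= Rmax (wd x) (wd y))%Re;
  dM : forall x y, x != 0 -> y != 0 -> wd (x * y) = (wd x + wd y)%Re;
  d_lead : forall x y, x != 0 -> y != 0 -> wd x = wd y ->
     exists c, x - wcst c * y = 0 \/ (wd (x - wcst c * y)%R < wd x)%Re;
  d_cst : forall c, wd (wcst c) = 0%Re;
  thP : forall i, derivation (wth i);
  th_cst : forall i c, wth i (wcst c) = 0;
  th_le : forall i x, (wd (wth i x) <= wd x)%Re;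
  th_d0 : forall i x, wd x = 0%Re -> wth i x = 0;
  euler : forall x, (0 < wd x)%Re -> wd (wth 0 x + wth 1 x + wth (1 + 1) x) = wd x;
  minor_ge2 : forall i j f g, i != j -> wth i f * wth j g - wth j f * wth i g != 0 ->
     (2 <= wd (wth i f * wth j g - wth j f * wth i g)%R)%Re;
  mon_neq0 : wmn != 0;
  mon_ge3 : (3 <= wd wmn)%Re;
  d_wf : forall Q : R -> Prop,
    (forall v, (forall u, (exists x y z, u = wd x + wd y + wd z)%Re -> (u < v)%Re -> Q u) -> Q v) ->
    forall v, Q v }.

(** * The weighted degree for three rationally independent weights *)

Section Instance.
Variables (C : fieldType) (w1 w2 w3 : R).
Hypothesis charC : [pchar C] =i pred0.
Hypothesis w1_ge1 : (1 <= w1)%Re.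
Hypothesis w2_ge1 : (1 <= w2)%Re.
Hypothesis w3_ge1 : (1 <= w3)%Re.
Hypothesis w_indep : forall i j k i' j' k',
  (INR i * w1 + INR j * w2 + INR k * w3 = INR i' * w1 + INR j' * w2 + INR k' * w3)%Re ->
  [/\ i = i', j = j' & k = k'].

Let dC (x : C) : R := 0%Re.
Let cC : {rmorphism C -> C} := idfun.
Let V0 (v : R) : Prop := v = 0%Re.

Lemma dCP : is_degree cC dC V0.
Proof.
split=> //; rewrite /dC /V0 /=; try by move=> *; lra.
- by move=> *; rewrite Rmax_left; lra.
- by move=> x y x0 y0 _; exists (x / y); left; rewrite divfK // subrr.
Qed.

Let c1 : {rmorphism C -> {poly C}} := polyC.
Let c2 : {rmorphism C -> {poly {poly C}}} := polyC \o polyC.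
Let c3 : {rmorphism C -> P3 C} := polyC \o (polyC \o polyC).
Let d1 := pdeg dC w1.
Let d2 := pdeg d1 w2.
Definition wdeg : P3 C -> R := pdeg d2 w3.
Let V1 := Vext w1 V0.
Let V2 := Vext w2 V1.

Lemma w1_gt0 : (0 < w1)%Re. Proof. lra. Qed.
Lemma w2_gt0 : (0 < w2)%Re. Proof. lra. Qed.
Lemma w3_gt0 : (0 < w3)%Re. Proof. lra. Qed.

Lemma V0_indep x y i j : V0 x -> V0 y -> (INR i * w1 + x = INR j * w1 + y)%Re -> i = j.
Proof. by move=> -> -> h; case: (@w_indep i 0 0 j 0 0); first lra. Qed.
Lemma V1_indep x y i j : V1 x -> V1 y -> (INR i * w2 + x = INR j * w2 + y)%Re -> i = j.
Proof. by move=> [a [? [-> ->]]] [b [? [-> ->]]] h; case: (@w_indep a i 0 b j 0); first lra. Qed.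
Lemma V2_indep x y i j : V2 x -> V2 y -> (INR i * w3 + x = INR j * w3 + y)%Re -> i = j.
Proof.
move=> [a [? [[a' [? [-> ->]]] ->]]] [b [? [[b' [? [-> ->]]] ->]]] h.
by case: (@w_indep a' a i b' b j); first lra.
Qed.

Lemma d1P : is_degree c1 d1 V1. Proof. exact: (pdegP w1_gt0 dCP V0_indep). Qed.
Lemma d2P : is_degree c2 d2 V2. Proof. exact: (pdegP w2_gt0 d1P V1_indep). Qed.
Lemma wdegP : is_degree c3 wdeg (Vext w3 V2). Proof. exact: (pdegP w3_gt0 d2P V2_indep). Qed.

Definition wtheta (i : 'I_3) : P3 C -> P3 C :=
  if val i == 0%N then map_poly (map_poly (@theta C)) else
  if val i == 1%N then map_poly (@theta {poly C}) else @theta {poly {poly C}}.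

Lemma wthetaP i : derivation (wtheta i).
Proof.
rewrite /wtheta; case: ifP => _; last case: ifP => _.
- exact/derivation_map/derivation_map/theta_derivation.
- exact/derivation_map/theta_derivation.
- exact: theta_derivation.
Qed.

Lemma theta0 (A : comNzRingType) : theta (0 : {poly A}) = 0.
Proof. by rewrite /theta deriv0 mulr0. Qed.

Lemma map_polyC0 (A : nzRingType) (T : A -> A) c : T 0 = 0 -> map_poly T c%:P = (T c)%:P.
Proof. by move=> T0; apply/polyP => i; rewrite coef_map_id0 // !coefC; case: ifP. Qed.

Lemma wtheta_cst i c : wtheta i (c3 c) = 0.
Proof.
rewrite /wtheta /c3 /=; case: ifP => _; last case: ifP => _; last exact: theta_const.
- by rewrite !map_polyC0 ?theta_const ?map_poly0 ?theta0.
- by rewrite map_polyC0 ?theta_const ?theta0.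
Qed.

Lemma wtheta_le i x : (wdeg (wtheta i x) <= wdeg x)%Re.
Proof.
rewrite /wtheta; case: ifP => _; last case: ifP => _.
- apply: (pdeg_map w3_gt0 d2P); first by rewrite map_poly0.
  move=> y; apply: (pdeg_map w2_gt0 d1P); first by rewrite theta0.
  by move=> z; apply: (pdeg_theta w1_gt0 dCP).
- apply: (pdeg_map w3_gt0 d2P); first by rewrite theta0.
  by move=> y; apply: (pdeg_theta w2_gt0 d1P).
- exact: (pdeg_theta w3_gt0 d2P).
Qed.

Lemma wdeg_eq0 x : wdeg x = 0%Re -> exists c, x = c3 c.
Proof.
move=> /(pdeg_eq0 w3_gt0 d2P) [e1 /(pdeg_eq0 w2_gt0 d1P) [e2 /(pdeg_eq0 w1_gt0 dCP) [e3 _]]].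
by exists (x`_0`_0`_0); rewrite {1}e1 {1}e2 {1}e3.
Qed.

Lemma wtheta_d0 i x : wdeg x = 0%Re -> wtheta i x = 0.
Proof. by move=> /wdeg_eq0 [c ->]; exact: wtheta_cst. Qed.

Let E0 (x : C) : C := 0.
Let E1 := peuler E0.
Let E2 := peuler E1.
Let E3 := peuler E2.

Lemma E1_0 : E1 0 = 0. Proof. by rewrite /E1 /peuler size_poly0 poly_def big_ord0. Qed.
Lemma E2_0 : E2 0 = 0. Proof. by rewrite /E2 /peuler size_poly0 poly_def big_ord0. Qed.

Lemma E1E (p : {poly C}) : E1 p = theta p.
Proof. by apply/polyP => i; rewrite peuler_coef // coef_theta add0r. Qed.

Lemma E2E (p : {poly {poly C}}) : E2 p = map_poly (@theta C) p + theta p.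
Proof.
apply/polyP => i; rewrite peuler_coef ?E1_0 // coefD coef_theta E1E.
by rewrite coef_map_id0 ?theta0.
Qed.

Lemma E3E p : E3 p = wtheta 0 p + wtheta 1 p + wtheta (1 + 1) p.
Proof.
apply/polyP => i; rewrite peuler_coef ?E2_0 // !coefD /wtheta /= coef_theta E2E.
by rewrite !coef_map_id0 ?theta0 ?map_poly0.
Qed.

Lemma wdeg_euler x : (0 < wdeg x)%Re -> wdeg (wtheta 0 x + wtheta 1 x + wtheta (1 + 1) x) = wdeg x.
Proof.
have H0 : euler_like dC E0.
  move=> y n [h|]; last by rewrite /dC; lra.
  move=> y0; rewrite /E0 add0r; split=> //.
  by rewrite -mulr_natr mulf_neq0 //; move/pcharf0P: charC => ->; rewrite -lt0n.
have H1 : euler_like d1 E1.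
  exact: (peulerP w1_gt0 dCP V0_indep).
have Hc1 y : d1 y = 0%Re -> E1 y = 0.
  by move=> /(pdeg_eq0 w1_gt0 dCP) [e1 _]; rewrite e1 E1E theta_const.
have H2 : euler_like d2 E2.
  exact: (peulerP w2_gt0 d1P V1_indep E1_0 Hc1).
have Hc2 y : d2 y = 0%Re -> E2 y = 0.
  move=> /(pdeg_eq0 w2_gt0 d1P) [e1 /(pdeg_eq0 w1_gt0 dCP) [e2 _]].
  by rewrite e1 e2 E2E theta_const addr0 map_polyC0 ?theta0 // theta_const.
have H3 : euler_like wdeg E3.
  exact: (peulerP w3_gt0 d2P V2_indep E2_0 Hc2).
move=> x0; have xn : x != 0.
  by apply/eqP => h; move: x0; rewrite h (deg_zero wdegP); lra.
by have [|_] := H3 x 0%N _ xn; [right | rewrite mulr0n addr0 E3E].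
Qed.

Definition Xw (i : 'I_3) : P3 C := Xv C i.
Definition ww (i : 'I_3) : R := if val i == 0%N then w1 else if val i == 1%N then w2 else w3.

Lemma pdegX (A : idomainType) (dA : A -> R) w (K : fieldType) (cs : {rmorphism K -> A}) V :
  (0 < w)%Re -> is_degree cs dA V -> pdeg dA w 'X = w.
Proof.
move=> w0 dAP; have h1 : dA 1 = 0%Re by rewrite -(rmorph1 cs) (deg_cst dAP).
apply: Rle_antisym; last first.
  have := @pdeg_ge A dA w 'X 1%N; rewrite coefX eqxx oner_eq0 /= => /(_ isT); dlra dA.
apply: (pdeg_le w0 dAP); first lra.
move=> i; rewrite coefX; case: (i =P 1%N) => [->|_] /=; last by rewrite eqxx.
by rewrite /=; dlra dA.
Qed.

Lemma pdegC (A : idomainType) (dA : A -> R) w (K : fieldType) (cs : {rmorphism K -> A}) V c :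
  (0 < w)%Re -> is_degree cs dA V -> pdeg dA w c%:P = dA c.
Proof.
move=> w0 dAP; have h0 := deg_ge0 dAP c; have hz := deg_zero dAP.
apply: Rle_antisym; last first.
  have [->|c0] := eqVneq c 0; first by rewrite hz; exact: pdeg_ge0.
  by have := @pdeg_ge A dA w c%:P 0%N; rewrite coefC /= => /(_ c0); dlra dA.
apply: (pdeg_le w0 dAP); first dlra dA.
by move=> [|i]; rewrite coefC //= ?eqxx // => _; dlra dA.
Qed.

Lemma wdeg_X i : wdeg (Xw i) = ww i.
Proof.
rewrite /Xw /Xv /ww; case: ifP => _; last case: ifP => _.
- rewrite /wdeg (pdegC _ w3_gt0 d2P) /d2 (pdegC _ w2_gt0 d1P) /d1; exact: (pdegX w1_gt0 dCP).
- rewrite /wdeg (pdegC _ w3_gt0 d2P); exact: (pdegX w2_gt0 d1P).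
- exact: (pdegX w3_gt0 d2P).
Qed.

Lemma Xw_neq0 i : Xw i != 0.
Proof.
rewrite /Xw /Xv; case: ifP => _; last case: ifP => _; rewrite /X1 /X2 /X3 ?polyC_eq0 polyX_eq0 //.
Qed.

Lemma wtheta_div i x : exists y, wtheta i x = Xw i * y.
Proof.
rewrite /wtheta /Xw /Xv; case: ifP => _; last case: ifP => _; last by exists x^`().
- exists (map_poly (map_poly (@deriv C)) x); apply/polyP => k.
  rewrite /X1 coefCM !coef_map_id0 ?map_poly0 ?poly.deriv0 //.
    apply/polyP => j; rewrite coefCM !coef_map_id0 ?theta0 ?poly.deriv0 //.
- exists (map_poly (@deriv {poly C}) x); apply/polyP => k.
  by rewrite /X2 coefCM !coef_map_id0 ?theta0 ?poly.deriv0.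
Qed.

Lemma ww_ge1 i : (1 <= ww i)%Re.
Proof. by rewrite /ww; case: ifP => _ //; case: ifP. Qed.

(** The minor is divisible by the product of the variables with indices [i] and [j], each of weight
    at least 1. *)
Lemma wminor_ge2 i j f g : i != j -> wtheta i f * wtheta j g - wtheta j f * wtheta i g != 0 ->
  (2 <= wdeg (wtheta i f * wtheta j g - wtheta j f * wtheta i g)%R)%Re.
Proof.
have [f1 e1] := wtheta_div i f; have [f2 e2] := wtheta_div j f.
have [g1 e3] := wtheta_div i g; have [g2 e4] := wtheta_div j g.
rewrite e1 e2 e3 e4; have -> : Xw i * f1 * (Xw j * g2) - Xw j * f2 * (Xw i * g1) =
  Xw i * (Xw j * (f1 * g2 - f2 * g1)) by ring.
move=> _ n0; move: (n0); rewrite !mulf_eq0 !negb_or => /and3P [h1 h2 h3].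
rewrite (degM wdegP) ?mulf_neq0 // (degM wdegP) // !wdeg_X.
have := ww_ge1 i; have := ww_ge1 j; have := deg_ge0 wdegP (f1 * g2 - f2 * g1); lra.
Qed.

Definition wmon : P3 C := X1 C * X2 C * X3 C.

Lemma wmonE : wmon = Xw 0 * Xw 1 * Xw (1 + 1). Proof. by []. Qed.

Lemma wmon_neq0 : wmon != 0.
Proof. by rewrite wmonE !mulf_neq0 ?Xw_neq0. Qed.

Lemma wdeg_mon : wdeg wmon = (w1 + w2 + w3)%Re.
Proof.
by rewrite wmonE (degM wdegP) ?(degM wdegP) ?wdeg_X ?mulf_neq0 ?Xw_neq0.
Qed.

Lemma wmon_ge3 : (3 <= wdeg wmon)%Re.
Proof. by rewrite wdeg_mon; lra. Qed.

Lemma wdeg_val x : exists i j k, wdeg x = (INR i * w1 + INR j * w2 + INR k * w3)%Re.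
Proof.
have [->|/(deg_val wdegP)] := eqVneq x 0.
  by exists 0%N, 0%N, 0%N; rewrite (deg_zero wdegP) /=; lra.
move=> [k [? [[j [? [[i [? [-> ->]]] ->]]] ->]]].
by exists i, j, k; lra.
Qed.

(* Below a bound there are finitely many degree values, so strict inequality is well founded. *)
Lemma wdeg_wf (Q : R -> Prop) :
  (forall v, (forall u, (exists x y z : P3 C, u = wdeg x + wdeg y + wdeg z)%Re -> (u < v)%Re -> Q u) -> Q v) ->
  forall v, Q v.
Proof.
move=> H.
pose val v := exists i j k, v = (INR i * w1 + INR j * w2 + INR k * w3)%Re.
have vval u : (exists x y z : P3 C, u = wdeg x + wdeg y + wdeg z)%Re -> val u.
  move=> [x [y [z ->]]].
  have [i [j [k ->]]] := wdeg_val x; have [i' [j' [k' ->]]] := wdeg_val y.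
  have [i2 [j2 [k2 ->]]] := wdeg_val z.
  exists (i + i' + i2)%N, (j + j' + j2)%N, (k + k' + k2)%N.
  by rewrite !plus_INR; lra.
suff K n : forall (s : seq R), (size s <= n)%N ->
   forall v, (forall u, val u -> (u < v)%Re -> List.In u s) -> Q v.
  move=> v; have [N hN] := INR_unbounded v.
  pose l := List.seq 0 N.
  pose s := List.map (fun t : nat * nat * nat =>
     (INR t.1.1 * w1 + INR t.1.2 * w2 + INR t.2 * w3)%Re) (List.list_prod (List.list_prod l l) l).
  apply: (K (size s) s) => // u [i [j [k ->]]] hu.
  have bnd m x : (INR m * 1 <= x)%Re -> (x < v)%Re -> List.In m l.
    move=> h1 h2; apply/List.in_seq; split; first exact: PeanoNat.Nat.le_0_l.
    by apply: INR_lt; rewrite plusE add0n; lra.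
  have mono m x : (1 <= x)%Re -> (INR m * 1 <= INR m * x)%Re.
    by move=> h; apply: Rmult_le_compat_l => //; exact: pos_INR.
  have h1 := mono i _ w1_ge1; have h2 := mono j _ w2_ge1; have h3 := mono k _ w3_ge1.
  have p1 := pos_INR i; have p2 := pos_INR j; have p3 := pos_INR k.
  apply/List.in_map_iff; exists (i, j, k); split=> //.
  apply: List.in_prod; first apply: List.in_prod.
  - by apply: bnd hu; lra.
  - by apply: bnd hu; lra.
  - by apply: bnd hu; lra.
elim: n => [|n IH] s hs v hv.
  apply: H => u /vval hu uv.
  by have := hv u hu uv; move: hs; case: s {hv}.
apply: H => u /vval hu uv.
have us := hv u hu uv.
have [sa [sb es]] := List.in_split u s us.
apply: (IH (sa ++ sb)).
  by move: hs; rewrite es !size_cat /= addnS.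
have vu : forall u', (u' < u)%Re -> (u' < v)%Re by move=> *; lra.
move=> u' hu' h'; have := hv u' hu' (vu _ h'); rewrite es => /(@List.in_app_or _ _ _ _) [h|/= [h|h]].
- by apply: List.in_or_app; left.
- by exfalso; lra.
- by apply: List.in_or_app; right.
Qed.

Definition wctx : ctx C (P3 C).
Proof.
apply: (@Ctx C (P3 C) (c3 : {rmorphism C -> P3 C}) wdeg wtheta wmon).
- exact: (deg_ge0 wdegP).
- exact: (deg_zero wdegP).
- exact: (degD wdegP).
- exact: (degM wdegP).
- exact: (deg_lead wdegP).
- exact: (deg_cst wdegP).
- exact: wthetaP.
- exact: wtheta_cst.
- exact: wtheta_le.
- exact: wtheta_d0.
- exact: wdeg_euler.
- exact: wminor_ge2.
- exact: wmon_neq0.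
- exact: wmon_ge3.
- exact: wdeg_wf.
Defined.

End Instance.

(** * Wedge products and the degree of the Jacobian minors *)

Section Wedge.
Variables (C : fieldType) (P : idomainType) (X : ctx C P).
Hypothesis charC : [pchar C] =i pred0.
Local Notation d := (wd X).
Local Notation cst := (wcst X).
Local Notation th := (wth X).
Local Notation mon := (wmn X).
Local Ltac dl := dlra (wd X).
Implicit Types f g h p q x y : P.

Lemma dN x : d (- x) = d x.
Proof.
have [->|x0] := eqVneq x 0; first by rewrite oppr0.
have H : d (-1) = 0%Re by rewrite -(d_cst X (-1)) rmorphN1.
rewrite -mulN1r dM ?H ?oppr_eq0 ?oner_eq0 //; lra.
Qed.

Lemma dB x y : (d (x - y)%R <= Rmax (d x) (d y))%Re.
Proof. by have := dD X x (- y); rewrite dN. Qed.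

Lemma dM_le x y : (d (x * y)%R <= d x + d y)%Re.
Proof.
have hx := d_ge0 X x; have hy := d_ge0 X y.
have [->|x0] := eqVneq x 0; first by rewrite mul0r d0; dl.
have [->|y0] := eqVneq y 0; first by rewrite mulr0 d0; dl.
by rewrite dM //; lra.
Qed.

Lemma d_pos_neq0 x : (0 < d x)%Re -> x != 0.
Proof. by move=> h; apply/eqP => e; move: h; rewrite e d0; lra. Qed.

Lemma dD_lt x y : (d x < d y)%Re -> d (x + y) = d y.
Proof.
move=> h; apply: Rle_antisym; first by have := dD X x y; dl.
have := dB (x + y) x; rewrite addrAC subrr add0r; dl.
Qed.

Lemma cst_neq0 c : c != 0 -> cst c != 0.
Proof. by rewrite fmorph_eq0. Qed.

Lemma dZ c x : c != 0 -> d (cst c * x) = d x.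
Proof.
move=> c0; have [->|x0] := eqVneq x 0; first by rewrite mulr0.
by rewrite dM ?cst_neq0 // d_cst; lra.
Qed.

Lemma dZ_le c x : (d (cst c * x)%R <= d x)%Re.
Proof. have := dM_le (cst c) x; rewrite d_cst; lra. Qed.

Lemma dX x n : x != 0 -> d (x ^+ n) = (INR n * d x)%Re.
Proof.
move=> x0; elim: n => [|n IH].
  rewrite expr0 /=; have := d_cst X 1; rewrite rmorph1; dl.
by rewrite exprS dM ?expf_neq0 // IH S_INR; lra.
Qed.

Lemma dlead x y : d x = d y -> (0 < d x)%Re -> exists2 c, c != 0 & (d (x - cst c * y)%R < d x)%Re.
Proof.
move=> e h; have x0 := d_pos_neq0 h; have y0 : y != 0 by apply: d_pos_neq0; lra.
have [c hc] := d_lead x0 y0 e.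
have c0 : c != 0.
  apply/eqP => c0; move: hc; rewrite c0 rmorph0 mul0r subr0 => -[hc|hc]; last lra.
  by rewrite hc eqxx in x0.
by exists c => //; case: hc => [->|//]; rewrite d0.
Qed.

Implicit Types u v : 'rV[P]_3.

Definition dv (v : 'rV[P]_3) : R := Rmax (d (v ord0 0)) (Rmax (d (v ord0 1)) (d (v ord0 (1 + 1)))).

Lemma I3E (i : 'I_3) : [\/ i = 0, i = 1 | i = 1 + 1].
Proof.
case: i => [[|[|[|n]]] hn] //.
- by apply: Or31; apply: val_inj.
- by apply: Or32; apply: val_inj.
- by apply: Or33; apply: val_inj.
Qed.

Lemma dv_ge v i : (d (v ord0 i) <= dv v)%Re.
Proof.
rewrite /dv; case: (I3E i) => ->.
- exact: Rmax_l.
- exact: Rle_trans (Rmax_l _ _) (Rmax_r _ _).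
- exact: Rle_trans (Rmax_r _ _) (Rmax_r _ _).
Qed.

Lemma dv_le v t : (forall i, (d (v ord0 i) <= t)%Re) -> (dv v <= t)%Re.
Proof. by move=> H; do 2?[apply: Rmax_lub]; exact: H. Qed.

Lemma dv_attain v : exists i, dv v = d (v ord0 i).
Proof.
rewrite /dv /Rmax; case: Rle_dec => _; last by exists 0.
by case: Rle_dec => _; [exists (1 + 1) | exists 1].
Qed.

Lemma dv_ge0 v : (0 <= dv v)%Re.
Proof. exact: Rle_trans (d_ge0 X _) (dv_ge v 0). Qed.

Lemma dvD u v : (dv (u + v)%R <= Rmax (dv u) (dv v))%Re.
Proof.
apply: dv_le => i; rewrite mxE; apply: Rle_trans (dD X _ _) _.
by apply: Rmax_lub; [apply: Rle_trans (Rmax_l _ _) | apply: Rle_trans (Rmax_r _ _)]; exact: dv_ge.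
Qed.

Lemma dvN v : dv (- v) = dv v.
Proof.
suff H u : (dv (- u)%R <= dv u)%Re.
  by apply: Rle_antisym; [exact: H | rewrite -{1}(opprK v); exact: H].
by apply: dv_le => i; rewrite mxE dN; exact: dv_ge.
Qed.

Lemma dv0 : dv 0 = 0%Re.
Proof. by have [i ->] := dv_attain 0; rewrite mxE d0. Qed.

Lemma dvZ_le p v : (dv (p *: v)%R <= d p + dv v)%Re.
Proof.
apply: dv_le => i; rewrite mxE; have := dM_le p (v ord0 i); have := dv_ge v i; dl.
Qed.

Lemma dvZ p v : p != 0 -> v != 0 -> dv (p *: v) = (d p + dv v)%Re.
Proof.
move=> p0 v0; apply: Rle_antisym; first exact: dvZ_le.
have [i ei] := dv_attain v.
(* The maximum may be attained at a zero entry, as zero has degree 0. Then [dv v] is 0 and any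
   nonzero entry serves instead. *)
have [z|z] := eqVneq (v ord0 i) 0; last first.
  by have := dv_ge (p *: v) i; rewrite mxE dM // ei; dl.
have [j vj] : exists j, v ord0 j != 0.
  case/rV0Pn: v0 => j hj; by exists j.
have := dv_ge (p *: v) j; rewrite mxE dM // ei z d0.
have := d_ge0 X (v ord0 j); dl.
Qed.

Lemma dvD_lt u v : (dv u < dv v)%Re -> dv (u + v) = dv v.
Proof.
move=> h; apply: Rle_antisym; first by have := dvD u v; rmax; dl.
have := dvD (u + v) (- u); rewrite addrAC subrr add0r dvN; rmax; dl.
Qed.

(** Cross product of the logarithmic gradients. Indices are taken modulo 3, so that [det3] is the
    expansion of the determinant along its first row without signs. *)
Definition wdg f g : 'rV[P]_3 :=
  \row_i (th (i + 1) f * th (i + 1 + 1) g - th (i + 1 + 1) f * th (i + 1) g).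
(* The degree of [df /\ dg], measured with logarithmic derivatives. *)
Definition dwdg f g : R := dv (wdg f g).
Local Notation D := dwdg.
Definition det3 f g h : P := \sum_i th i f * wdg g h ord0 i.
(** The ordinary Jacobian determinant is a nonzero constant; passing to logarithmic derivatives
    multiplies it by [mon]. *)
Definition jac f g h : Prop := exists2 c, c != 0 & det3 f g h = cst c * mon.

Lemma thD i x y : th i (x + y) = th i x + th i y.
Proof. exact: (thP X i).1. Qed.
Lemma thM i x y : th i (x * y) = th i x * y + x * th i y.
Proof. exact: (thP X i).2. Qed.
Lemma th0 i : th i 0 = 0.
Proof. exact: derivation0 (thP X i). Qed.
Lemma thN i x : th i (- x) = - th i x.
Proof. by apply/eqP; rewrite -addr_eq0 -thD addNr th0. Qed.
Lemma thZ i c x : th i (cst c * x) = cst c * th i x.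
Proof. by rewrite thM th_cst mul0r add0r. Qed.

Lemma wdgDl f g h : wdg (f + g) h = wdg f h + wdg g h.
Proof. by apply/rowP => i; rewrite !mxE !thD; ring. Qed.
Lemma wdgC f g : wdg f g = - wdg g f.
Proof. by apply/rowP => i; rewrite !mxE; ring. Qed.
Lemma wdgDr f g h : wdg f (g + h) = wdg f g + wdg f h.
Proof. by rewrite wdgC wdgDl opprD -!(wdgC f). Qed.
Lemma wdgxx f : wdg f f = 0.
Proof. by apply/rowP => i; rewrite !mxE; ring. Qed.
Lemma wdgZl c f g : wdg (cst c * f) g = cst c *: wdg f g.
Proof. by apply/rowP => i; rewrite !mxE !thZ; ring. Qed.
Lemma wdgZr c f g : wdg f (cst c * g) = cst c *: wdg f g.
Proof. by rewrite wdgC wdgZl -scalerN -wdgC. Qed.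
Lemma wdg_cstl c g : wdg (cst c) g = 0.
Proof. by apply/rowP => i; rewrite !mxE !th_cst; ring. Qed.
Lemma wdg_cstr c g : wdg g (cst c) = 0.
Proof. by rewrite wdgC wdg_cstl oppr0. Qed.
Lemma wdgNl f g : wdg (- f) g = - wdg f g.
Proof. by apply/rowP => i; rewrite !mxE !thN; ring. Qed.
Lemma D_sym f g : D f g = D g f.
Proof. by rewrite /dwdg wdgC dvN. Qed.

Lemma D_ge0 f g : (0 <= D f g)%Re.
Proof. exact: dv_ge0. Qed.

Lemma D_le f g : (D f g <= d f + d g)%Re.
Proof.
apply: dv_le => i; rewrite mxE; apply: Rle_trans (dB _ _) _.
have := dM_le (th (i + 1) f) (th (i + 1 + 1) g); have := dM_le (th (i + 1 + 1) f) (th (i + 1) g).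
have := th_le X (i + 1) f; have := th_le X (i + 1) g.
have := th_le X (i + 1 + 1) f; have := th_le X (i + 1 + 1) g.
by move=> *; apply: Rmax_lub; lra.
Qed.

Lemma D_ge2 f g : wdg f g != 0 -> (2 <= D f g)%Re.
Proof.
case/rV0Pn => i hi; apply: Rle_trans (dv_ge _ i); move: hi; rewrite mxE => hi.
apply: minor_ge2 hi; by case: (I3E i) => ->.
Qed.

Lemma det3_le f g h : (d (det3 f g h) <= d f + D g h)%Re.
Proof.
have H i : (d (th i f * wdg g h ord0 i)%R <= d f + D g h)%Re.
  have := dM_le (th i f) (wdg g h ord0 i); have := th_le X i f; have := dv_ge (wdg g h) i.
  by rewrite -/(D g h); dl.
rewrite /det3 !big_ord_recl big_ord0 addr0.
apply: Rle_trans (dD _ _ _) _; apply: Rmax_lub; first exact: H.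
by apply: Rle_trans (dD _ _ _) _; apply: Rmax_lub; exact: H.
Qed.

Lemma sum3 (A : nmodType) (F : 'I_3 -> A) : \sum_i F i = F 0 + F 1 + F (1 + 1).
Proof.
rewrite !big_ord_recl big_ord0 addr0 addrA; congr (_ + _ + _); congr F; exact: val_inj.
Qed.

Lemma I3_2 : (1 + 1 + 1 : 'I_3) = 0. Proof. exact: val_inj. Qed.

Lemma det3E f g h : det3 f g h =
  th 0 f * (th 1 g * th (1 + 1) h - th (1 + 1) g * th 1 h) +
  th 1 f * (th (1 + 1) g * th 0 h - th 0 g * th (1 + 1) h) +
  th (1 + 1) f * (th 0 g * th 1 h - th 1 g * th 0 h).
Proof. by rewrite /det3 sum3 !mxE ?add0r I3_2 add0r. Qed.

Lemma det3_rot f g h : det3 f g h = det3 g h f.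
Proof. by rewrite !det3E; ring. Qed.

Lemma det3_swap f g h : det3 g f h = - det3 f g h.
Proof. by rewrite !det3E; ring. Qed.

Lemma jac_rot f g h : jac f g h -> jac g h f.
Proof. by case=> c c0 e; exists c => //; rewrite -det3_rot. Qed.

Lemma jac_swap f g h : jac f g h -> jac g f h.
Proof.
case=> c c0 e; exists (- c); first by rewrite oppr_eq0.
by rewrite det3_swap e rmorphN mulNr.
Qed.

Lemma jac_pos f g h : jac f g h -> (0 < d f)%Re.
Proof.
move=> [c c0 e]; case: (Req_dec (d f) 0) => [h0|]; last by have := d_ge0 X f; dl.
exfalso; move: e; rewrite det3E !(th_d0 _ h0) !mul0r !addr0 => /esym/eqP.
by rewrite mulf_eq0 (negbTE (cst_neq0 c0)) (negbTE (mon_neq0 X)).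
Qed.

Lemma jac_wdg f g h : jac f g h -> wdg g h != 0.
Proof.
move=> [c c0 e]; apply/eqP => h0; move: e; rewrite /det3 h0 big1; last by move=> i _; rewrite mxE mulr0.
by move=> /esym/eqP; rewrite mulf_eq0 (negbTE (cst_neq0 c0)) (negbTE (mon_neq0 X)).
Qed.

(* Contracting df /\ dg /\ dh with the Euler field: of the three numbers below the largest is attained twice. *)
Lemma two_max f g h : jac f g h ->
  (d f + D g h <= Rmax (d g + D f h) (d h + D f g))%Re.
Proof.
move=> J; have f0 := jac_pos J; have J1 := jac_rot J; have J2 := jac_rot J1.
pose e x := th 0 x + th 1 x + th (1 + 1) x.
have id : e f *: wdg g h = (- e g) *: wdg h f + ((- e h) *: wdg f g + det3 f g h *: const_mx 1).
  apply/rowP => i; rewrite !mxE det3E /e; case: (I3E i) => ->; rewrite ?add0r ?I3_2 ?add0r ?mulr1; ring.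
have L : dv (e f *: wdg g h) = (d f + D g h)%Re.
  have ef : d (e f) = d f by exact: euler.
  by rewrite dvZ ?(jac_wdg J) ?ef //; apply: d_pos_neq0; rewrite ef.
have eg : d (e g) = d g by apply: euler; exact: jac_pos J1.
have eh : d (e h) = d h by apply: euler; exact: jac_pos J2.
have h1 : (dv ((- e g) *: wdg h f)%R <= d g + D f h)%Re.
  by have := dvZ_le (- e g) (wdg h f); rewrite dN eg -/(D h f) D_sym.
have h2 : (dv ((- e h) *: wdg f g)%R <= d h + D f g)%Re.
  by have := dvZ_le (- e h) (wdg f g); rewrite dN eh.
(* The determinant term does no harm: after a rotation [det3_le] bounds it by one of the two
   admissible terms. *)
have h3 : (dv (det3 f g h *: const_mx 1 : 'rV[P]_3)%R <= d h + D f g)%Re.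
  apply: dv_le => i; rewrite !mxE mulr1 det3_rot det3_rot; exact: det3_le.
rewrite -L id; apply: Rle_trans (dvD _ _) _; apply: Rmax_lub.
  exact: Rle_trans h1 (Rmax_l _ _).
apply: Rle_trans (dvD _ _) _; apply: Rmax_lub; exact: Rle_trans (Rmax_r _ _).
Qed.

End Wedge.

(** * Subalgebras generated by two polynomials *)

Section Eval.
Variables (C : fieldType) (P : idomainType) (X : ctx C P).
Hypothesis charC : [pchar C] =i pred0.
Local Notation d := (wd X).
Local Notation cst := (wcst X).
Local Notation th := (wth X).
Local Notation mon := (wmn X).
Local Ltac dl := dlra (wd X).
Implicit Types f g h p x y : P.
Implicit Types q : {poly C}.
Implicit Types phi psi : {poly {poly C}}.

Definition evu g : {rmorphism {poly C} -> P} :=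
  (horner_eval g \o map_poly cst : {rmorphism {poly C} -> P}).
(** The outer variable goes to [f] and the inner one to [g]; thus the formal derivative of [phi] is
    the partial derivative in [f]. *)
Definition ev f g : {rmorphism {poly {poly C}} -> P} :=
  (horner_eval f \o map_poly (evu g) : {rmorphism {poly {poly C}} -> P}).

Lemma evuX g : evu g 'X = g.
Proof. by rewrite /= map_polyX /horner_eval hornerX. Qed.
Lemma evuC g c : evu g c%:P = cst c.
Proof. by rewrite /= map_polyC /horner_eval hornerC. Qed.
Lemma evX f g : ev f g 'X = f.
Proof. by rewrite /= map_polyX /horner_eval hornerX. Qed.
Lemma evC f g q : ev f g q%:P = evu g q.
Proof. by rewrite /= map_polyC /horner_eval hornerC. Qed.

Lemma evuE g q : evu g q = \sum_(i < size q) cst q`_i * g ^+ i.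
Proof.
rewrite /= /horner_eval horner_coef size_map_poly; apply: eq_bigr => i _.
by rewrite coef_map.
Qed.

Lemma evE f g phi : ev f g phi = \sum_(i < size phi) evu g phi`_i * f ^+ i.
Proof.
rewrite {1}(_ : phi = \sum_(i < size phi) (phi`_i)%:P * 'X^i); last first.
  by rewrite -{1}[phi]coefK poly_def; apply: eq_bigr => i _; rewrite mul_polyC.
by rewrite rmorph_sum; apply: eq_bigr => i _; rewrite rmorphM rmorphXn evX evC.
Qed.

Lemma th_evu i g q : th i (evu g q) = evu g q^`() * th i g.
Proof.
elim/poly_ind: q => [|q c IH]; first by rewrite derivC !rmorph0 th0 mul0r.
rewrite derivD derivM derivX derivC addr0 mulr1.
rewrite !rmorphD !rmorphM evuX evuC thD thM th_cst IH; ring.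
Qed.

Lemma th_ev i f g phi : th i (ev f g phi) =
  ev f g phi^`() * th i f + ev f g (map_poly (@deriv C) phi) * th i g.
Proof.
elim/poly_ind: phi => [|phi q IH].
  by rewrite derivC map_poly0 !rmorph0 th0 !mul0r addr0.
have e : map_poly (@deriv C) (phi * 'X + q%:P) = map_poly (@deriv C) phi * 'X + q^`()%:P.
  by rewrite raddfD /= map_polyC /= ; congr (_ + _); apply/polyP => k; rewrite coef_map !coefMX /= ;
     case: ifP; rewrite ?linear0 ?coef_map.
rewrite e derivD derivM derivX derivC addr0 mulr1.
rewrite !rmorphD !rmorphM evX !evC thD thM th_evu IH; ring.
Qed.

Lemma wdg_ev f g phi h : wdg X (ev f g phi) h =
  ev f g phi^`() *: wdg X f h + ev f g (map_poly (@deriv C) phi) *: wdg X g h.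
Proof. by apply/rowP => i; rewrite !mxE !th_ev; ring. Qed.

Lemma wdg_evu g q h : wdg X (evu g q) h = evu g q^`() *: wdg X g h.
Proof. by apply/rowP => i; rewrite !mxE !th_evu; ring. Qed.

Lemma det3_ev f g phi h : det3 X (ev f g phi) g h = ev f g phi^`() * det3 X f g h.
Proof. by rewrite !det3E !th_ev; ring. Qed.

Lemma ev_swap f g phi : exists psi, ev g f psi = ev f g phi /\ forall i j, psi`_j`_i = phi`_i`_j.
Proof.
exists (swapXY phi); split; last by move=> i j; rewrite coef_swapXY.
elim/poly_ind: phi => [|phi q IH]; first by rewrite !rmorph0.
have es : swapXY (phi * 'X + q%:P) = swapXY phi * 'X%:P + map_poly polyC q.
  by rewrite (rmorphD swapXY) (rmorphM swapXY) /= swapXY_X swapXY_polyC.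
have eq : ev g f (map_poly polyC q) = evu g q.
  elim/poly_ind: q {es} => [|q c IHq]; first by rewrite map_poly0 !rmorph0.
  have e : map_poly polyC (q * 'X + c%:P) = map_poly polyC q * 'X + c%:P%:P.
    by rewrite rmorphD rmorphM /= map_polyX map_polyC.
  by rewrite e !rmorphD !rmorphM IHq evX evC !evuC evuX.
by rewrite es !rmorphD !rmorphM IH eq evX !evC evuX.
Qed.

Definition sub f g p : Prop := exists phi, p = ev f g phi.

Lemma sub_l f g : sub f g f. Proof. by exists 'X; rewrite evX. Qed.
Lemma sub_r f g : sub f g g. Proof. by exists 'X%:P; rewrite evC evuX. Qed.
Lemma sub_cst f g c : sub f g (cst c). Proof. by exists c%:P%:P; rewrite evC evuC. Qed.
Lemma subD f g x y : sub f g x -> sub f g y -> sub f g (x + y).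
Proof. by move=> [a ->] [b ->]; exists (a + b); rewrite rmorphD. Qed.
Lemma subN f g x : sub f g x -> sub f g (- x).
Proof. by move=> [a ->]; exists (- a); rewrite rmorphN. Qed.
Lemma subB f g x y : sub f g x -> sub f g y -> sub f g (x - y).
Proof. by move=> hx hy; apply: subD => //; exact: subN. Qed.
Lemma subM f g x y : sub f g x -> sub f g y -> sub f g (x * y).
Proof. by move=> [a ->] [b ->]; exists (a * b); rewrite rmorphM. Qed.
Lemma sub0 f g : sub f g 0. Proof. by exists 0; rewrite rmorph0. Qed.
Lemma subX f g x n : sub f g x -> sub f g (x ^+ n).
Proof. by move=> [a ->]; exists (a ^+ n); rewrite rmorphXn. Qed.
Lemma subZ f g c x : sub f g x -> sub f g (cst c * x).
Proof. by move=> h; apply: subM => //; exact: sub_cst. Qed.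
Lemma sub_evu f g h q : sub f g h -> sub f g (evu h q).
Proof.
move=> hh; elim/poly_ind: q => [|q c IH]; first by rewrite rmorph0; exact: sub0.
rewrite rmorphD rmorphM evuX evuC; apply: subD; [exact: subM | exact: sub_cst].
Qed.
Lemma sub_trans f g f' g' p : sub f g f' -> sub f g g' -> sub f' g' p -> sub f g p.
Proof.
move=> hf hg [phi ->]; elim/poly_ind: phi => [|phi q IH]; first by rewrite rmorph0; exact: sub0.
rewrite rmorphD rmorphM evX evC; apply: subD; [exact: subM | exact: sub_evu].
Qed.
Lemma sub_sym f g p : sub f g p -> sub g f p.
Proof. apply: sub_trans; [exact: sub_r | exact: sub_l]. Qed.

Section Cancel.
Variables f g : P.
Hypothesis f0 : (0 < d f)%Re.
Hypothesis g0 : (0 < d g)%Re.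
Hypothesis fg0 : wdg X f g != 0.
Local Notation a := (d f).
Local Notation b := (d g).

Definition mdg (i j : nat) : R := (INR i * a + INR j * b)%Re.

Let fn0 : f != 0. Proof. exact: d_pos_neq0 f0. Qed.
Let gn0 : g != 0. Proof. exact: d_pos_neq0 g0. Qed.

Lemma mdg_ge0 i j : (0 <= mdg i j)%Re.
Proof.
by apply: Rplus_le_le_0_compat; apply: Rmult_le_pos; try exact: pos_INR; lra.
Qed.

Lemma d_monom c i j : c != 0 -> d (cst c * g ^+ j * f ^+ i) = mdg i j.
Proof.
by move=> c0; rewrite dM ?mulf_neq0 ?cst_neq0 ?expf_neq0 // dZ // !dX // /mdg; lra.
Qed.

Lemma d_ev_lt phi v : (0 < v)%Re -> (forall i j, phi`_i`_j != 0 -> (mdg i j < v)%Re) ->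
  (d (ev f g phi) < v)%Re.
Proof.
move=> v0 H; rewrite evE.
elim/big_ind: _ => [|x y hx hy|i _]; first by rewrite d0.
  by have := dD X x y; dl.
rewrite evuE mulr_suml.
elim/big_ind: _ => [|x y hx hy|j _]; first by rewrite d0.
  by have := dD X x y; dl.
have [->|n0] := eqVneq phi`_i`_j 0; first by rewrite rmorph0 !mul0r d0.
by rewrite d_monom //; exact: H.
Qed.

Lemma d_ev_le phi v : (forall i j, phi`_i`_j != 0 -> (mdg i j <= v)%Re) -> (0 <= v)%Re ->
  (d (ev f g phi) <= v)%Re.
Proof.
move=> H v0; apply: Rnot_lt_le => h.
have : (d (ev f g phi) < d (ev f g phi))%Re; last lra.
by apply: d_ev_lt; [lra | move=> i j /H; lra].
Qed.

Local Notation nab := (a + b - dwdg X f g)%Re.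

Lemma nab_ge0 : (0 <= nab)%Re.
Proof. by have := D_le X f g; lra. Qed.

(** The operator [f d/df - k]. It multiplies the monomial [f^i g^j] by [i - k], so in characteristic
    0 it kills exactly the monomials with [i = k]. *)
Definition Top (k : nat) phi : {poly {poly C}} := 'X * phi^`() - phi *+ k.

Lemma coef_Top k phi i j : (Top k phi)`_i`_j = phi`_i`_j * (i%:R - k%:R).
Proof.
rewrite /Top coefB coefXM coefMn coef_deriv coefB coefMn mulrBr !mulr_natr.
by case: i => [|i] /=; rewrite ?coef0 ?mulr0n // coefMn.
Qed.

Lemma Top_neq0 k phi i j : ((Top k phi)`_i`_j != 0) = (phi`_i`_j != 0) && (i != k).
Proof.
rewrite coef_Top mulf_eq0 negb_or; congr (_ && _).
have nz n : (n%:R == 0 :> C) = (n == 0)%N by move/pcharf0P: charC.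
case: (ltngtP i k) => h; last by rewrite h subrr eqxx.
  by rewrite -oppr_eq0 opprB -natrB 1?ltnW // nz subn_eq0 -ltnNge.
by rewrite -natrB 1?ltnW // nz subn_eq0 -ltnNge.
Qed.

(* Applying [f d/df] to a polynomial in [f] and [g] amounts to wedging it with [dg]. *)
Lemma d_deriv_mul phi : (d (f * ev f g phi^`())%R <= d (ev f g phi) + nab)%Re.
Proof.
have hn := nab_ge0.
have [->|n0] := eqVneq (ev f g phi^`()) 0.
  by rewrite mulr0 d0; have := d_ge0 X (ev f g phi); lra.
rewrite dM //; have := D_le X (ev f g phi) g.
by rewrite {1}/dwdg wdg_ev wdgxx scaler0 addr0 dvZ // -/(dwdg X f g); lra.
Qed.

Lemma d_Top k phi : (d (ev f g (Top k phi)) <= d (ev f g phi) + nab)%Re.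
Proof.
have hn := nab_ge0; have h := d_deriv_mul phi.
rewrite /Top rmorphB rmorphM evX -mulr_natl rmorphM rmorph_nat.
have e : k%:R = cst k%:R by rewrite rmorph_nat.
rewrite e; have := dB X (f * ev f g phi^`()) (cst k%:R * ev f g phi).
have := dZ_le X k%:R (ev f g phi); dl.
Qed.

Lemma mdg_inj_r i j j' : mdg i j = mdg i j' -> j = j'.
Proof. by move=> h; apply: INR_eq; apply: (Rmult_eq_reg_r b); rewrite /mdg in h; lra. Qed.

(* The Shestakov-Umirbaev estimate: each operator [Top k] removes one monomial from the part of
   highest formal degree [v], and raises the degree of the value by at most
   [nab = d f + d g - deg (df /\ dg)]; after [N] steps a single monomial is left. *)
Lemma cancel_bound N : forall phi v (s : seq nat), uniq s -> size s = N.+1 ->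
  (forall i j, phi`_i`_j != 0 -> (mdg i j <= v)%Re) ->
  (forall i, i \in s -> exists j, phi`_i`_j != 0 /\ mdg i j = v) ->
  (forall i j, phi`_i`_j != 0 -> mdg i j = v -> i \in s) ->
  (v <= d (ev f g phi) + INR N * nab)%Re.
Proof.
elim: N => [|N IH] phi v [//|i0 s] us ss H1 H2 H3.
  have {ss} ? : s = [::] by case: s ss us H2 H3.
  subst s; have [|j0 [n0 e0]] := H2 i0; first by rewrite inE.
  case: (Rle_lt_dec v 0) => v0; first by have := d_ge0 X (ev f g phi); rewrite /=; lra.
  pose m : {poly {poly C}} := (phi`_i0`_j0 *: 'X^j0)%:P * 'X^i0.
  have em : ev f g m = cst phi`_i0`_j0 * g ^+ j0 * f ^+ i0.
    rewrite /m rmorphM rmorphXn evX evC -mul_polyC rmorphM rmorphXn evuX evuC //.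
  have cm i j : m`_i`_j = if (i == i0) && (j == j0) then phi`_i0`_j0 else 0.
    rewrite /m coefCM coefXn; case: (i =P i0) => _ /=; last by rewrite mulr0 coef0.
    by rewrite mulr1 coefZ coefXn; case: (j =P j0) => _ /=; rewrite ?mulr1 ?mulr0.
  have hlt : (d (ev f g (phi - m)%R) < v)%Re.
    apply: d_ev_lt => // i j; rewrite !coefB cm.
    case: ifP => [/andP [/eqP -> /eqP ->]|hij]; first by rewrite subrr eqxx.
    rewrite subr0 => hn; have := H1 _ _ hn; case: (Req_dec (mdg i j) v) => [e|]; last lra.
    have ii : i = i0 by have := H3 _ _ hn e; rewrite inE => /eqP.
    move: hij; rewrite ii eqxx /= => /eqP; case.
    by apply: (@mdg_inj_r i0); rewrite e0 -ii.
  have e2 : d (ev f g phi) = v.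
    rewrite -(subrK m phi) rmorphD dD_lt; first by rewrite em d_monom.
    by rewrite em d_monom // e0.
  by rewrite e2 /=; lra.
have u' : uniq s /\ i0 \notin s by move: us => /= /andP [].
case: u' => us' is'.
have := IH (Top i0 phi) v s us' _ _ _ _; have := d_Top i0 phi.
have ss' : size s = N.+1 by case: ss.
move=> h1 h2; rewrite S_INR.
suff : (v <= d (ev f g (Top i0 phi)) + INR N * nab)%Re by lra.
apply: h2 => //.
- by move=> i j; rewrite Top_neq0 => /andP [hn _]; exact: H1.
- move=> i hi; have [|j [hj ej]] := H2 i; first by rewrite inE hi orbT.
  exists j; rewrite Top_neq0 hj; split=> //=; by apply: contraNneq is' => <-.
- move=> i j; rewrite Top_neq0 => /andP [hn ni] e.
  by have := H3 _ _ hn e; rewrite inE (negbTE ni).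
Qed.

End Cancel.
End Eval.

(** * Cancellation of leading forms *)

(** The quotients [(i - i0) / q] are [n + 1] distinct natural numbers, so they cannot all be below
    [n]. *)
Lemma spaced_large (s : seq nat) i0 q n : uniq s -> size s = n.+1 -> (0 < q)%N ->
  (forall i, i \in s -> (i0 <= i)%N /\ (q %| i - i0)%N) ->
  exists2 i, i \in s & (i0 + n * q <= i)%N.
Proof.
move=> us ss q0 H; case: (boolP (has (fun i => i0 + n * q <= i)%N s)) => [/hasP [i hi hb]|/hasPn hn].
  by exists i.
have um : uniq [seq ((i - i0) %/ q)%N | i <- s].
  rewrite map_inj_in_uniq // => i j hi hj e.
  have [h1 /divnK h2] := H _ hi; have [h3 /divnK h4] := H _ hj; nia.
have : {subset [seq ((i - i0) %/ q)%N | i <- s] <= iota 0 n}.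
  move=> x /mapP [i hi ->]; rewrite mem_iota add0n /= ltn_divLR //.
  by have := hn _ hi; rewrite -ltnNge; have [] := H _ hi; lia.
by move/(uniq_leq_size um); rewrite size_map size_iota ss ltnn.
Qed.

(** A tie between two monomials makes the two degrees commensurable; [q] and [p] are the differences
    of the exponents in lowest terms. *)
Lemma common_multiple (a b : R) i i' j j' : (0 < a)%Re -> (0 < b)%Re -> (i < i')%N ->
  (INR i * a + INR j * b = INR i' * a + INR j' * b)%Re ->
  exists p q, [/\ (0 < p)%N, (0 < q)%N, coprime p q & (INR q * a = INR p * b)%Re].
Proof.
move=> a0 b0 ii e; have hi : (INR i < INR i')%Re by apply: lt_INR; apply/ssrnat.ltP.
have jj : (j' < j)%N.
  apply/ssrnat.ltP; apply: INR_lt; apply: Rnot_le_lt => h.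
  have h1 : (INR i * a < INR i' * a)%Re by apply: Rmult_lt_compat_r.
  have h2 : (INR j * b <= INR j' * b)%Re by apply: Rmult_le_compat_r => //; lra.
  lra.
pose m := (i' - i)%N; pose n := (j - j')%N.
have e1 : (INR m * a = INR n * b)%Re.
  by rewrite /m /n !minus_INR; [lra | apply/ssrnat.leP; lia | apply/ssrnat.leP; lia].
have g0 : (0 < gcdn m n)%N by rewrite gcdn_gt0 /m; lia.
have hm : m = (m %/ gcdn m n * gcdn m n)%N by rewrite divnK // dvdn_gcdl.
have hn : n = (n %/ gcdn m n * gcdn m n)%N by rewrite divnK // dvdn_gcdr.
have m0 : (0 < m)%N by rewrite /m; lia.
have n0 : (0 < n)%N by rewrite /n; lia.
exists (n %/ gcdn m n)%N, (m %/ gcdn m n)%N; split.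
- by move: n0; rewrite {1}hn; case: (n %/ gcdn m n)%N.
- by move: m0; rewrite {1}hm; case: (m %/ gcdn m n)%N.
- rewrite /coprime -(eqn_pmul2r g0) muln_gcdl -hn -hm mul1n gcdnC //.
have G : (0 < INR (gcdn m n))%Re by apply: lt_0_INR; apply/ssrnat.ltP.
apply: (Rmult_eq_reg_r (INR (gcdn m n))); last lra.
have em : INR m = (INR (m %/ gcdn m n)%N * INR (gcdn m n))%Re by rewrite -mult_INR multE -hm.
have en : INR n = (INR (n %/ gcdn m n)%N * INR (gcdn m n))%Re by rewrite -mult_INR multE -hn.
by move: e1; rewrite em en; lra.
Qed.

Section Dichotomy.
Variables (C : fieldType) (P : idomainType) (X : ctx C P).
Hypothesis charC : [pchar C] =i pred0.
Local Notation d := (wd X).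
Local Notation D := (dwdg X).
Local Notation cst := (wcst X).
Local Ltac dl := dlra (wd X).
Implicit Types f g h x y : P.
Implicit Types phi : {poly {poly C}}.

Local Notation ev := (ev X).

(** The maximal formal degree is [pdeg] with weights [d f] and [d g]. Attaining it requires
    independence of the inner weight only, where the coefficients all have degree 0. *)
Lemma mdg_max f g phi : (0 < d f)%Re -> (0 < d g)%Re -> phi != 0 -> exists i0 j0,
  phi`_i0`_j0 != 0 /\ forall i j, phi`_i`_j != 0 -> (mdg X f g i j <= mdg X f g i0 j0)%Re.
Proof.
move=> f0 g0 p0.
have ind (x y : R) i j : x = 0%Re -> y = 0%Re -> (INR i * d g + x = INR j * d g + y)%Re -> i = j.
  by move=> -> -> h; apply: INR_eq; apply: (Rmult_eq_reg_r (d g)); lra.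
have P1 : is_degree (polyC : {rmorphism C -> {poly C}}) (pdeg (fun _ : C => 0%Re) (d g)) _ := pdegP g0 (dCP C) ind.
have [i0 [i0n e0]] := pdeg_attain f0 P1 p0.
have [j0 [j0n e1]] := pdeg_attain g0 (dCP C) i0n.
exists i0, j0; split=> // i j hn.
have pn : phi`_i != 0 by apply: contraNneq hn => ->; rewrite coef0.
have := @pdeg_ge _ (pdeg (fun _ => 0%Re) (d g)) (d f) phi i pn.
have := @pdeg_ge _ (fun _ : C => 0%Re) (d g) phi`_i j hn.
rewrite e0 e1 /mdg => h1 h2.
have := Rle_trans _ _ _ (Rplus_le_compat_l (INR i * d f) _ _ h1) h2; lra.
Qed.

Definition Reqb (x y : R) : bool := if Req_EM_T x y then true else false.
Lemma ReqbP (x y : R) : reflect (x = y) (Reqb x y).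
Proof. by rewrite /Reqb; case: Req_EM_T => h; constructor. Qed.

(** The [f]-exponents of the monomials of top formal degree [v] differ by multiples of [q]. If there
    are [n + 1 >= 2] of them, then [v >= n l] with [l = q d f], and [v <= d (ev f g phi) + n nab]
    from [cancel_bound] gives [l - nab] as lower bound. If one exponent is first removed by [Top k],
    only [n - 1] summands [nab] are lost, so [Top k phi] has value of degree at least [l]; when
    [ev f g phi] itself lies below [l], this degree must come from [f] times the derivative. *)
Lemma cancel_dichotomy f g phi : (0 < d f)%Re -> (0 < d g)%Re -> wdg X f g != 0 ->
  (forall i j, phi`_i`_j != 0 -> (mdg X f g i j <= d (ev f g phi))%Re) \/
  exists p q, [/\ (0 < p)%N, (0 < q)%N, coprime p q, (INR q * d f = INR p * d g)%Re &
    (d f + d g - D f g <= INR q * d f)%Re ->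
    (INR q * d f - (d f + d g - D f g) <= d (ev f g phi))%Re /\
    ((d (ev f g phi) < INR q * d f)%Re -> ev f g phi^`() != 0 /\
       (INR q * d f <= d f + d (ev f g phi^`()))%Re)].
Proof.
move=> f0 g0 fg0.
have nz : (0 <= d f + d g - D f g)%Re by exact: nab_ge0.
set nab := (d f + d g - D f g)%Re in nz *.
have [->|p0] := eqVneq phi 0; first by left=> i j; rewrite !coef0 eqxx.
have [i0 [j0 [hn hmax]]] := mdg_max f0 g0 p0.
set v := mdg X f g i0 j0 in hmax.
pose T i := has (fun j => (phi`_i`_j != 0) && Reqb (mdg X f g i j) v) (iota 0 (size phi`_i)).
pose s := [seq i <- iota 0 (size phi) | T i].
have H2 i : i \in s -> exists j, phi`_i`_j != 0 /\ mdg X f g i j = v.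
  by rewrite mem_filter => /andP [/hasP [j _ /andP [h1 /ReqbP h2]] _]; exists j.
have H3 i j : phi`_i`_j != 0 -> mdg X f g i j = v -> i \in s.
  move=> h1 h2; rewrite mem_filter mem_iota add0n leq0n /=; apply/andP; split.
    apply/hasP; exists j; last by rewrite h1; apply/ReqbP.
    rewrite mem_iota add0n leq0n /= ltnNge; apply: contra h1 => h1.
    by rewrite [_`_j]nth_default.
  rewrite ltnNge; apply: contra h1 => h1.
  by rewrite [phi`_i]nth_default ?coef0.
have us : uniq s by rewrite filter_uniq // iota_uniq.
have srt : sorted ltn s by apply: sorted_filter; [exact: ltn_trans | exact: iota_ltn_sorted].
case es : s => [|k s1]; first by have := H3 _ _ hn erefl; rewrite es.
case: s1 es => [|k1 s1] es.
  left=> i j /hmax h; apply: Rle_trans h _.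
  have := @cancel_bound _ _ X charC f g f0 g0 fg0 0%N phi v s us.
  by rewrite es /= -es => /(_ erefl hmax H2 H3); rewrite Rmult_0_l; lra.
right.
have kin : k \in s by rewrite es inE eqxx.
have k1in : k1 \in s by rewrite es !inE eqxx orbT.
have kmin i : i \in s -> (k <= i)%N.
  move: srt; rewrite es /= => /andP [hk hp]; rewrite inE => /orP [/eqP -> //|hi].
  have : all (ltn k) (k1 :: s1) by apply: (order_path_min ltn_trans); rewrite /= hk hp.
  by move/allP => /(_ _ hi) /ltnW.
have kk1 : (k < k1)%N by move: srt; rewrite es /= => /andP [].
have [jk [jk0 ejk]] := H2 _ kin; have [jk1 [_ ejk1]] := H2 _ k1in.
have [|p [q [pp qp cop epq]]] := @common_multiple (d f) (d g) k k1 jk jk1 f0 g0 kk1.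
  by move: ejk ejk1; rewrite /mdg; lra.
exists p, q; split=> // hnab.
set l := (INR q * d f)%Re in hnab *.
have dvd i : i \in s -> (k <= i)%N /\ (q %| i - k)%N.
  move=> hi; have ki := kmin _ hi; split=> //.
  have [ji [_ eji]] := H2 _ hi.
  have e1 : (INR (i - k) * d f = (INR jk - INR ji) * d g)%Re.
    by rewrite minus_INR; [move: ejk eji; rewrite /mdg; lra | apply/ssrnat.leP].
  have le : (ji <= jk)%N.
    apply/ssrnat.leP; apply: INR_le; apply: Rnot_lt_le => h.
    have : (0 <= INR (i - k) * d f)%Re by apply: Rmult_le_pos; [exact: pos_INR | lra].
    have : (0 < (INR ji - INR jk) * d g)%Re by apply: Rmult_lt_0_compat; lra.
    lra.
  have e2 : ((i - k) * p = (jk - ji) * q)%N.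
    apply: INR_eq; rewrite !mult_INR (minus_INR jk); last by apply/ssrnat.leP.
    apply: (Rmult_eq_reg_r (d g)); last lra.
    rewrite !Rmult_assoc -epq.
    transitivity (INR q * (INR (i - k) * d f))%Re; first lra.
    rewrite e1; lra.
  by rewrite -(@Gauss_dvdl q (i - k) p) 1?coprime_sym // e2 dvdn_mull.
have ss : size s = (size s1).+2 by rewrite es.
have [i hi hib] := spaced_large us ss qp dvd.
have vl : (INR (size s1).+1 * l <= v)%Re.
  have [ji [_ <-]] := H2 _ hi; rewrite /mdg /l.
  have h1 : (INR ((size s1).+1 * q)%N <= INR i)%Re by apply: le_INR; apply/ssrnat.leP; lia.
  have h2 : (INR ((size s1).+1 * q)%N * d f <= INR i * d f)%Re by apply: Rmult_le_compat_r; lra.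
  have h3 : (0 <= INR ji * d g)%Re by apply: Rmult_le_pos; [exact: pos_INR | lra].
  by move: h2; rewrite mult_INR; lra.
have n0 := pos_INR (size s1).
have B0 := @cancel_bound _ _ X charC f g f0 g0 fg0 (size s1).+1 phi v s us ss hmax H2 H3.
rewrite -/nab in B0.
have ln : (0 <= INR (size s1) * (l - nab))%Re by apply: Rmult_le_pos; lra.
move: vl B0; rewrite !S_INR => vl B0; split; first lra.
move=> hd.
have B1 : (v <= d (ev f g (Top k phi)) + INR (size s1) * nab)%Re.
  apply: (@cancel_bound _ _ X charC f g f0 g0 fg0 (size s1) (Top k phi) v (k1 :: s1)).
  - by move: us; rewrite es => /= /andP [].
  - by [].
  - by move=> i' j; rewrite Top_neq0 // => /andP [h _]; exact: hmax.
  - move=> i' hi'; have [|j [hj ej]] := H2 i'; first by rewrite es inE hi' orbT.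
    exists j; rewrite Top_neq0 // hj; split=> //=.
    by apply: contraTneq hi' => ->; move: us; rewrite es => /= /andP [].
  - move=> i' j; rewrite Top_neq0 // => /andP [h ni] e.
    by have := H3 _ _ h e; rewrite es inE (negbTE ni).
have l0 : (0 < l)%Re by apply: Rmult_lt_0_compat => //; apply: lt_0_INR; apply/ssrnat.ltP.
have hT : (l <= d (f * ev f g phi^`())%R)%Re.
  apply: Rnot_lt_le => h.
  have e : ev f g (Top k phi) = f * ev f g phi^`() - cst k%:R * ev f g phi.
    by rewrite /Top rmorphB rmorphM evX -[phi *+ k]mulr_natl rmorphM !rmorph_nat.
  have := dB X (f * ev f g phi^`()) (cst k%:R * ev f g phi).
  have := dZ_le X k%:R (ev f g phi); rewrite -e; dl.
have en : ev f g phi^`() != 0.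
  by apply/eqP => e; move: hT; rewrite e mulr0 d0; lra.
by split=> //; move: hT; rewrite dM //; apply: d_pos_neq0 f0.
Qed.

End Dichotomy.

Lemma coprime_uniq (p q p' q' : nat) : (0 < q)%N -> (0 < q')%N -> coprime p q -> coprime p' q' ->
  (p * p' = q * q')%N -> p = q' /\ q = p'.
Proof.
move=> q0 q0' c1 c2 e.
have h1 : (p %| q')%N by rewrite -(Gauss_dvdr _ c1) -e dvdn_mulr.
have h2 : (q' %| p)%N by rewrite -(@Gauss_dvdl q' p p') 1?coprime_sym // e dvdn_mull.
have pq : p = q' by apply/eqP; rewrite eqn_dvd h1 h2.
by split=> //; move: e; rewrite pq [(q * q')%N]mulnC => /eqP; rewrite eqn_pmul2l // => /eqP.
Qed.

Lemma INR_ge m n : (m <= n)%N -> (INR m <= INR n)%Re.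
Proof. by move=> h; apply: le_INR; apply/ssrnat.leP. Qed.

Lemma INR_mul_ge m n (a : R) : (0 <= a)%Re -> (m <= n)%N -> (INR m * a <= INR n * a)%Re.
Proof. by move=> a0 h; apply: Rmult_le_compat_r => //; exact: INR_ge. Qed.

Lemma INR_ge2 n : (2 <= n)%N -> (2 <= INR n)%Re.
Proof. by move/INR_ge; rewrite !S_INR /=; lra. Qed.

Lemma INR2_mul_le (b : R) q : (0 <= b)%Re -> (2 <= q)%N -> (2 * b <= INR q * b)%Re.
Proof. by move=> b0 q2; have := INR_mul_ge b0 q2; rewrite [INR 2]/=; lra. Qed.

(** * Degrees of elements of a subalgebra with two generators *)

Section Plane.
Variables (C : fieldType) (P : idomainType) (X : ctx C P).
Hypothesis charC : [pchar C] =i pred0.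
Local Notation d := (wd X).
Local Notation D := (dwdg X).
Local Notation cst := (wcst X).
Local Notation mon := (wmn X).
Local Notation ev := (ev X).
Local Notation evu := (evu X).
Local Notation sub := (sub X).
Local Notation jac := (jac X).
Local Notation wdg := (wdg X).
Local Ltac dl := dlra (wd X).
Implicit Types f g h x y z : P.
Implicit Types phi : {poly {poly C}}.

(* [l] is the common multiple of the degrees at which cancellation can take place. *)
Definition SU f g x (l : R) : Prop :=
  (l - (d f + d g - D f g) <= d x)%Re /\
  ((d x < l)%Re ->
   [/\ (l - d f + D f g <= D x g)%Re, (l - d g + D f g <= D x f)%Re &
     forall h, jac f g h -> (l - d f + d mon <= d x + D g h)%Re /\ (l - d g + d mon <= d x + D f h)%Re]).

(* Non-cancelling: the monomials of some presentation of [x] have degree at most [d x]. *)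
Definition NC f g x : Prop :=
  exists phi, x = ev f g phi /\ forall i j, phi`_i`_j != 0 -> (mdg X f g i j <= d x)%Re.

(** By the chain rule, wedging [ev f g phi] with [dg] leaves only its derivative in [f] times
    [df /\ dg]. A lower bound for that derivative therefore passes to [D] and, through the Jacobian
    determinant, to [D g h]. *)
Lemma cancel_one f g phi l : (0 < d f)%Re -> wdg f g != 0 ->
  ev f g phi^`() != 0 -> (l <= d f + d (ev f g phi^`()))%Re ->
  (l - d f + D f g <= D (ev f g phi) g)%Re /\
  (forall h, jac f g h -> (l - d f + d mon <= d (ev f g phi) + D g h)%Re).
Proof.
move=> f0 fg0 en hl; split.
  by rewrite {2}/dwdg wdg_ev wdgxx scaler0 addr0 dvZ // -/(D f g); lra.
move=> h [c c0 e]; have := det3_le X (ev f g phi) g h.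
rewrite det3_ev e dM ?mulf_neq0 ?cst_neq0 ?mon_neq0 // dZ //; lra.
Qed.

(** The two halves of [SU] come from [cancel_dichotomy] for [phi] and for the presentation with [f]
    and [g] exchanged; coprimality makes the two common multiples equal. *)
Lemma sub_dichotomy f g x : (0 < d f)%Re -> (0 < d g)%Re -> wdg f g != 0 -> sub f g x ->
  NC f g x \/ exists p q, [/\ (0 < p)%N, (0 < q)%N, coprime p q, (INR q * d f = INR p * d g)%Re &
    (d f + d g - D f g <= INR q * d f)%Re -> SU f g x (INR q * d f)].
Proof.
move=> f0 g0 fg0 [phi ->].
have gf0 : wdg g f != 0 by rewrite wdgC oppr_eq0.
have [psi [epsi cpsi]] := ev_swap X f g phi.
case: (cancel_dichotomy charC phi f0 g0 fg0) => [h|[p [q [p0 q0 cop epq H]]]].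
  by left; exists phi.
case: (cancel_dichotomy charC psi g0 f0 gf0) => [h|[p' [q' [p0' q0' cop' epq' H']]]].
  left; exists phi; split=> // i j hn.
  by have := h j i; rewrite cpsi epsi => /(_ hn); rewrite /mdg; lra.
right; exists p, q; split=> // hnab.
have [ep eq] : p = q' /\ q = p'.
  apply: coprime_uniq => //; apply: INR_eq; rewrite !mult_INR.
  apply: (Rmult_eq_reg_r (d f)); last lra.
  apply: (Rmult_eq_reg_r (d g)); last lra.
  transitivity ((INR p * d g) * (INR p' * d f))%Re; first lra.
  by rewrite -epq -epq'; lra.
have el : (INR q' * d g = INR q * d f)%Re by rewrite -ep -epq.
have [h1 h2] := H hnab.
split=> [//|hl]; have [n1 m1] := h2 hl.
rewrite el (D_sym X g f) epsi in H'.
have [_ h3] := H' ltac:(move: hnab; lra).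
have [n2 m2] := h3 hl.
have [a1 b1] := cancel_one f0 fg0 n1 m1.
have [a2 b2] := cancel_one g0 gf0 n2 m2.
move: a2 b2; rewrite epsi (D_sym X g f) => a2 b2.
by split=> // h J; split; [exact: b1 | exact/b2/jac_swap].
Qed.

(** If both exponents are at least 2, the common multiple is at least [d f + d g] and the side
    condition of the dichotomy holds automatically. An exponent 1 means that one degree is a
    multiple of the other; then a power of one generator can be used to lower the other. *)
Lemma sub_cases f g x : (0 < d f)%Re -> (0 < d g)%Re -> wdg f g != 0 -> sub f g x ->
  [\/ NC f g x, exists2 m, (1 <= m)%N & d f = (INR m * d g)%Re,
      exists2 m, (1 <= m)%N & d g = (INR m * d f)%Re |
      exists p q, [/\ (2 <= p)%N, (2 <= q)%N, coprime p q, (INR q * d f = INR p * d g)%Re &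
        SU f g x (INR q * d f)]].
Proof.
move=> f0 g0 fg0 /(sub_dichotomy f0 g0 fg0) [h|[p [q [p0 q0 cop e H]]]]; first by constructor 1.
case: (ltnP 1 q) => q2; last first.
  have eq : q = 1%N by lia.
  by constructor 2; exists p => //; move: e; rewrite eq /=; lra.
case: (ltnP 1 p) => p2; last first.
  have ep : p = 1%N by lia.
  by constructor 3; exists q => //; move: e; rewrite ep /=; lra.
constructor 4; exists p, q; split=> //; apply: H.
have hq := INR_ge2 q2.
have hp := INR_ge2 p2.
have h1 : (2 * d f <= INR q * d f)%Re by apply: Rmult_le_compat_r; lra.
have h2 : (2 * d g <= INR p * d g)%Re by apply: Rmult_le_compat_r; lra.
have := D_ge0 X f g; lra.
Qed.

Lemma d_evu g (q : {poly C}) : (0 < d g)%Re -> d (evu g q) = (INR (size q).-1 * d g)%Re.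
Proof.
move=> g0; elim/poly_ind: q => [|q c IH]; first by rewrite rmorph0 d0 size_poly0 /=; lra.
rewrite rmorphD rmorphM evuX evuC size_MXaddC.
case: ifP => [/andP [/eqP -> /eqP ->]|h].
  by rewrite rmorph0 mul0r add0r rmorph0 d0 /=; lra.
have [q0|q0] := eqVneq q 0.
  by rewrite q0 rmorph0 mul0r add0r d_cst size_poly0 /=; lra.
have sq : (0 < size q)%N by rewrite size_poly_gt0.
have e0 : evu g q != 0.
  have [s1|s1] := leqP (size q) 1.
    have := size1_polyC s1 => eq; rewrite eq evuC cst_neq0 //.
    by apply: contra q0 => /eqP z; rewrite eq z.
  apply: (@d_pos_neq0 _ _ X); rewrite IH; apply: Rmult_lt_0_compat => //; apply: lt_0_INR; apply/ssrnat.ltP.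
  by case: (size q) s1 => [|[]].
have E : d (evu g q * g) = (INR (size q) * d g)%Re.
  rewrite dM ?(d_pos_neq0 g0) // IH -[in RHS](prednK sq) S_INR; lra.
rewrite addrC dD_lt E //= d_cst; apply: Rmult_lt_0_compat => //; apply: lt_0_INR; exact/ssrnat.ltP.
Qed.

Lemma evu_deriv_deg g (q : {poly C}) : (0 < d g)%Re -> (1 < size q)%N ->
  evu g q^`() != 0 /\ d (evu g q^`()) = (INR (size q).-2 * d g)%Re.
Proof.
move=> g0 sq.
have sd : size q^`() = (size q).-1.
  have nz n : (n%:R == 0 :> C) = (n == 0)%N by move/pcharf0P: charC.
  apply/eqP; rewrite eqn_leq; apply/andP; split.
    by rewrite -ltnS prednK ?lt_size_deriv // -?size_poly_gt0; lia.
  have : (q^`())`_(size q).-2 != 0.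
    rewrite coef_deriv -mulr_natr mulf_neq0 //.
      have -> : (size q).-2.+1 = (size q).-1 by lia.
      by rewrite -lead_coefE lead_coef_eq0 -size_poly_gt0; exact: ltnW sq.
    by rewrite nz.
  move=> h; rewrite leqNgt; apply: contra h => h; rewrite nth_default //.
  by case: (size q) sq h => [|[|n]].
split; last by rewrite d_evu // sd.
have h := d_evu q^`() g0; rewrite sd in h.
case: (ltnP 2 (size q)) => s2.
  apply: (@d_pos_neq0 _ _ X); rewrite h; apply: Rmult_lt_0_compat => //; apply: lt_0_INR; apply/ssrnat.ltP.
  by case: (size q) s2 => [|[|[|n]]].
have s1 : (size q^`() <= 1)%N by rewrite sd; case: (size q) s2 sq => [|[|[|n]]].
rewrite (size1_polyC s1) evuC cst_neq0 //; apply/eqP => z.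
have : q^`() = 0 by rewrite (size1_polyC s1) z.
by move/(congr1 (size \o polyseq)); rewrite /= size_poly0 sd; case: (size q) sq => [|[|n]].
Qed.

Lemma NC_attain f g x : (0 < d f)%Re -> (0 < d g)%Re -> NC f g x -> (0 < d x)%Re ->
  exists i j, d x = (INR i * d f + INR j * d g)%Re.
Proof.
move=> f0 g0 [phi [e H]] x0.
have p0 : phi != 0 by apply: contraTneq (d_pos_neq0 x0) => z; rewrite e z rmorph0 eqxx.
have [i [j [hn hm]]] := mdg_max f0 g0 p0.
exists i, j; apply: Rle_antisym; last exact: H.
rewrite [X in (d X <= _)%Re]e; apply: d_ev_le => //; exact: mdg_ge0.
Qed.

(** The bounds on [d x] leave no room for [f^2] or [f g], so the presentation is linear in [f] with
    constant coefficient. *)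
Lemma NC_split f g x : (0 < d f)%Re -> (0 < d g)%Re -> NC f g x ->
  (d x < 2 * d f)%Re -> (d x < d f + d g)%Re ->
  exists c q, x = cst c * f + evu g q /\ (c != 0 -> (d f <= d x)%Re).
Proof.
move=> f0 g0 [phi [e H]] h1 h2; exists phi`_1`_0, phi`_0.
have Z i j : phi`_i`_j != 0 -> i = 0%N \/ (i = 1%N /\ j = 0%N).
  move=> hn; have := H _ _ hn; rewrite /mdg.
  have mono m n : (m <= i)%N -> (n <= j)%N -> (INR m * d f + INR n * d g <= INR i * d f + INR j * d g)%Re.
    by move=> hm hn'; apply: Rplus_le_compat; apply: INR_mul_ge => //; lra.
  case: (posnP i) => [-> _|i0]; first by left.
  case: (ltnP 1 i) => i1; first by move=> h; exfalso; have := mono 2%N 0%N i1 isT; rewrite /=; lra.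
  case: (posnP j) => [-> _|j0]; first by right; split=> //; lia.
  by move=> h; exfalso; have := mono 1%N 1%N i0 j0; rewrite /=; lra.
split; last by move=> hc; have := H _ _ hc; rewrite /mdg /=; lra.
have ephi : phi = (phi`_1`_0)%:P%:P * 'X + (phi`_0)%:P.
  apply/polyP => i; apply/polyP => j.
  rewrite coefD coefMX coefC; case: i => [|[|i]] /=.
  - by rewrite add0r.
  - rewrite addr0 coefC /= coefC; case: j => [|j] //=.
    by apply/eqP/negP => /negP /Z [//|[_ //]].
  - rewrite addr0 coefC /= coef0.
    by apply/eqP/negP => /negP /Z [//|[//]].
by rewrite e {1}ephi rmorphD rmorphM evX !evC evuC.
Qed.

Lemma NC_uni f g x : (0 < d f)%Re -> (0 < d g)%Re -> NC f g x -> (d x < d f)%Re -> exists q, x = evu g q.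
Proof.
move=> f0 g0 h hx; have [||c [q [e hc]]] := NC_split f0 g0 h; try lra.
exists q; rewrite e; have [->|/hc] := eqVneq c 0; last lra.
by rewrite rmorph0 mul0r add0r.
Qed.

Lemma NC_const f g x : (0 < d f)%Re -> (0 < d g)%Re -> NC f g x -> (d x < d f)%Re -> (d x < d g)%Re ->
  exists c, x = cst c.
Proof.
move=> f0 g0 h hx hy; have [q e] := NC_uni f0 g0 h hx.
have sq : (size q <= 1)%N.
  rewrite leqNgt; apply/negP => s2; move: hy; rewrite e d_evu //.
  have s1 : (1 <= (size q).-1)%N by case: (size q) s2 => [|[|n]].
  have := @INR_mul_ge 1 (size q).-1 (d g) ltac:(lra) s1; rewrite /=; lra.
by exists q`_0; rewrite e {1}(size1_polyC sq) evuC.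
Qed.

Lemma d_ind (Q : P -> Prop) : (forall x, (forall y, (d y < d x)%Re -> Q y) -> Q x) -> forall x, Q x.
Proof.
move=> H; suff K : forall v, forall x, d x = v -> Q x by move=> x; exact: (K (d x)).
apply: (@d_wf _ _ X (fun v => forall x, d x = v -> Q x)) => v IH x ex; apply: H => y hy.
apply: (IH (d y)) => //; last by rewrite -ex.
by exists y, 0, 0; rewrite d0; lra.
Qed.

Lemma coset_min (S : P -> Prop) : (forall u v, S u -> S v -> S (u + v)) -> S 0 -> forall x,
  exists y, S (y - x) /\ forall z, S (z - y) -> (d y <= d z)%Re.
Proof.
move=> SD S0; elim/d_ind => x IH.
case: (classic (exists2 z, S (z - x) & (d z < d x)%Re)) => [[z h1 h2]|h].
  have [y [hy1 hy2]] := IH z h2.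
  by exists y; split=> //; rewrite -(subrK z y) -addrA; apply: SD.
exists x; split; first by rewrite subrr.
by move=> z hz; apply: Rnot_lt_le => hlt; apply: h; exists z.
Qed.

End Plane.

(** * Affine changes of coordinates *)

Section Affine.
Variables (C : fieldType) (P : idomainType) (X : ctx C P).
Hypothesis charC : [pchar C] =i pred0.
Local Notation d := (wd X).
Local Notation D := (dwdg X).
Local Notation cst := (wcst X).
Local Notation mon := (wmn X).
Local Notation evu := (evu X).
Local Notation sub := (sub X).
Local Notation jac := (jac X).
Local Notation wdg := (wdg X).
Local Notation SU := (SU X).
Local Notation NC := (NC X).
Local Ltac dl := dlra (wd X).
Implicit Types f g h x y z u v w : P.

Definition aff2 f g x := exists a b e, x = cst a * f + cst b * g + cst e.
Definition aff3 f g h x := exists a b c e, x = cst a * f + cst b * g + cst c * h + cst e.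

Lemma cstV (c : C) : c != 0 -> cst c^-1 * cst c = 1.
Proof. by move=> c0; rewrite -rmorphM mulVf // rmorph1. Qed.

Lemma cst_solve (l k : C) : l != 0 -> exists a, cst l * cst a = cst k.
Proof. by move=> l0; exists (l^-1 * k); rewrite -rmorphM mulrA mulfV // mul1r. Qed.

Section AffineSpan.
Variables f g h : P.
Lemma aff3_1 : aff3 f g h f. Proof. by exists 1, 0, 0, 0; rewrite rmorph1 rmorph0; ring. Qed.
Lemma aff3_2 : aff3 f g h g. Proof. by exists 0, 1, 0, 0; rewrite rmorph1 rmorph0; ring. Qed.
Lemma aff3_3 : aff3 f g h h. Proof. by exists 0, 0, 1, 0; rewrite rmorph1 rmorph0; ring. Qed.
Lemma aff3_c c : aff3 f g h (cst c). Proof. by exists 0, 0, 0, c; rewrite rmorph0; ring. Qed.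
Lemma aff3D x y : aff3 f g h x -> aff3 f g h y -> aff3 f g h (x + y).
Proof.
move=> [a [b [c [e ->]]]] [a' [b' [c' [e' ->]]]].
by exists (a + a'), (b + b'), (c + c'), (e + e'); rewrite !rmorphD; ring.
Qed.
Lemma aff3Z k x : aff3 f g h x -> aff3 f g h (cst k * x).
Proof.
move=> [a [b [c [e ->]]]].
by exists (k * a), (k * b), (k * c), (k * e); rewrite !rmorphM; ring.
Qed.
Lemma aff3N x : aff3 f g h x -> aff3 f g h (- x).
Proof. by move=> /(aff3Z (-1)); rewrite rmorphN1 mulN1r. Qed.
Lemma aff3B x y : aff3 f g h x -> aff3 f g h y -> aff3 f g h (x - y).
Proof. by move=> hx /aff3N hy; exact: aff3D. Qed.
End AffineSpan.

Lemma aff3_trans f g h f' g' h' x : aff3 f g h f' -> aff3 f g h g' -> aff3 f g h h' ->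
  aff3 f' g' h' x -> aff3 f g h x.
Proof.
move=> h1 h2 h3 [a [b [c [e ->]]]].
by apply: aff3D; [apply: aff3D; [apply: aff3D |] | exact: aff3_c]; exact: aff3Z.
Qed.

Lemma aff2_aff3 f g h x : aff2 f g x -> aff3 f g h x.
Proof. by move=> [a [b [e ->]]]; exists a, b, 0, e; rewrite rmorph0; ring. Qed.

Lemma aff2_sub f g x : aff2 f g x -> sub f g x.
Proof.
move=> [a [b [e ->]]]; apply: subD; last exact: sub_cst.
by apply: subD; apply: subZ; [exact: sub_l | exact: sub_r].
Qed.

Lemma aff2_1 f g : aff2 f g f. Proof. by exists 1, 0, 0; rewrite rmorph1 rmorph0; ring. Qed.
Lemma aff2_2 f g : aff2 f g g. Proof. by exists 0, 1, 0; rewrite rmorph1 rmorph0; ring. Qed.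
Lemma aff2_c f g c : aff2 f g (cst c). Proof. by exists 0, 0, c; rewrite rmorph0; ring. Qed.
Lemma aff2D f g x y : aff2 f g x -> aff2 f g y -> aff2 f g (x + y).
Proof.
move=> [a [b [e ->]]] [a' [b' [e' ->]]].
by exists (a + a'), (b + b'), (e + e'); rewrite !rmorphD; ring.
Qed.
Lemma aff2Z f g k x : aff2 f g x -> aff2 f g (cst k * x).
Proof. by move=> [a [b [e ->]]]; exists (k * a), (k * b), (k * e); rewrite !rmorphM; ring. Qed.
Lemma aff2_trans f g f' g' x : aff2 f g f' -> aff2 f g g' -> aff2 f' g' x -> aff2 f g x.
Proof.
move=> h1 h2 [a [b [e ->]]].
by apply: aff2D; [apply: aff2D | exact: aff2_c]; exact: aff2Z.
Qed.

Definition eqv f g h f' g' h' : Prop :=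
  [/\ aff3 f g h f', aff3 f g h g' & aff3 f g h h'] /\
  [/\ aff3 f' g' h' f, aff3 f' g' h' g & aff3 f' g' h' h].

Lemma eqv_sym f g h f' g' h' : eqv f g h f' g' h' -> eqv f' g' h' f g h.
Proof. by case. Qed.

Lemma eqv_refl f g h : eqv f g h f g h.
Proof. by split; split; (exact: aff3_1 || exact: aff3_2 || exact: aff3_3). Qed.

Lemma eqv_trans f g h f' g' h' f2 g2 h2 : eqv f g h f' g' h' -> eqv f' g' h' f2 g2 h2 -> eqv f g h f2 g2 h2.
Proof.
move=> [[a1 a2 a3] [b1 b2 b3]] [[c1 c2 c3] [e1 e2 e3]].
split; split.
- exact: aff3_trans a1 a2 a3 c1.
- exact: aff3_trans a1 a2 a3 c2.
- exact: aff3_trans a1 a2 a3 c3.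
- exact: aff3_trans e1 e2 e3 b1.
- exact: aff3_trans e1 e2 e3 b2.
- exact: aff3_trans e1 e2 e3 b3.
Qed.

Lemma eqv_213 f g h : eqv f g h g f h.
Proof. by split; split; (exact: aff3_1 || exact: aff3_2 || exact: aff3_3). Qed.
Lemma eqv_231 f g h : eqv f g h g h f.
Proof. by split; split; (exact: aff3_1 || exact: aff3_2 || exact: aff3_3). Qed.
Lemma eqv_312 f g h : eqv f g h h f g.
Proof. by split; split; (exact: aff3_1 || exact: aff3_2 || exact: aff3_3). Qed.
Lemma eqv_132 f g h : eqv f g h f h g.
Proof. by split; split; (exact: aff3_1 || exact: aff3_2 || exact: aff3_3). Qed.
Lemma eqv_321 f g h : eqv f g h h g f.
Proof. by split; split; (exact: aff3_1 || exact: aff3_2 || exact: aff3_3). Qed.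

Lemma eqv_center g1 g2 h u1 u2 k c w : c != 0 ->
  aff2 u1 u2 g1 -> aff2 u1 u2 g2 -> aff2 g1 g2 u1 -> aff2 g1 g2 u2 -> aff2 u1 u2 w ->
  h = cst c * k + w -> eqv g1 g2 h u1 u2 k.
Proof.
move=> c0 a1 a2 b1 b2 aw ->.
have aw' : aff2 g1 g2 w by exact: aff2_trans b1 b2 aw.
split; split; try exact: aff2_aff3.
- have e : k = cst c^-1 * (cst c * k + w) - cst c^-1 * w.
    by rewrite mulrDr mulrA cstV // mul1r addrK.
  rewrite [X in aff3 _ _ _ X]e.
  by apply: aff3B; apply: aff3Z; [exact: aff3_3 | exact: aff2_aff3].
- by apply: aff3D; [apply: aff3Z; exact: aff3_3 | exact: aff2_aff3].
Qed.

Lemma det3_aff f g h f' g' h' : aff3 f g h f' -> aff3 f g h g' -> aff3 f g h h' ->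
  exists m, det3 X f' g' h' = cst m * det3 X f g h.
Proof.
move=> [a1 [b1 [c1 [e1 ->]]]] [a2 [b2 [c2 [e2 ->]]]] [a3 [b3 [c3 [e3 ->]]]].
exists (a1 * (b2 * c3 - b3 * c2) - b1 * (a2 * c3 - a3 * c2) + c1 * (a2 * b3 - a3 * b2)).
rewrite !det3E !thD !thZ !th_cst !(rmorphB, rmorphD, rmorphM); ring.
Qed.

Lemma jac_eqv f g h f' g' h' : eqv f g h f' g' h' -> jac f g h -> jac f' g' h'.
Proof.
move=> [[a1 a2 a3] [b1 b2 b3]] [c c0 e].
have [m em] := det3_aff a1 a2 a3; have [m' em'] := det3_aff b1 b2 b3.
exists (m * c); last by rewrite em e rmorphM mulrA.
rewrite mulf_neq0 //; apply/eqP => z.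
move: em'; rewrite em z rmorph0 mul0r mulr0 e => /eqP.
by rewrite mulf_eq0 (negbTE (cst_neq0 X c0)) (negbTE (mon_neq0 X)).
Qed.

Lemma jac_red f g h y : sub f g (y - h) -> jac f g y -> jac f g h.
Proof.
move=> [phi e] J.
have J1 := jac_rot (jac_rot J); case: J1 => c c0 ec.
apply: jac_rot; exists c => //; rewrite -ec.
have -> : y = ev X f g phi + h by rewrite -e subrK.
have : det3 X (ev X f g phi) f g = 0.
  by rewrite !det3E !th_ev; ring.
rewrite !det3E !thD => z; rewrite -[LHS]add0r -{1}z; ring.
Qed.

Definition good f g h := [/\ (0 < d h)%Re, (d h < d g)%Re & (d g < d f)%Re].

Lemma d_aff1 f c e : c != 0 -> (0 < d f)%Re -> d (cst c * f + cst e) = d f.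
Proof. by move=> c0 f0; rewrite addrC dD_lt dZ // d_cst. Qed.

Lemma d_aff2 f g a b e : a != 0 -> (0 < d g)%Re -> (d g < d f)%Re -> d (cst a * f + cst b * g + cst e) = d f.
Proof.
move=> a0 g0 fg; have hb := dZ_le X b g; have he := d_cst X e.
have := dD X (cst b * g) (cst e) => h.
rewrite -addrA addrC dD_lt dZ //; dl.
Qed.

Lemma d_aff3 f g h a b c e : good f g h -> a != 0 -> d (cst a * f + cst b * g + cst c * h + cst e) = d f.
Proof.
move=> [h0 hg gf] a0; have hb := dZ_le X b g; have he := d_cst X e; have hc := dZ_le X c h.
have h1 := dD X (cst b * g) (cst c * h + cst e); have h2 := dD X (cst c * h) (cst e).
rewrite -!addrA addrC dD_lt dZ //; dl.
Qed.

Lemma aff3_deg f g h x : good f g h -> aff3 f g h x ->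
  [\/ exists a b c e, [/\ a != 0, x = cst a * f + cst b * g + cst c * h + cst e & d x = d f],
      exists b c e, [/\ b != 0, x = cst b * g + cst c * h + cst e & d x = d g],
      exists c e, [/\ c != 0, x = cst c * h + cst e & d x = d h] |
      d x = 0%Re].
Proof.
move=> G [a [b [c [e ->]]]]; have [h0 hg gf] := G.
have [->|a0] := eqVneq a 0; last by constructor 1; exists a, b, c, e; rewrite d_aff3.
rewrite rmorph0 mul0r add0r.
have [->|b0] := eqVneq b 0; last by constructor 2; exists b, c, e; rewrite d_aff2.
rewrite rmorph0 mul0r add0r.
have [->|c0] := eqVneq c 0; last by constructor 3; exists c, e; rewrite d_aff1.
by constructor 4; rewrite rmorph0 mul0r add0r d_cst.
Qed.

(** The elements of the affine span have only the degrees [d f], [d g], [d h] and 0. The filtration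
    by degree is thus a flag, and a second basis with decreasing degrees is triangular with respect
    to the first. *)
Lemma flag f g h x y z : good f g h -> good x y z -> aff3 f g h x -> aff3 f g h y -> aff3 f g h z ->
  [/\ exists a b c e, [/\ a != 0, x = cst a * f + cst b * g + cst c * h + cst e & d x = d f],
      exists b c e, [/\ b != 0, y = cst b * g + cst c * h + cst e & d y = d g] &
      exists c e, [/\ c != 0, z = cst c * h + cst e & d z = d h]].
Proof.
move=> G [z0 zy yx] hx hy hz; have [h0 hg gf] := G.
case: (aff3_deg G hz) => H3; case: (aff3_deg G hy) => H2; case: (aff3_deg G hx) => H1;
  do ?[split=> //]; exfalso;
  repeat match goal with
  | H : exists _, _ |- _ => destruct H
  | H : and3 _ _ _ |- _ => destruct H
  end; lra.
Qed.

Lemma good_jac f g h x y z : eqv f g h x y z -> jac f g h -> [/\ (0 < d x)%Re, (0 < d y)%Re & (0 < d z)%Re].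
Proof.
move=> E J; have J' := jac_eqv E J; split; first exact: jac_pos J'.
  exact: jac_pos (jac_rot J').
exact: jac_pos (jac_rot (jac_rot J')).
Qed.

(* The three kinds of planes of an affine span, each with the complementary basis element. *)
Definition canon f1 f2 f3 u1 u2 u3 : Prop :=
  [\/ exists a b, [/\ u1 = f1 + cst a * f3, u2 = f2 + cst b * f3 & u3 = f3],
      exists a, [/\ u1 = f1 + cst a * f2, u2 = f3 & u3 = f2] |
      [/\ u1 = f2, u2 = f3 & u3 = f1]].

(** The position of [d h] among the three degrees tells which basis element is complementary to the
    plane of [g1], [g2]; elimination then normalizes the plane. The three cases are the Schubert
    cells of planes with respect to the flag of degrees. *)
Lemma center_form f1 f2 f3 g1 g2 h : good f1 f2 f3 ->
  aff3 f1 f2 f3 g1 -> aff3 f1 f2 f3 g2 -> aff3 f1 f2 f3 h ->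
  (0 < d g2)%Re -> (d g2 < d g1)%Re -> (0 < d h)%Re -> d h <> d g1 -> d h <> d g2 ->
  exists u1 u2 u3 c w, [/\ canon f1 f2 f3 u1 u2 u3, c != 0, h = cst c * u3 + w, aff2 u1 u2 w &
   [/\ (d w < d u3)%Re, d h = d u3, aff2 u1 u2 g1 /\ aff2 u1 u2 g2 & aff2 g1 g2 u1 /\ aff2 g1 g2 u2]].
Proof.
move=> G a1 a2 ah g20 g21 h0 hn1 hn2; have [f30 f32 f21] := G.
case: (Rlt_le_dec (d h) (d g2)) => o1; last case: (Rlt_le_dec (d h) (d g1)) => o2.
- have [[l1 [m [n [e [l10 E1 D1]]]]] [l2 [k [e' [l20 E2 D2]]]] [l3 [e3 [l30 E3 D3]]]] :
     _ := flag G (And3 h0 o1 g21) a1 a2 ah.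
  have [b hb] : exists b, cst l2 * cst b = cst k by exact: cst_solve.
  have [a ha] : exists a, cst l1 * cst a = cst (n - m * b) by exact: cst_solve.
  exists (f1 + cst a * f3), (f2 + cst b * f3), f3, l3, (cst e3).
  have e1 : g1 = cst l1 * (f1 + cst a * f3) + cst m * (f2 + cst b * f3) + cst e.
    by rewrite E1 mulrDr [cst l1 * (cst a * f3)]mulrA ha rmorphB rmorphM; ring.
  have e2 : g2 = cst l2 * (f2 + cst b * f3) + cst e'.
    by rewrite E2 mulrDr [cst l2 * (cst b * f3)]mulrA hb.
  have b2 : aff2 g1 g2 (f2 + cst b * f3).
    have -> : f2 + cst b * f3 = cst l2^-1 * (g2 - cst e').
      by rewrite e2 addrK mulrA cstV // mul1r.
    by apply: aff2Z; apply: aff2D; [exact: aff2_2 | rewrite -rmorphN; exact: aff2_c].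
  split=> //; [by constructor 1; exists a, b | exact: aff2_c |].
  split=> //; first by rewrite d_cst.
    by split; [rewrite e1; exists l1, m, e | rewrite e2; exists 0, l2, e'; rewrite rmorph0; ring].
  split=> //.
  have -> : f1 + cst a * f3 = cst l1^-1 * (g1 - cst m * (f2 + cst b * f3) - cst e).
    rewrite e1; have -> : cst l1 * (f1 + cst a * f3) + cst m * (f2 + cst b * f3) + cst e -
      cst m * (f2 + cst b * f3) - cst e = cst l1 * (f1 + cst a * f3) by ring.
    by rewrite mulrA cstV // mul1r.
  apply: aff2Z; apply: aff2D; last by rewrite -rmorphN; exact: aff2_c.
  by apply: aff2D; [exact: aff2_1 | rewrite -mulNr -rmorphN; apply: aff2Z].
- have o1' : (d g2 < d h)%Re by lra.
  have [[l1 [m [n [e [l10 E1 D1]]]]] [l2 [k [e' [l20 E2 D2]]]] [l3 [e3 [l30 E3 D3]]]] :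
     _ := flag G (And3 g20 o1' o2) a1 ah a2.
  have [a ha] : exists a, cst l1 * cst a = cst m by exact: cst_solve.
  exists (f1 + cst a * f2), f3, f2, l2, (cst k * f3 + cst e').
  have e1 : g1 = cst l1 * (f1 + cst a * f2) + cst n * f3 + cst e.
    by rewrite E1 mulrDr [cst l1 * (cst a * f2)]mulrA ha.
  have b2 : aff2 g1 g2 f3.
    have -> : f3 = cst l3^-1 * (g2 - cst e3) by rewrite E3 addrK mulrA cstV // mul1r.
    by apply: aff2Z; apply: aff2D; [exact: aff2_2 | rewrite -rmorphN; exact: aff2_c].
  split=> //; [by constructor 2; exists a | by rewrite E2 addrA | by exists 0, k, e'; rewrite rmorph0; ring |].
  split=> //.
  + by have := dD X (cst k * f3) (cst e'); have := dZ_le X k f3; rewrite d_cst; dl.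
  + by split; [rewrite e1; exists l1, n, e | rewrite E3; exists 0, l3, e3; rewrite rmorph0; ring].
  split=> //.
  have -> : f1 + cst a * f2 = cst l1^-1 * (g1 - cst n * f3 - cst e).
    rewrite e1; have -> : cst l1 * (f1 + cst a * f2) + cst n * f3 + cst e -
      cst n * f3 - cst e = cst l1 * (f1 + cst a * f2) by ring.
    by rewrite mulrA cstV // mul1r.
  apply: aff2Z; apply: aff2D; last by rewrite -rmorphN; exact: aff2_c.
  by apply: aff2D; [exact: aff2_1 | rewrite -mulNr -rmorphN; apply: aff2Z].
- have o2' : (d g1 < d h)%Re by lra.
  have [[l1 [m [n [e [l10 E1 D1]]]]] [l2 [k [e' [l20 E2 D2]]]] [l3 [e3 [l30 E3 D3]]]] :
     _ := flag G (And3 g20 g21 o2') ah a1 a2.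
  exists f2, f3, f1, l1, (cst m * f2 + cst n * f3 + cst e).
  have b2 : aff2 g1 g2 f3.
    have -> : f3 = cst l3^-1 * (g2 - cst e3) by rewrite E3 addrK mulrA cstV // mul1r.
    by apply: aff2Z; apply: aff2D; [exact: aff2_2 | rewrite -rmorphN; exact: aff2_c].
  split=> //; [by constructor 3 | by rewrite E1 !addrA | by exists m, n, e |].
  split=> //.
  + have := dD X (cst m * f2 + cst n * f3) (cst e); have := dD X (cst m * f2) (cst n * f3).
    by have := dZ_le X m f2; have := dZ_le X n f3; rewrite d_cst; dl.
  + by split; [rewrite E2; exists l2, k, e' | rewrite E3; exists 0, l3, e3; rewrite rmorph0; ring].
  split=> //.
  have -> : f2 = cst l2^-1 * (g1 - cst k * f3 - cst e').
    rewrite E2; have -> : cst l2 * f2 + cst k * f3 + cst e' - cst k * f3 - cst e' = cst l2 * f2 by ring.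
    by rewrite mulrA cstV // mul1r.
  apply: aff2Z; apply: aff2D; last by rewrite -rmorphN; exact: aff2_c.
  by apply: aff2D; [exact: aff2_1 | rewrite -mulNr -rmorphN; apply: aff2Z].
Qed.

(** In the cancelling case [SU] gives [q d f <= d x + d f + d g - D f g < 3 d f], hence [q = 2], and
    [p] is odd by coprimality. *)
Lemma half_case f g x : (0 < d g)%Re -> (d g < d f)%Re -> wdg f g != 0 -> sub f g x -> (d x < d f)%Re ->
  [\/ exists q, x = evu g q,
      exists2 m, (2 <= m)%N & d f = (INR m * d g)%Re |
      exists p, [/\ odd p, (3 <= p)%N, (2 * d f = INR p * d g)%Re & SU f g x (2 * d f)%Re]].
Proof.
move=> g0 gf fg0 S xf; have f0 : (0 < d f)%Re by lra.
case: (sub_cases charC f0 g0 fg0 S) => [h|[m m1 e]|[m m1 e]|[p [q [p2 q2 cop e SUx]]]].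
- by constructor 1; exact: NC_uni h xf.
- constructor 2; exists m => //; case: m m1 e => [|[|m]] // _ e.
  by exfalso; move: e; rewrite /=; lra.
- exfalso; have := @INR_mul_ge 1 m (d f) ltac:(lra) m1; rewrite /=; lra.
have h : q = 2%N.
  apply/eqP; rewrite eqn_leq q2 andbT leqNgt; apply/negP => q3.
  have := @INR_mul_ge 3 q (d f) ltac:(lra) q3; rewrite !S_INR /=.
  by have := SUx.1; have := D_ge0 X f g; lra.
constructor 3; exists p; rewrite h in cop e SUx.
have e2 : INR 2 = 2%Re by rewrite /=; lra.
rewrite e2 in e SUx.
have op : odd p by move: cop; rewrite coprimen2.
split=> //.
have : p <> 2%N by move=> p2'; rewrite p2' in op.
by lia.
Qed.

End Affine.

(** * Reducible triples *)

Section Reduction.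
Variables (C : fieldType) (P : idomainType) (X : ctx C P).
Hypothesis charC : [pchar C] =i pred0.
Local Notation d := (wd X).
Local Notation D := (dwdg X).
Local Notation cst := (wcst X).
Local Notation mon := (wmn X).
Local Notation evu := (evu X).
Local Notation sub := (sub X).
Local Notation jac := (jac X).
Local Notation wdg := (wdg X).
Local Notation SU := (SU X).
Local Notation NC := (NC X).
Local Notation aff2 := (aff2 X).
Local Notation aff3 := (aff3 X).
Local Notation eqv := (eqv X).
Local Notation good := (good X).
Local Notation canon := (canon X).
Local Ltac dl := dlra (wd X).
Implicit Types f g h x y z u v w : P.

Variables x1 x2 x3 : P.
(** The degrees of the base triple lie within a factor 2 of each other and are pairwise
    incommensurable. So there is no cancellation, and no nonlinear monomial has degree at most
    [d x1]; elementary moves that do not raise the degree are then affine, see [base_moves]. *)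
Definition base_ok : Prop :=
  [/\ jac x1 x2 x3, good x1 x2 x3, (d x1 < 2 * d x3)%Re &
   forall m n, (0 < m)%N -> [/\ (INR m * d x1 <> INR n * d x2)%Re, (INR m * d x1 <> INR n * d x3)%Re &
      (INR m * d x2 <> INR n * d x3)%Re]].
Hypothesis base : base_ok.

(* The exceptional (non elementary) reduction of Shestakov and Umirbaev: [x] is first replaced by
   [x + q(f3)], which does not lower the degree, and then [f3] is reduced. *)
Definition Kcond x f2 f3 (q : {poly C}) y : Prop :=
  let f1 := x + evu f3 q in
  [/\ size q = 3, sub f1 f2 (y - f3), (2 * d f1 = 3 * d f2)%Re &
   [/\ (d f1 - d f2 + D f1 f2 <= d f3)%Re, (4 * d f3 <= 3 * d f2)%Re,
       (d y < d f1 - d f2 + D f1 f2)%Re, (d x <= d f1)%Re &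
       (d x < d f1)%Re \/ (4 * d f3 < 3 * d f2)%Re]].

(** Each rule leads from the reduced triple to the unreduced one. The distinct degrees in [A_red]
    allow [center_form] to bring the plane of [f] and [g] into one of the normal positions of
    [canon]. *)
Inductive redtriple : P -> P -> P -> Prop :=
| A_base : redtriple x1 x2 x3
| A_eqv f g h f' g' h' : redtriple f g h -> eqv f g h f' g' h' -> redtriple f' g' h'
| A_red f g h y : redtriple f g y -> sub f g (y - h) -> d f <> d g -> d f <> d h -> d g <> d h ->
    (d y < d h)%Re -> redtriple f g h
| A_K x f2 f3 q y : redtriple (x + evu f3 q) f2 y -> Kcond x f2 f3 q y -> redtriple x f2 f3.
Local Notation A := redtriple.

Lemma jac_add_sub f2 f3 x p : sub f2 f3 p -> jac (x + p) f2 f3 -> jac x f2 f3.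
Proof.
move=> hp J; have J' := jac_rot J.
apply: jac_rot; apply: jac_rot; apply: (@jac_red _ _ _ f2 f3 x (x + p)); last exact: J'.
by rewrite addrC addKr.
Qed.

Lemma A_jac f g h : A f g h -> jac f g h.
Proof.
elim=> [|? ? ? ? ? ? _ J E|? ? ? ? _ J S _ _ _ _|x f2 f3 q y _ J [_ S _ _]].
- by case: base.
- exact: jac_eqv E J.
- exact: jac_red S J.
- have J' := jac_red S J; apply: (jac_add_sub _ J').
  by apply: sub_evu; exact: sub_r.
Qed.

Definition Ebase f1 f2 f3 := [/\ d f1 = d x1, d f2 = d x2 & d f3 = d x3].
Definition Ecert f1 f2 f3 := exists u1 u2 u3 y,
  [/\ canon f1 f2 f3 u1 u2 u3, sub u1 u2 (y - u3), (d y < d u3)%Re & A u1 u2 y].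
Definition Kcert f1 f2 f3 := exists b q y,
  A (f1 + evu f3 q) (f2 + cst b * f3) y /\ Kcond f1 (f2 + cst b * f3) f3 q y.

(** Inversion of a derivation, with consecutive changes of basis merged into one. *)
Lemma cert_raw f g h : A f g h -> exists f' g' h', eqv f g h f' g' h' /\
  [\/ f' = x1 /\ g' = x2 /\ h' = x3,
      exists y, [/\ A f' g' y, sub f' g' (y - h') & [/\ d f' <> d g', d f' <> d h', d g' <> d h' & (d y < d h')%Re]] |
      exists q y, A (f' + evu h' q) g' y /\ Kcond f' g' h' q y].
Proof.
elim=> [|f0 g0 h0 f' g' h' _ [f2 [g2 [h2 [E H]]]] E'|f0 g0 h0 y hA _ S n1 n2 n3 hd|x f2 f3 q y hA _ HK].
- by exists x1, x2, x3; split; [exact: eqv_refl | constructor 1].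
- by exists f2, g2, h2; split=> //; apply: eqv_trans E; exact: eqv_sym.
- by exists f0, g0, h0; split; [exact: eqv_refl | constructor 2; exists y].
- by exists x, f2, f3; split; [exact: eqv_refl | constructor 3; exists q, y].
Qed.

(** * Degrees forced by the exceptional reduction *)

Section KFacts.
Variables (x f2 f3 y : P) (q : {poly C}).
Hypothesis J : jac x f2 f3.
Hypothesis K : Kcond x f2 f3 q y.
Let f1 := x + evu f3 q.

Lemma K_jac1 : jac f1 f2 f3.
Proof.
have J' := jac_rot J; apply: jac_rot; apply: jac_rot; apply: (@jac_red _ _ _ f2 f3 _ x) => //.
have -> : x - f1 = - evu f3 q by rewrite /f1; ring.
by apply: subN; apply: sub_evu; exact: sub_r.
Qed.

Lemma K_pos : [/\ (0 < d f1)%Re, (0 < d f2)%Re, (0 < d f3)%Re & (0 < d x)%Re].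
Proof.
have J1 := K_jac1; split; [exact: jac_pos J1|exact: jac_pos (jac_rot J1)|
 exact: jac_pos (jac_rot (jac_rot J1))|exact: jac_pos J].
Qed.

Lemma K_D12 : (2 <= D f1 f2)%Re.
Proof. apply: D_ge2; exact: jac_wdg (jac_rot (jac_rot K_jac1)). Qed.

(** As [2 d f1 = 3 d f2], the left side equals [d f1 + D f1 f2], which is what [SU] with a common
    multiple of at least [2 d f1] gives for [D (y - f3) f2]. The bound on [d y] keeps [dy /\ df2]
    below this, so the estimate passes to [df3 /\ df2]. *)
Lemma K_D23 : (3 * (d f1 - d f2) + D f1 f2 <= D f2 f3)%Re.
Proof.
have [_ S e [k1 k2 k3 k4 k5]] := K; rewrite -/f1 in S e k1 k3 k4 k5.
have [p1 p2 p3 px] := K_pos; have D2 := K_D12.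
have J3 : wdg f1 f2 != 0 by exact: jac_wdg (jac_rot (jac_rot K_jac1)).
have dphi : d (y - f3) = d f3 by rewrite dD_lt dN //; lra.
case: (sub_cases charC p1 p2 J3 S) => [h|[m m1 em]|[m m1 em]|[p [r [pp2 r2 _ er SUx]]]].
- exfalso; have [||c ec] := NC_const p1 p2 h; rewrite ?dphi; try lra.
  by move: dphi; rewrite ec d_cst; lra.
- exfalso; case: m m1 em => [|[|m]] // _; first by rewrite /=; lra.
  by rewrite !S_INR => em; have : (0 <= INR m * d f2)%Re; [apply: Rmult_le_pos; [exact: pos_INR | lra] | lra].
- exfalso; have := @INR_mul_ge 1 m (d f1) ltac:(lra) m1; rewrite /=; lra.
have hr := @INR_mul_ge 2 r (d f1) ltac:(lra) r2.
move: hr; rewrite [INR 2]/= => hr.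
have [|hD _ _] := SUx.2; first by rewrite dphi; lra.
have : D f3 f2 = D (y - f3) f2; last by rewrite (D_sym X f3 f2) => ->; lra.
have hy := D_le X y f2.
have ef : f3 = y + - (y - f3) by ring.
rewrite {1}ef /dwdg wdgDl wdgNl dvD_lt dvN // -/(D y f2) -/(D (y - f3) f2).
have := hD; lra.
Qed.

Lemma K_D13' : D f1 f3 = (d f1 - d f2 + D f2 f3)%Re.
Proof.
have [_ S e [k1 k2 k3 k4 k5]] := K; rewrite -/f1 in S e k1 k3 k4 k5.
have [p1 p2 p3 px] := K_pos; have D2 := K_D12; have D23 := K_D23.
have t1 := two_max K_jac1; have t2 := two_max (jac_rot K_jac1).
rewrite (D_sym X f3 f1) (D_sym X f2 f1) in t2.
move: t1 t2; rmax; lra.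
Qed.

Lemma K_D13 : D x f3 = (d f1 - d f2 + D f2 f3)%Re.
Proof.
rewrite -K_D13'; rewrite /f1 /dwdg wdgDl wdg_evu wdgxx scaler0 addr0 //.
Qed.

(** [x = f1 - q(f3)] with [q] quadratic, so the derivative of [q] at [f3] has degree [d f3]; by
    [K_D23] the wedge [df1 /\ df2] is too small to matter. *)
Lemma K_D12x : D x f2 = (d f3 + D f2 f3)%Re.
Proof.
have [s3 S e [k1 k2 k3 k4 k5]] := K; rewrite -/f1 in S e k1 k3 k4 k5.
have [p1 p2 p3 px] := K_pos; have D2 := K_D12; have D23 := K_D23.
have ex : x = f1 + - evu f3 q by rewrite /f1; ring.
have s1 : (1 < size q)%N by rewrite s3.
have [n0 dq] := evu_deriv_deg charC p3 s1.
rewrite s3 /= in dq.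
have L : dv X (- (evu f3 q^`() *: wdg f3 f2)) = (d f3 + D f2 f3)%Re.
  rewrite dvN dvZ //; last by exact: jac_wdg (jac_rot (jac_rot (jac_swap (jac_rot K_jac1)))).
  by rewrite -/(D f3 f2) D_sym dq; lra.
rewrite {1}ex /dwdg wdgDl wdgNl wdg_evu dvD_lt L // -/(D f1 f2).
have := D_ge0 X f2 f3; lra.
Qed.

(** Since [q(f3)] has degree [2 d f3] and [f1] has degree [3/2 d f2], the degree of [x] can fall
    below that of [f1] only when [4 d f3 = 3 d f2]. The lower bounds for [d x] and [d f3] come from
    inserting the known value of [D x f2] into [D x f2 <= d x + d f2]. *)
Lemma K_degrees : [/\ (d f2 < d x)%Re, (d f3 < d f2)%Re, (d f2 < 2 * d f3)%Re &
   (3 * d f2 < 2 * D f2 f3)%Re] /\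
  ((2 * d x = 3 * d f2 /\ 4 * d f3 < 3 * d f2) \/
   (5 * d f2 < 4 * d x /\ 2 * d x < 3 * d f2 /\ 4 * d f3 = 3 * d f2))%Re.
Proof.
have [s3 S e [k1 k2 k3 k4 k5]] := K; rewrite -/f1 in S e k1 k3 k4 k5.
have [p1 p2 p3 px] := K_pos; have D2 := K_D12; have D23 := K_D23.
have hx := D_le X x f2; rewrite K_D12x in hx.
have dq : d (evu f3 q) = (2 * d f3)%Re by rewrite d_evu // s3 /=; lra.
have dx_lt : (d x < d f1)%Re -> (2 * d f3 = d f1)%Re.
  by move=> h; rewrite -dq /f1 dD_lt // dq; apply: Rnot_le_lt => h'; have := dD X x (evu f3 q); rewrite -/f1 dq; rmax; lra.
have dx_eq : (4 * d f3 < 3 * d f2)%Re -> d x = d f1.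
  by move=> h; apply: Rle_antisym => //; apply: Rnot_lt_le => /dx_lt; lra.
split; first split; try lra.
Qed.
End KFacts.

Lemma sort3 f g h : d f <> d g -> d f <> d h -> d g <> d h ->
  [\/ (d h < d g < d f)%Re \/ (d h < d f < d g)%Re, (d g < d h < d f)%Re \/ (d f < d h < d g)%Re |
      (d g < d f < d h)%Re \/ (d f < d g < d h)%Re].
Proof.
move=> n1 n2 n3.
case: (Rlt_le_dec (d f) (d g)) => h1; case: (Rlt_le_dec (d f) (d h)) => h2; case: (Rlt_le_dec (d g) (d h)) => h3;
 try (constructor 1; lra); try (constructor 2; lra); try (constructor 3; lra).
Qed.

Lemma aff2_swap f g x : aff2 f g x -> aff2 g f x.
Proof. by move=> [a [b [e ->]]]; exists b, a, e; ring. Qed.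

(** A move in an arbitrary basis of the affine span is, up to affine changes, a move over one of the
    normal planes of [canon], and a drop of degree remains a drop. *)
Lemma transfer f1 f2 f3 g1 g2 h : jac f1 f2 f3 -> good f1 f2 f3 -> eqv f1 f2 f3 g1 g2 h ->
  d g1 <> d g2 -> d g1 <> d h -> d g2 <> d h ->
  exists u1 u2 u3, [/\ canon f1 f2 f3 u1 u2 u3, d h = d u3 &
    forall y, sub g1 g2 (y - h) -> exists y', [/\ sub u1 u2 (y' - u3), eqv g1 g2 y u1 u2 y' &
      ((d y < d h)%Re -> (d y' < d u3)%Re)]].
Proof.
move=> J G.
wlog: g1 g2 / (d g2 < d g1)%Re => [H E n1 n2 n3|g21 E n1 n2 n3].
  case: (Rlt_le_dec (d g2) (d g1)) => h1; first exact: H.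
  have g12 : (d g1 < d g2)%Re by lra.
  have [u1 [u2 [u3 [c e K]]]] := H g2 g1 g12 (eqv_trans E (eqv_213 _ _ _ _)) (nesym n1) n3 n2.
  exists u1, u2, u3; split=> // y /sub_sym /K [y' [h2 h3 h4]]; exists y'; split=> //.
  by apply: eqv_trans h3; exact: eqv_213.
have [p1 p2 p3] := good_jac E J; have [[a1 a2 a3] _] := E.
have [u1 [u2 [u3 [c [w [cn c0 eh aw [dw dh [b1 b2] [e1 e2]]]]]]]] :=
  center_form G a1 a2 a3 p2 g21 p3 (nesym n2) (nesym n3).
exists u1, u2, u3; split=> // y S; exists (cst c^-1 * (y - w)).
have ey : y = cst c * (cst c^-1 * (y - w)) + w.
  by rewrite mulrA -rmorphM mulfV // rmorph1 mul1r subrK.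
have S1 z : sub g1 g2 z -> sub u1 u2 z by apply: sub_trans; exact: aff2_sub.
split.
- have -> : cst c^-1 * (y - w) - u3 = cst c^-1 * (y - h).
    rewrite eh; have -> : cst c^-1 * (y - (cst c * u3 + w)) = cst c^-1 * (y - w) - (cst c^-1 * cst c) * u3 by ring.
    by rewrite cstV // mul1r.
  by apply: subZ; apply: S1.
- exact: eqv_center c0 b1 b2 e1 e2 aw ey.
- move=> hy; rewrite dZ ?invr_eq0 //; have := dB X y w; dl.
Qed.

Lemma D_lin u v (a m e c e' : C) : a != 0 -> c != 0 ->
  D (cst a * u + cst m * v + cst e) (cst c * v + cst e') = D u v.
Proof.
move=> a0 c0; rewrite /dwdg !wdgDl !wdgDr !wdgZl !wdgZr !wdg_cstl !wdg_cstr wdgxx !scaler0 !addr0.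
rewrite scalerA -rmorphM; have [->|n0] := eqVneq (wdg u v) 0; first by rewrite scaler0.
by rewrite dvZ ?cst_neq0 ?mulf_neq0 // d_cst; lra.
Qed.

(** The last rule of a derivation is brought into normal form relative to a basis with decreasing
    degrees; the later case distinctions start from here. *)
Lemma cert_form f1 f2 f3 : good f1 f2 f3 -> A f1 f2 f3 ->
  [\/ Ebase f1 f2 f3, Kcert f1 f2 f3 | Ecert f1 f2 f3].
Proof.
move=> G hA; have J := A_jac hA; have [f [g [h [E H]]]] := cert_raw hA.
case: H => [[e1 [e2 e3]]|[y [hy S [n1 n2 n3 hd]]]|[q [y [hy K]]]].
- subst f g h; have [[a1 a2 a3] _] := E; have [_ bg _ _] := base.
  have [[? [? [? [? [_ _ d1]]]]] [? [? [? [_ _ d2]]]] [? [? [_ _ d3]]]] := flag G bg a1 a2 a3.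
  by constructor 1; split; rewrite ?d1 ?d2 ?d3.
- have [u1 [u2 [u3 [cn dh T]]]] := transfer J G E n1 n2 n3.
  have [y' [h1 h2 h3]] := T y S.
  constructor 3; exists u1, u2, u3, y'; split=> //; first exact: h3.
  exact: A_eqv hy h2.
have J' := jac_eqv E J.
have [[k1 k2 k3 k4] _] := K_degrees J' K.
have Gk : good f g h by split=> //; exact: jac_pos (jac_rot (jac_rot J')).
have [[a1 a2 a3] _] := E.
have [[l1 [m [n [e [l10 E1 D1]]]]] [l2 [k [e' [l20 E2 D2]]]] [l3 [e3 [l30 E3 D3]]]] :=
  flag G Gk a1 a2 a3.
constructor 2.
have [b hb] := cst_solve X k l20.
have [a ha] := cst_solve X (n - m * b) l10.
(* [q2] absorbs the affine substitution that expresses [h] by [f3]. *)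
pose q2 : {poly C} := q \Po (l3 *: 'X + e3%:P).
have sq2 : size q2 = size q.
  rewrite size_comp_poly2 // size_addl size_scale // ?size_polyX // size_polyC; case: (_ != 0) => //.
have eq2 : evu f3 q2 = evu h q.
  rewrite /q2 E3; elim/poly_ind: q {hy K k1 k2 k3 k4 q2 sq2} => [|q c IH]; first by rewrite comp_poly0 !rmorph0.
  rewrite comp_polyD comp_polyM comp_polyX comp_polyC !rmorphD !rmorphM IH !evuX !evuC.
  by rewrite -mul_polyC rmorphD rmorphM evuX !evuC.
(* [q3] also absorbs the multiple of [f3] by which the plane elements differ; the added term is
   linear, so the degree remains 2. *)
pose q3 : {poly C} := a *: 'X + l1^-1 *: q2.
have sq3 : size q3 = size q.
  have [s3 _ _ _] := K.
  have sc : size (l1^-1 *: q2) = size q by rewrite size_scale ?invr_eq0.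
  rewrite /q3 addrC size_polyDl sc // s3.
  by apply: leq_ltn_trans (size_scale_leq _ _) _; rewrite size_polyX.
have eq3 : cst l1 * evu f3 q3 = cst (n - m * b) * f3 + evu h q.
  have eX : evu f3 q3 = cst a * f3 + cst l1^-1 * evu f3 q2.
    rewrite /q3 -[a *: _]mul_polyC -[l1^-1 *: _]mul_polyC.
    by rewrite (rmorphD (evu f3)) 2!(rmorphM (evu f3)) evuX !evuC.
  by rewrite eX eq2 mulrDr !mulrA ha -(rmorphM cst) mulfV // rmorph1 mul1r.
have e1 : f + evu h q = cst l1 * (f1 + evu f3 q3) + cst m * (f2 + cst b * f3) + cst e.
  by rewrite E1 mulrDr eq3 rmorphB rmorphM; ring.
have e2 : g = cst l2 * (f2 + cst b * f3) + cst e'.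
  by rewrite E2 mulrDr [cst l2 * (cst b * f3)]mulrA hb.
set F1 := f1 + evu f3 q3 in e1; set F2 := f2 + cst b * f3 in e1 e2.
exists b, q3, (cst l3^-1 * (y - cst e3)); rewrite -/F1 -/F2.
have [s3 S en [c1 c2 c3 c4 c5]] := K.
have b2 : aff2 (f + evu h q) g F2.
  have -> : F2 = cst l2^-1 * (g - cst e') by rewrite e2 addrK mulrA cstV // mul1r.
  by apply: aff2Z; apply: aff2D; [exact: aff2_2 | rewrite -rmorphN; exact: aff2_c].
have b1 : aff2 (f + evu h q) g F1.
  have -> : F1 = cst l1^-1 * (f + evu h q - cst m * F2 - cst e).
    rewrite e1; have -> : cst l1 * F1 + cst m * F2 + cst e - cst m * F2 - cst e = cst l1 * F1 by ring.
    by rewrite mulrA cstV // mul1r.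
  apply: aff2Z; apply: aff2D; last by rewrite -rmorphN; exact: aff2_c.
  by apply: aff2D; [exact: aff2_1 | rewrite -mulNr -rmorphN; apply: aff2Z].
have b3 : aff2 F1 F2 (f + evu h q) by rewrite e1; exists l1, m, e.
have b4 : aff2 F1 F2 g by rewrite e2; exists 0, l2, e'; rewrite rmorph0; ring.
have ey : y = cst l3 * (cst l3^-1 * (y - cst e3)) + cst e3.
  by rewrite mulrA -rmorphM mulfV // rmorph1 mul1r subrK.
have dF2 : d F2 = d g.
  by rewrite D2 /F2 addrC dD_lt //; have := dZ_le X b f3; have [_ h1 _] := G; lra.
have DF : D (f + evu h q) g = D F1 F2 by rewrite e1 e2 D_lin.
split.
  apply: A_eqv hy _; apply: (eqv_center l30 b3 b4 b1 b2 _ ey); exact: aff2_c.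
have dq : d (evu h q) = (2 * d h)%Re.
  rewrite d_evu ?s3 /=; [lra | exact: jac_pos (jac_rot (jac_rot J'))].
have dq3 : d (evu f3 q3) = (2 * d h)%Re.
  by rewrite d_evu ?sq3 ?s3 -?D3 /=; [lra | exact: jac_pos (jac_rot (jac_rot J'))].
have [z0 z1 z2] := G; have [h0 hg hf] := Gk.
have dF1 : d F1 = d (f + evu h q).
  have [w0 w1] : (d F2 < d (f + evu h q))%Re /\ (0 < d F2)%Re by rewrite dF2; lra.
  case: (Rlt_le_dec (d F2) (d F1)) => hF.
    by rewrite e1 d_aff2.
  move: w0; rewrite e1; have := dD X (cst l1 * F1 + cst m * F2) (cst e).
  have := dD X (cst l1 * F1) (cst m * F2); have := dZ_le X l1 F1; have := dZ_le X m F2.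
  by rewrite d_cst; dl.
have S' : sub F1 F2 (cst l3^-1 * (y - cst e3) - f3).
  have -> : cst l3^-1 * (y - cst e3) - f3 = cst l3^-1 * (y - h).
    rewrite E3; have -> : cst l3^-1 * (y - (cst l3 * f3 + cst e3)) = cst l3^-1 * (y - cst e3) - (cst l3^-1 * cst l3) * f3 by ring.
    by rewrite cstV // mul1r.
  apply: subZ; apply: sub_trans S; exact: aff2_sub.
have dy : (d (cst l3^-1 * (y - cst e3))%R <= d y)%Re.
  apply: Rle_trans (dZ_le X _ _) _; have := dB X y (cst e3); have := d_ge0 X y; rewrite d_cst; dl.
rewrite /Kcond -/F1 dF1 dF2 -DF -D1 -D3; split=> //; first by rewrite sq3.
by split=> //; lra.
Qed.

End Reduction.

(** * Commuting moves *)

Section Moves.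
Variables (C : fieldType) (P : idomainType) (X : ctx C P).
Hypothesis charC : [pchar C] =i pred0.
Local Notation d := (wd X).
Local Notation D := (dwdg X).
Local Notation cst := (wcst X).
Local Notation mon := (wmn X).
Local Notation evu := (evu X).
Local Notation sub := (sub X).
Local Notation jac := (jac X).
Local Notation wdg := (wdg X).
Local Notation SU := (SU X).
Local Notation NC := (NC X).
Local Notation aff2 := (aff2 X).
Local Notation aff3 := (aff3 X).
Local Notation eqv := (eqv X).
Local Notation good := (good X).
Local Notation canon := (canon X).
Local Ltac dl := dlra (wd X).
Implicit Types f g h x y z u v w : P.

Local Notation Kcond := (Kcond X).
Variables x1 x2 x3 : P.
Local Notation A := (redtriple X x1 x2 x3).
Local Notation Ebase := (Ebase X x1 x2 x3).
Local Notation Ecert := (Ecert X x1 x2 x3).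
Local Notation Kcert := (Kcert X x1 x2 x3).
Hypothesis base : base_ok X x1 x2 x3.

Definition degsum f g h : R := (d f + d g + d h)%Re.
Local Notation sumd := degsum.
Definition closed f g h : Prop := forall f' g' h' y, eqv f g h f' g' h' -> sub f' g' (y - h') -> A f' g' y.
(* The induction hypothesis of the peak reduction. *)
Definition Nlt (mu : R) : Prop := forall f g h, A f g h -> (sumd f g h < mu)%Re -> closed f g h.

Lemma mult_cases m (a b : R) : (0 < b)%Re -> (a = INR m * b)%Re ->
  [\/ (a = 0)%Re \/ a = b, (a = 2 * b)%Re, (a = 3 * b)%Re | (4 * b <= a)%Re].
Proof.
move=> b0; case: m => [|[|[|[|m]]]]; rewrite ?S_INR /= => e.
- by constructor 1; left; lra.
- by constructor 1; right; lra.
- by constructor 2; lra.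
- by constructor 3; lra.
- constructor 4; have : (0 <= INR m * b)%Re by apply: Rmult_le_pos; [exact: pos_INR | lra].
  by lra.
Qed.

Lemma mult2_cases m (a b : R) : (0 < b)%Re -> (2 <= m)%N -> (a = INR m * b)%Re ->
  [\/ (a = 2 * b)%Re, (a = 3 * b)%Re | (4 * b <= a)%Re].
Proof.
move=> b0; case: m => [|[|[|[|m]]]] //; rewrite ?S_INR /= => _ e.
- by constructor 1; lra.
- by constructor 2; lra.
- constructor 3; have : (0 <= INR m * b)%Re by apply: Rmult_le_pos; [exact: pos_INR | lra].
  by lra.
Qed.

Lemma odd_cases p (a b : R) : (0 < b)%Re -> odd p -> (3 <= p)%N -> (2 * a = INR p * b)%Re ->
  [\/ (2 * a = 3 * b)%Re, (2 * a = 5 * b)%Re, (2 * a = 7 * b)%Re | (9 * b <= 2 * a)%Re].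
Proof.
move=> b0; case: p => [|[|[|[|[|[|[|[|[|p]]]]]]]]] //; rewrite ?S_INR /= => _ _ e.
- by constructor 1; lra.
- by constructor 2; lra.
- by constructor 3; lra.
- constructor 4; have : (0 <= INR p * b)%Re by apply: Rmult_le_pos; [exact: pos_INR | lra].
  by lra.
Qed.

Section Step.
Variables (mu : R) (N : Nlt mu).

Lemma step3 f g h y : A f g h -> (sumd f g h < mu)%Re -> sub f g (y - h) -> A f g y.
Proof. by move=> hA hs; apply: (N hA hs); exact: eqv_refl. Qed.

Lemma step2 f g h y : A f g h -> (sumd f g h < mu)%Re -> sub f h (y - g) -> A f y h.
Proof.
move=> hA hs S; apply: (A_eqv _ (eqv_132 _ _ _ _)).
by apply: (N hA hs) S; exact: eqv_132.
Qed.

Lemma step1 f g h y : A f g h -> (sumd f g h < mu)%Re -> sub g h (y - f) -> A y g h.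
Proof.
move=> hA hs S; apply: (A_eqv _ (eqv_312 _ _ _ _)).
by apply: (N hA hs) S; exact: eqv_231.
Qed.

(* The detour through [(f, g', h)] and [(f, g', y)] avoids [(f, g, h)], where the induction
   hypothesis is not available. *)
Lemma square1 f g g' h y q : A f g' h -> (sumd f g' h < mu)%Re -> g' - g = evu f q -> sub f g (y - h) ->
  (sumd f g' y < mu)%Re -> A f g y.
Proof.
move=> hA hs e S hs'.
have eg : g = g' - evu f q by rewrite -e opprB addrC subrK.
have hG : A f g' y.
  apply: (step3 hA hs); apply: sub_trans S; first exact: sub_l.
  by rewrite eg; apply: subB; [exact: sub_r | apply: sub_evu; exact: sub_l].
apply: (step2 hG hs'); have -> : g - g' = - evu f q by rewrite -e opprB.
by apply: subN; apply: sub_evu; exact: sub_l.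
Qed.

Lemma square2 f g g' h y q : A f g y -> (sumd f g y < mu)%Re -> g' - g = evu f q -> sub f g (y - h) ->
  (sumd f g' y < mu)%Re -> A f g' h.
Proof.
move=> hA hs e S hs'.
have eg : g = g' - evu f q by rewrite -e opprB addrC subrK.
have hG : A f g' y.
  by apply: (step2 hA hs); rewrite e; apply: sub_evu; exact: sub_l.
apply: (step3 hG hs'); rewrite -opprB; apply: subN; apply: sub_trans S; first exact: sub_l.
by rewrite eg; apply: subB; [exact: sub_r | apply: sub_evu; exact: sub_l].
Qed.
End Step.

(** [E1], [E2] and [E3] are the three forms of [Ecert], according to which basis element is lowered;
    the scalars parametrize the normal planes. *)
Definition E1 f1 f2 f3 := exists y, [/\ sub f2 f3 (y - f1), (d y < d f1)%Re & A y f2 f3].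
Definition E2 f1 f2 f3 := exists a y, [/\ sub (f1 + cst a * f2) f3 (y - f2), (d y < d f2)%Re &
  A (f1 + cst a * f2) y f3].
Definition E3 f1 f2 f3 := exists a b y, [/\ sub (f1 + cst a * f3) (f2 + cst b * f3) (y - f3), (d y < d f3)%Re &
  A (f1 + cst a * f3) (f2 + cst b * f3) y].

Lemma EcertE f1 f2 f3 : Ecert f1 f2 f3 -> [\/ E1 f1 f2 f3, E2 f1 f2 f3 | E3 f1 f2 f3].
Proof.
move=> [u1 [u2 [u3 [y [[[a [b [-> -> ->]]]|[a [-> -> ->]]|[-> -> ->]] S dy hA]]]]].
- by constructor 3; exists a, b, y.
- constructor 2; exists a, y; split=> //; exact: A_eqv hA (eqv_132 _ _ _ _).
- constructor 1; exists y; split=> //; exact: A_eqv hA (eqv_312 _ _ _ _).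
Qed.

Lemma d_add_lt f g a : (d g < d f)%Re -> d (f + cst a * g) = d f.
Proof. by move=> h; rewrite addrC dD_lt //; have := dZ_le X a g; lra. Qed.

Lemma d_diff y f : (d y < d f)%Re -> d (y - f) = d f.
Proof. by move=> h; rewrite dD_lt dN. Qed.

Section Good.
Variables f1 f2 f3 : P.
Hypothesis J : jac f1 f2 f3.
Hypothesis G : good f1 f2 f3.
Local Notation a := (d f1).
Local Notation b := (d f2).
Local Notation c := (d f3).

Lemma jac_shift1 k : jac (f1 + cst k * f2) f2 f3.
Proof.
apply: jac_rot; apply: jac_rot; apply: (@jac_red _ _ _ f2 f3 _ f1); last exact: jac_rot J.
have -> : f1 - (f1 + cst k * f2) = - (cst k * f2) by ring.
by apply: subN; apply: subZ; exact: sub_l.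
Qed.

Lemma jac_shift3 k l : jac (f1 + cst k * f3) (f2 + cst l * f3) f3.
Proof.
apply: jac_eqv J; split; split.
- by apply: aff3D; [exact: aff3_1 | apply: aff3Z; exact: aff3_3].
- by apply: aff3D; [exact: aff3_2 | apply: aff3Z; exact: aff3_3].
- exact: aff3_3.
- have e : f1 = f1 + cst k * f3 - cst k * f3 by ring.
  by rewrite [X in aff3 _ _ _ X]e; apply: aff3B; [exact: aff3_1 | apply: aff3Z; exact: aff3_3].
- have e : f2 = f2 + cst l * f3 - cst l * f3 by ring.
  by rewrite [X in aff3 _ _ _ X]e; apply: aff3B; [exact: aff3_2 | apply: aff3Z; exact: aff3_3].
- exact: aff3_3.
Qed.

Lemma evu_multiple g (q : {poly C}) : (0 < d g)%Re -> (d g < d (evu g q))%Re ->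
  exists2 m, (2 <= m)%N & d (evu g q) = (INR m * d g)%Re.
Proof.
move=> g0; rewrite d_evu // => h; exists (size q).-1 => //.
by case: (size q).-1 h => [|[|m]] //= h; lra.
Qed.

(** When [y] lies below [f1], the difference [y - f1] has the degree of [f1], so [sub_cases] for
    this difference constrains the degrees of the triple itself. [E2num] and [E3num] do the same for
    [f2] and [f3]. *)
Lemma E1num y : sub f2 f3 (y - f1) -> (d y < a)%Re ->
  [\/ exists i j, a = (INR i * b + INR j * c)%Re, exists2 m, (2 <= m)%N & b = (INR m * c)%Re |
      exists p q, [/\ (2 <= p)%N, (2 <= q)%N, coprime p q, (INR q * b = INR p * c)%Re &
        SU f2 f3 (y - f1) (INR q * b)]].
Proof.
move=> S dy; have [c0 cb ba] := G; have b0 : (0 < b)%Re by lra.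
case: (sub_cases charC b0 c0 (jac_wdg J) S) => [h|[m m1 e]|[m m1 e]|h]; last by constructor 3.
- constructor 1; rewrite -(d_diff dy); apply: NC_attain => //; rewrite (d_diff dy); lra.
- constructor 2; exists m => //; case: m m1 e => [|[|m]] // _; rewrite /=; lra.
- exfalso; have := @INR_mul_ge 1 m b ltac:(lra) m1; rewrite /=; lra.
Qed.

Lemma E2num k y : sub (f1 + cst k * f2) f3 (y - f2) -> (d y < b)%Re ->
  [\/ (exists q, y - f2 = evu f3 q) /\ exists2 m, (2 <= m)%N & b = (INR m * c)%Re,
      exists2 m, (2 <= m)%N & a = (INR m * c)%Re |
      (exists p, [/\ odd p, (3 <= p)%N & (2 * a = INR p * c)%Re]) /\
        (a - c + D (f1 + cst k * f2) f3 <= b)%Re /\ SU (f1 + cst k * f2) f3 (y - f2) (2 * a)%Re].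
Proof.
move=> S dy; have [c0 cb ba] := G.
have du : d (f1 + cst k * f2) = a by apply: d_add_lt.
have dd := d_diff dy.
have W : wdg (f1 + cst k * f2) f3 != 0.
  exact: jac_wdg (jac_swap (jac_shift1 k)).
have cu : (c < d (f1 + cst k * f2))%Re by rewrite du; lra.
have yu : (d (y - f2)%R < d (f1 + cst k * f2))%Re by rewrite du dd; lra.
case: (half_case charC c0 cu W S yu) => [[q e]|[m m2 e]|[p [op p3 e SUx]]].
- constructor 1; split; first by exists q.
  by rewrite -dd e; apply: evu_multiple => //; rewrite -e dd; lra.
- by constructor 2; exists m => //; rewrite -du.
constructor 3; rewrite du in e SUx; split; first by exists p.
by split=> //; have := SUx.1; rewrite dd du; lra.
Qed.

(** In the cancelling case [SU] gives [a - b <= c < b], and of the odd [p] with [2 a = p b] only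
    [p = 3] remains. *)
Lemma E3num k l y : sub (f1 + cst k * f3) (f2 + cst l * f3) (y - f3) -> (d y < c)%Re ->
  (exists2 m, (2 <= m)%N & a = (INR m * b)%Re) \/
  ((2 * a = 3 * b)%Re /\ (a - b + D (f1 + cst k * f3) (f2 + cst l * f3) <= c)%Re /\
    SU (f1 + cst k * f3) (f2 + cst l * f3) (y - f3) (2 * a)%Re).
Proof.
move=> S dy; have [c0 cb ba] := G.
have du : d (f1 + cst k * f3) = a by apply: d_add_lt; lra.
have dv : d (f2 + cst l * f3) = b by apply: d_add_lt; lra.
have dd := d_diff dy.
have W : wdg (f1 + cst k * f3) (f2 + cst l * f3) != 0.
  exact: jac_wdg (jac_rot (jac_rot (jac_shift3 k l))).
have v0 : (0 < d (f2 + cst l * f3)%R)%Re by rewrite dv; lra.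
have vu : (d (f2 + cst l * f3)%R < d (f1 + cst k * f3)%R)%Re by rewrite du dv.
have yu : (d (y - f3)%R < d (f1 + cst k * f3)%R)%Re by rewrite du dd; lra.
case: (half_case charC v0 vu W S yu) => [[q e]|[m m2 e]|[p [op p3 e SUx]]].
- exfalso; have := dd; rewrite e d_evu // dv => h.
  by case: (mult_cases (b := b) ltac:(lra) (esym h)); lra.
- by left; exists m => //; rewrite -du -dv.
right; rewrite du dv in e SUx.
have h := SUx.1; rewrite dd du dv in h; have hD := D_ge0 X (f1 + cst k * f3) (f2 + cst l * f3).
split; last by split=> //; lra.
by case: (odd_cases (b := b) ltac:(lra) op p3 e); lra.
Qed.

Lemma E1_of f : (exists k l, f = cst k * f2 + cst l * f3) -> forall y, (d y < a)%Re -> sub f2 f3 (y - f1) ->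
  A (y + f) f2 f3 -> E1 f1 f2 f3.
Proof.
move=> [k [l ->]] y dy S hA; exists y; split=> //.
apply: A_eqv hA _; split; split; try exact: aff3_2; try exact: aff3_3.
- have e : y = y + (cst k * f2 + cst l * f3) - (cst k * f2 + cst l * f3) by ring.
  rewrite [X in aff3 _ _ _ X]e; apply: aff3B; first exact: aff3_1.
  by apply: aff3D; apply: aff3Z; [exact: aff3_2 | exact: aff3_3].
- apply: aff3D; first exact: aff3_1.
  by apply: aff3D; apply: aff3Z; [exact: aff3_2 | exact: aff3_3].
Qed.

Lemma pow_evu (g : P) (k : C) m : - (cst k * g ^+ m) = evu g (- (k *: 'X^m)).
Proof. by rewrite rmorphN -mul_polyC rmorphM rmorphXn evuX evuC. Qed.

Lemma lead_pow g f m : (0 < d g)%Re -> (0 < m)%N -> d f = (INR m * d g)%Re ->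
  exists k, (d (f - cst k * g ^+ m)%R < d f)%Re.
Proof.
move=> g0 m0 e; have [||k _ h] := @dlead _ _ X f (g ^+ m); last by exists k.
  by rewrite dX // (d_pos_neq0 g0).
by rewrite e; apply: Rmult_lt_0_compat => //; apply: lt_0_INR; apply/ssrnat.ltP.
Qed.

Hypothesis N : Nlt (sumd f1 f2 f3).

(** Lowering [f1] by a power of [f3] commutes with the given reduction of [f2], by [square2]; so
    [f1] may be lowered first. *)
Lemma R13_E2_E1 m : (2 <= m)%N -> a = (INR m * c)%Re -> E2 f1 f2 f3 -> E1 f1 f2 f3.
Proof.
move=> m2 e [k [y [S dy hA]]]; have [c0 cb ba] := G.
set g := f1 + cst k * f2 in S hA.
have dg : d g = a by apply: d_add_lt.
have eg : d g = (INR m * d f3)%Re by rewrite dg.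
have [l hl] := lead_pow c0 (ltnW m2) eg.
have hA' : A f3 g y := A_eqv hA (eqv_312 _ _ _ _).
have S0 : A f3 (g - cst l * f3 ^+ m) f2.
  apply: (square2 N hA' (q := - (l *: 'X^m)) (y := y)).
  - by rewrite /degsum dg; lra.
  - by rewrite -pow_evu; ring.
  - exact: sub_sym.
  - by rewrite /degsum; lra.
have hy : (d (f1 - cst l * f3 ^+ m)%R < a)%Re.
  have -> : f1 - cst l * f3 ^+ m = (g - cst l * f3 ^+ m) - cst k * f2 by rewrite /g; ring.
  by have := dB X (g - cst l * f3 ^+ m) (cst k * f2); have := dZ_le X k f2; dl.
apply: (@E1_of (cst k * f2 + cst 0 * f3) _ (f1 - cst l * f3 ^+ m)) => //.
- by exists k, 0.
- have -> : f1 - cst l * f3 ^+ m - f1 = - (cst l * f3 ^+ m) by ring.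
  by apply: subN; apply: subZ; apply: subX; exact: sub_r.
- have -> : f1 - cst l * f3 ^+ m + (cst k * f2 + cst 0 * f3) = g - cst l * f3 ^+ m.
    by rewrite rmorph0 /g; ring.
  by apply: A_eqv S0 _; apply: eqv_231.
Qed.
End Good.

End Moves.

(** * Wedges of shifted pairs and elements of least degree *)

Section Peaks.
Variables (C : fieldType) (P : idomainType) (X : ctx C P).
Hypothesis charC : [pchar C] =i pred0.
Local Notation d := (wd X).
Local Notation D := (dwdg X).
Local Notation cst := (wcst X).
Local Notation mon := (wmn X).
Local Notation evu := (evu X).
Local Notation sub := (sub X).
Local Notation jac := (jac X).
Local Notation wdg := (wdg X).
Local Notation SU := (SU X).
Local Notation NC := (NC X).
Local Notation aff2 := (aff2 X).
Local Notation aff3 := (aff3 X).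
Local Notation eqv := (eqv X).
Local Notation good := (good X).
Local Notation canon := (canon X).
Local Ltac dl := dlra (wd X).
Implicit Types f g h x y z u v w : P.

Local Notation Kcond := (Kcond X).
Variables x1 x2 x3 : P.
Local Notation A := (redtriple X x1 x2 x3).
Local Notation Ebase := (Ebase X x1 x2 x3).
Local Notation Ecert := (Ecert X x1 x2 x3).
Local Notation Kcert := (Kcert X x1 x2 x3).
Hypothesis base : base_ok X x1 x2 x3.

Local Notation sumd := (degsum X).
Local Notation Nlt := (Nlt X x1 x2 x3).
Local Notation E1 := (E1 X x1 x2 x3).
Local Notation E2 := (E2 X x1 x2 x3).
Local Notation E3 := (E3 X x1 x2 x3).
Local Notation closed := (closed X x1 x2 x3).
Local Ltac inr := rewrite /=; lra.

Lemma dvZc (k : C) (v : 'rV[P]_3) : k != 0 -> dv X (cst k *: v) = dv X v.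
Proof.
move=> k0; have [->|v0] := eqVneq v 0; first by rewrite scaler0.
by rewrite dvZ ?cst_neq0 // d_cst; lra.
Qed.

Lemma dvZc_le (k : C) (v : 'rV[P]_3) : (dv X (cst k *: v)%R <= dv X v)%Re.
Proof. by have := dvZ_le X (cst k) v; rewrite d_cst; lra. Qed.

Lemma D_add_gt f g h k : (D g h < D f h)%Re -> D (f + cst k * g) h = D f h.
Proof.
move=> hD; rewrite /dwdg wdgDl wdgZl addrC dvD_lt //; have := dvZc_le k (wdg g h).
by rewrite -/(D g h) -/(D f h); lra.
Qed.

Lemma wdg_shift3 f1 f2 f3 k l : wdg (f1 + cst k * f3) (f2 + cst l * f3) =
  wdg f1 f2 + (cst l *: wdg f1 f3 + cst k *: wdg f3 f2).
Proof.
rewrite wdgDl !wdgDr !wdgZl !wdgZr wdgxx !scaler0 addr0 -addrA.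
by congr (_ + _); rewrite addrC.
Qed.

(** The shifted wedge is [df1 /\ df2] plus multiples of [df1 /\ df3] and [df3 /\ df2]. The three
    degrees are distinct, so the largest term present decides. *)
Lemma D_shift3 f1 f2 f3 k l : (D f2 f3 < D f1 f3)%Re -> (D f1 f2 < D f2 f3)%Re ->
  (k != 0 \/ l != 0) -> (D f2 f3 <= D (f1 + cst k * f3) (f2 + cst l * f3))%Re.
Proof.
move=> h1 h2 hkl; rewrite {2}/dwdg wdg_shift3.
have e : D f3 f2 = D f2 f3 by rewrite D_sym.
have [l0|l0] := eqVneq l 0; last first.
  have h3 : dv X (cst k *: wdg f3 f2 + cst l *: wdg f1 f3) = D f1 f3.
    have h4 : dv X (cst l *: wdg f1 f3) = D f1 f3 by exact: dvZc.
    by rewrite dvD_lt h4 //; have := dvZc_le k (wdg f3 f2); rewrite -/(D f3 f2) e; lra.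
  by rewrite dvD_lt [cst l *: _ + _]addrC h3 //; [lra | rewrite -/(D f1 f2); lra].
have k0 : k != 0 by case: hkl => //; rewrite l0 eqxx.
have h : dv X (cst k *: wdg f3 f2) = D f2 f3 by rewrite dvZc // -e.
by rewrite l0 rmorph0 scale0r add0r dvD_lt h //; lra.
Qed.

Lemma D_shift3_big f1 f2 f3 k l : (D f1 f3 < D f1 f2)%Re -> (D f2 f3 < D f1 f2)%Re ->
  D (f1 + cst k * f3) (f2 + cst l * f3) = D f1 f2.
Proof.
move=> h1 h2; rewrite /dwdg wdg_shift3 addrC dvD_lt //.
apply: Rle_lt_trans (dvD _ _ _) _; apply: Rmax_lub_lt.
  by apply: Rle_lt_trans (dvZc_le _ _) _; exact: h1.
by apply: Rle_lt_trans (dvZc_le _ _) _; rewrite -/(D f3 f2) D_sym; exact: h2.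
Qed.

Lemma Ebase_num f1 f2 f3 : Ebase f1 f2 f3 -> (d f1 < 2 * d f3)%Re /\ forall m n, (0 < m)%N ->
  [/\ (INR m * d f1 <> INR n * d f2)%Re, (INR m * d f1 <> INR n * d f3)%Re & (INR m * d f2 <> INR n * d f3)%Re].
Proof.
by move=> [-> -> ->]; case: base.
Qed.

Lemma Kcert_num f1 f2 f3 : good f1 f2 f3 -> jac f1 f2 f3 -> Kcert f1 f2 f3 ->
  [/\ (2 * D f1 f3 = d f2 + 2 * D f2 f3)%Re, (D f1 f2 = d f3 + D f2 f3)%Re, (3 * d f2 < 2 * D f2 f3)%Re &
   (d f2 < 2 * d f3)%Re] /\
  ((2 * d f1 = 3 * d f2 /\ 4 * d f3 < 3 * d f2) \/
   (5 * d f2 < 4 * d f1 /\ 2 * d f1 < 3 * d f2 /\ 4 * d f3 = 3 * d f2))%Re.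
Proof.
move=> G J [k [q [y [hA K]]]]; have [c0 cb ba] := G.
have J' : jac f1 (f2 + cst k * f3) f3.
  by have := jac_shift3 J 0 k; rewrite rmorph0 mul0r addr0.
have [[k1 k2 k3 k4] k5] := K_degrees charC J' K.
have e1 := K_D12x charC J' K; have e2 := K_D13 charC J' K.
have [_ _ en _] := K.
have dF : d (f2 + cst k * f3) = d f2 by apply: d_add_lt.
have DF : D (f2 + cst k * f3) f3 = D f2 f3.
  by rewrite /dwdg wdgDl wdgZl wdgxx scaler0 addr0.
rewrite dF DF in k1 k2 k3 k4 k5 e1 e2 en.
have e3 : D f1 f2 = D f1 (f2 + cst k * f3).
  rewrite /dwdg wdgDr wdgZr addrC dvD_lt //.
  have : wdg f1 f2 = wdg f1 (f2 + cst k * f3) + cst (- k) *: wdg f1 f3.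
    by rewrite wdgDr wdgZr rmorphN scaleNr addrK.
  move=> ->; rewrite addrC dvD_lt -/(D f1 (f2 + cst k * f3)) e1.
    by apply: Rle_lt_trans (dvZc_le _ _) _; rewrite -/(D f1 f3); lra.
  by apply: Rle_lt_trans (dvZc_le _ _) _; rewrite -/(D f1 f3); lra.
by split=> //; split; rewrite ?e3; lra.
Qed.

(** Such an [x] cannot be lowered by [f] and [g]; in particular its degree is no positive multiple
    of [d f] or [d g], which eliminates most numerical possibilities below. *)
Definition minimal f g x := forall z, sub f g (z - x) -> (d x <= d z)%Re.

Lemma minimal_exists f g x : exists y, sub f g (y - x) /\ minimal f g y.
Proof. by apply: (@coset_min _ _ X (sub f g)) => [u v|]; [exact: subD | exact: sub0]. Qed.

Lemma minimal_mult_r f g x m : (0 < d g)%Re -> minimal f g x -> (0 < m)%N -> d x <> (INR m * d g)%Re.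
Proof.
move=> g0 M m0 e; have [k hk] := lead_pow g0 m0 e.
suff : (d x <= d (x - cst k * g ^+ m)%R)%Re by lra.
apply: M; have -> : x - cst k * g ^+ m - x = - (cst k * g ^+ m) by ring.
by apply: subN; apply: subZ; apply: subX; exact: sub_r.
Qed.

Lemma minimal_swap f g x : minimal f g x -> minimal g f x.
Proof. by move=> M z /sub_sym; exact: M. Qed.

Lemma minimal_mult_l f g x m : (0 < d f)%Re -> minimal f g x -> (0 < m)%N -> d x <> (INR m * d f)%Re.
Proof. by move=> f0 /minimal_swap; exact: minimal_mult_r. Qed.

Lemma minimal_no f g x y : minimal f g x -> sub f g (y - x) -> (d y < d x)%Re -> False.
Proof. by move=> M /M; lra. Qed.

(** A power of [f2], or of its shift along [f3], matches the leading form of [f1]; the squares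
    exchange this reduction with the given one. *)
Lemma R12toE1 f1 f2 f3 m : good f1 f2 f3 -> jac f1 f2 f3 -> Nlt (sumd f1 f2 f3) ->
  (2 <= m)%N -> d f1 = (INR m * d f2)%Re -> E2 f1 f2 f3 \/ E3 f1 f2 f3 -> E1 f1 f2 f3.
Proof.
move=> G J N m2 e; have [c0 cb ba] := G; have m0 := ltnW m2.
have b0 : (0 < d f2)%Re by lra.
have h2 : (2 * d f2 <= d f1)%Re by rewrite e; apply: Rmult_le_compat_r; [lra | exact: INR_ge2].
case=> [[k [y [S dy hA]]]|[k [l [y [S dy hA]]]]].
  have [[[q eq] [m' m2' e']]|[m' m2' e']|[[p [op p3 ep]] [hD _]]] := E2num charC J G S dy.
  - set g := f1 + cst k * f2 in S hA.
    have dg : d g = d f1 by apply: d_add_lt.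
    have eg : d g = (INR m * d f2)%Re by rewrite dg.
    have [r hr] := lead_pow b0 m0 eg.
    have S0 : A f3 f2 (g - cst r * f2 ^+ m).
      apply: (square1 N (A_eqv hA (eqv_321 _ _ _ _)) (q := q)) => //.
      + by rewrite /degsum dg; lra.
      + have -> : g - cst r * f2 ^+ m - g = - (cst r * f2 ^+ m) by ring.
        by apply: subN; apply: subZ; apply: subX; exact: sub_r.
      + by rewrite /degsum; lra.
    have hy : (d (f1 - cst r * f2 ^+ m)%R < d f1)%Re.
      have -> : f1 - cst r * f2 ^+ m = (g - cst r * f2 ^+ m) - cst k * f2 by rewrite /g; ring.
      by have := dB X (g - cst r * f2 ^+ m) (cst k * f2); have := dZ_le X k f2; dl.
    apply: (E1_of (f := cst k * f2 + cst 0 * f3) _ (y:=f1 - cst r * f2 ^+ m)) => //.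
    + by exists k, 0.
    + have -> : f1 - cst r * f2 ^+ m - f1 = - (cst r * f2 ^+ m) by ring.
      by apply: subN; apply: subZ; apply: subX; exact: sub_l.
    + have -> : f1 - cst r * f2 ^+ m + (cst k * f2 + cst 0 * f3) = g - cst r * f2 ^+ m.
        by rewrite rmorph0 /g; ring.
      by apply: A_eqv S0 _; apply: eqv_321.
  - by apply: (R13_E2_E1 G N m2' e'); exists k, y.
  - have hD2 : (2 <= D (f1 + cst k * f2) f3)%Re.
      by apply: D_ge2; exact: jac_wdg (jac_swap (jac_shift1 J k)).
    by exfalso; case: (odd_cases c0 op p3 ep); lra.
set u1 := f1 + cst k * f3 in S hA; set u2 := f2 + cst l * f3 in S hA.
have d1 : d u1 = d f1 by apply: d_add_lt; lra.
have d2 : d u2 = d f2 by apply: d_add_lt; lra.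
have u20 : (0 < d u2)%Re by rewrite d2.
have eu : d u1 = (INR m * d u2)%Re by rewrite d1 d2.
have [r hr] := lead_pow u20 m0 eu.
have S0 : A u2 (u1 - cst r * u2 ^+ m) f3.
  apply: (square2 N (A_eqv hA (eqv_213 _ _ _ _)) (q := - (r *: 'X^m)) (y := y)).
  - by rewrite /degsum d1 d2; lra.
  - by rewrite -pow_evu; ring.
  - exact: sub_sym.
  - by rewrite /degsum d2; lra.
have hy : (d (f1 - cst r * u2 ^+ m)%R < d f1)%Re.
  have -> : f1 - cst r * u2 ^+ m = (u1 - cst r * u2 ^+ m) - cst k * f3 by rewrite /u1; ring.
  by have := dB X (u1 - cst r * u2 ^+ m) (cst k * f3); have := dZ_le X k f3; dl.
exists (f1 - cst r * u2 ^+ m); split=> //.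
  have -> : f1 - cst r * u2 ^+ m - f1 = - (cst r * u2 ^+ m) by ring.
  apply: subN; apply: subZ; apply: subX; apply: subD; first exact: sub_l.
  by apply: subZ; exact: sub_r.
apply: A_eqv S0 _; split; split.
- have -> : f1 - cst r * u2 ^+ m = (u1 - cst r * u2 ^+ m) - cst k * f3 by rewrite /u1; ring.
  by apply: aff3B; [exact: aff3_2 | apply: aff3Z; exact: aff3_3].
- have -> : f2 = u2 - cst l * f3 by rewrite /u2; ring.
  by apply: aff3B; [exact: aff3_1 | apply: aff3Z; exact: aff3_3].
- exact: aff3_3.
- by apply: aff3D; [exact: aff3_2 | apply: aff3Z; exact: aff3_3].
- have -> : u1 - cst r * u2 ^+ m = (f1 - cst r * u2 ^+ m) + cst k * f3 by rewrite /u1; ring.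
  by apply: aff3D; [exact: aff3_1 | apply: aff3Z; exact: aff3_3].
- exact: aff3_3.
Qed.

(** * Critical planes *)

Lemma D_ge2_jac f g h : jac f g h -> (2 <= D g h)%Re.
Proof. by move=> J; apply: D_ge2; exact: jac_wdg J. Qed.

Lemma jac132 f g h : jac f g h -> jac f h g.
Proof. by move=> J; exact: jac_rot (jac_swap J). Qed.
Lemma two_max_all f g h : jac f g h ->
  [/\ (d f + D g h <= Rmax (d g + D f h) (d h + D f g))%Re,
      (d g + D f h <= Rmax (d f + D g h) (d h + D f g))%Re &
      (d h + D f g <= Rmax (d f + D g h) (d g + D f h))%Re].
Proof.
move=> J; have t1 := two_max J; have t2 := two_max (jac_rot J); have t3 := two_max (jac_rot (jac_rot J)).
rewrite (D_sym X h f) (D_sym X g f) in t2; rewrite (D_sym X h g) (D_sym X h f) in t3.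
by split; move: t1 t2 t3; rmax; lra.
Qed.

(** One reduction brings the sum of degrees into the range of the induction hypothesis; from there
    the first element may be changed freely modulo the subalgebra of [f2] and [f3], in particular to
    one of least degree. *)
Lemma minimal_in_A f1 f2 f3 y0 : Nlt (sumd f1 f2 f3) -> sub f2 f3 (y0 - f1) -> (d y0 < d f1)%Re -> A y0 f2 f3 ->
  exists x, [/\ A x f2 f3, minimal f2 f3 x, sub f2 f3 (x - f1), (d x < d f1)%Re & jac x f2 f3].
Proof.
move=> N S dy hA; have [x [hx M]] := minimal_exists f2 f3 y0.
have dx : (d x <= d y0)%Re by apply: M; rewrite -opprB; exact: subN.
have Ax : A x f2 f3 by apply: (step1 N hA) => //; rewrite /degsum; lra.
exists x; split=> //; last exact: (A_jac base Ax).
  have -> : x - f1 = (x - y0) + (y0 - f1) by ring.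
  exact: subD.
lra.
Qed.

(* Degrees proportional to (9, 6, 4). *)
Lemma critical_964 f1 f2 f3 : good f1 f2 f3 -> A f1 f2 f3 -> Nlt (sumd f1 f2 f3) ->
  (4 * d f1 = 9 * d f3)%Re -> (2 * d f2 = 3 * d f3)%Re -> (d f1 - d f2 + D f1 f2 <= d f3)%Re ->
  (d f1 - d f2 < D f2 f3)%Re -> E1 f1 f2 f3 -> False.
Proof.
move=> G hA N ea eb hk hD [y0 [S0 dy0 hA0]]; have [c0 cb ba] := G; have J := A_jac base hA.
have b0 : (0 < d f2)%Re by lra.
have [x [Ax M S dx Jx]] := minimal_in_A N S0 dy0 hA0.
(* No monomial in [f2], [f3] has the degree of [f1], because [6 i + 4 j = 9] has no solution. So the
   reduction of [f1] involves cancellation and [SU] applies. *)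
have K1 : (2 * d f2 - d f3 + D f2 f3 <= D (x - f1) f2)%Re.
  case: (E1num charC J G S dx) => [[i [j e]]|[m m2 e]|[p [q [p2 q2 _ e SUx]]]].
  - exfalso; have e' : (d f1 - INR j * d f3 = INR i * d f2)%Re by lra.
    by case: (mult_cases b0 e') => [[]|||]; case: (mult_cases (a := INR j * d f3) c0 erefl) => [[]|||]; lra.
  - by exfalso; case: (mult2_cases c0 m2 e); lra.
  - have h2 : (2 * d f2 <= INR q * d f2)%Re by apply: INR2_mul_le => //; lra.
    have [|_ h _] := SUx.2; first by rewrite d_diff //; lra.
    by move: h; lra.
have D12 := D_ge0 X f1 f2.
have K2 : D x f2 = D (x - f1) f2.
  have -> : D x f2 = D (f1 + (x - f1)) f2 by rewrite addrC subrK.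
  by rewrite /dwdg wdgDl dvD_lt // -/(D f1 f2) -/(D (x - f1) f2); lra.
have hx := D_le X x f2.
have [t1 t2 t3] := two_max_all Jx.
have nm m := minimal_mult_r (m := m) c0 M; have nm' m := minimal_mult_l (m := m) b0 M.
have n1 := nm' 1%N isT; have n2 := nm 2%N isT; have n3 := nm 1%N isT.
rewrite /= in n1 n2 n3.
have Dx3 : (D f2 f3 + d f2 <= D x f3)%Re.
  have hx3 : (2 * d f2 + D f2 f3 <= d f3 + D x f2)%Re by lra.
  by move: t3; rmax; lra.
(* The order of [d x] and [d f2] determines the basis with decreasing degrees. In both orders each
   certificate contradicts the degrees or the minimality of [x]. *)
case: (Rlt_le_dec (d f2) (d x)) => o1.
  have Gx : good x f2 f3 by split=> //; lra.
  case: (cert_form charC base Gx Ax) => [B|K|/EcertE [[y [Sy dy _]]|[k [y [Sy dy _]]]|[k [l [y [Sy dy _]]]]]].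
  - have [_ nb] := Ebase_num B; have [_ _ nn] := nb 2%N 3%N isT; apply: nn; inr.
  - have [[k1 k2 k3 k4] k5] := Kcert_num Gx Jx K; lra.
  - exact: minimal_no M Sy dy.
  - case: (E2num charC Jx Gx Sy dy) => [[_ [m m2 e]]|[m m2 e]|[[p [op p3 e]] _]].
    + by case: (mult2_cases c0 m2 e); lra.
    + by apply: (nm m) => //; exact: ltnW.
    + by case: (odd_cases c0 op p3 e); lra.
  - case: (E3num charC Jx Gx Sy dy) => [[m m2 e]|[e _]]; last lra.
    by apply: (nm' m) => //; exact: ltnW.
have o2 : (d x < d f2)%Re by lra.
have o3 : (d f3 < d x)%Re by lra.
have Gx : good f2 x f3 by split.
have Ax' : A f2 x f3 by apply: A_eqv Ax _; exact: eqv_213.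
have Jx' := jac_swap Jx.
case: (cert_form charC base Gx Ax') => [B|K|/EcertE [[y [Sy dy _]]|[k [y [Sy dy _]]]|[k [l [y [Sy dy _]]]]]].
- have [_ nb] := Ebase_num B; have [_ nn _] := nb 2%N 3%N isT; apply: nn; inr.
- have [[k1 k2 k3 k4] k5] := Kcert_num Gx Jx' K; lra.
- case: (E1num charC Jx' Gx Sy dy) => [[i [j e]]|[m m2 e]|[p [q [p2 q2 _ e SUx]]]].
  + have e' : (d f2 - INR j * d f3 = INR i * d x)%Re by lra.
    by case: (mult_cases (b := d x) ltac:(lra) e') => [[]|||]; case: (mult_cases (a := INR j * d f3) c0 erefl) => [[]|||]; lra.
  + by apply: (nm m) => //; exact: ltnW.
  + have h2 : (2 * d x <= INR q * d x)%Re by apply: INR2_mul_le => //; lra.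
    by have := SUx.1; rewrite d_diff //; lra.
- case: (E2num charC Jx' Gx Sy dy) => [[_ [m m2 e]]|[m m2 e]|[_ [h _]]].
  + by apply: (nm m) => //; exact: ltnW.
  + by case: (mult2_cases c0 m2 e); lra.
  + have [k0|k0] := eqVneq k 0.
      by apply: (minimal_no M _ dy); move: Sy; rewrite k0 rmorph0 mul0r addr0.
    have hh : D (f2 + cst k * x) f3 = D x f3.
      rewrite /dwdg wdgDl wdgZl dvD_lt dvZc //.
      by rewrite -/(D f2 f3) -/(D x f3); lra.
    by rewrite hh in h; lra.
- case: (E3num charC Jx' Gx Sy dy) => [[m m2 e]|[e _]]; last lra.
  by case: (mult2_cases (b := d x) ltac:(lra) m2 e); lra.
Qed.

Lemma Nlt_le mu nu : (nu <= mu)%Re -> Nlt mu -> Nlt nu.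
Proof. by move=> h N f g k hA hs; apply: N hA _; lra. Qed.

Lemma D_sub1 f x h : (D f h < D (f - x) h)%Re -> D x h = D (f - x) h.
Proof.
move=> hD; have e : wdg x h = wdg f h - wdg (f - x) h.
  by rewrite wdgDl wdgNl opprD opprK addrA subrr add0r.
by rewrite /dwdg e dvD_lt dvN.
Qed.

Lemma D_sub2 f x h : (D (f - x) h < D f h)%Re -> D x h = D f h.
Proof.
move=> hD; have e : wdg x h = - wdg (f - x) h + wdg f h.
  by rewrite wdgDl wdgNl opprD opprK addrC addrA subrr add0r.
by rewrite /dwdg e dvD_lt // dvN.
Qed.

Lemma D_evu g h (q : {poly C}) : (0 < d h)%Re -> (1 < size q)%N -> wdg g h != 0 ->
  D (evu h q) g = (d (evu h q) - d h + D g h)%Re.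
Proof.
move=> h0 sq w0; have [n0 dn] := evu_deriv_deg charC h0 sq.
rewrite /dwdg wdg_evu dvZ //; last by rewrite wdgC oppr_eq0.
rewrite dn d_evu // -/(D h g) -/(D g h) D_sym.
by case: (size q) sq => [|[|n]] // _; rewrite -[n.+2.-1]/(n.+1) -[n.+2.-2]/n S_INR; lra.
Qed.

Lemma D_aff_evu c g h (q : {poly C}) : (0 < d h)%Re -> wdg g h != 0 -> (d g < d (cst c * g + evu h q)%R)%Re ->
  [/\ (1 < size q)%N, d (cst c * g + evu h q) = (INR (size q).-1 * d h)%Re,
   D (cst c * g + evu h q) g = (d (cst c * g + evu h q)%R - d h + D g h)%Re &
   (D (cst c * g + evu h q) h <= D g h)%Re].
Proof.
move=> h0 w0 hd; have e : d (cst c * g + evu h q) = d (evu h q).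
  apply: dD_lt; apply: Rle_lt_trans (dZ_le _ _ _) _; apply: Rnot_le_lt => hle.
  have h1 := dD X (cst c * g) (evu h q); have h2 := dZ_le X c g; move: h1 hle hd; rmax; dl.
have sq : (1 < size q)%N.
  rewrite ltnNge; apply/negP => /size1_polyC eq1; have := d_ge0 X g.
  by move: hd; rewrite e eq1 evuC d_cst; lra.
split=> //; first by rewrite e d_evu.
  rewrite e -D_evu // /dwdg wdgDl wdgZl wdgxx scaler0 add0r //.
rewrite /dwdg wdgDl wdgZl wdg_evu wdgxx scaler0 addr0; exact: dvZc_le.
Qed.

(* The lemmas [SC_*] and [critical_SC] deal with degrees proportional to (12, 8, 6).  Reducing [f1]
   modulo k[f2, f3] to an element [x] of least degree fixes the degrees of [dx /\ df2] and
   [dx /\ df3], and then no reduction of the new triple is possible, except the exceptional one,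
   which also reduces [f3]. *)
Lemma SC_large f1 f2 f3 x c (q : {poly C}) : good f1 f2 f3 -> wdg f2 f3 != 0 ->
  (d f1 = 2 * d f3)%Re -> (3 * d f2 = 4 * d f3)%Re -> (3 * D f1 f2 <= d f3)%Re -> (2 * d f3 < 3 * D f2 f3)%Re ->
  A x f2 f3 -> minimal f2 f3 x -> f1 - x = cst c * f2 + evu f3 q ->
  jac x f2 f3 -> (d f2 < d x < d f1)%Re -> (3 * D x f3 = 2 * d f3 + 3 * D f2 f3)%Re ->
  exists y, [/\ sub f1 f2 (y - f3), (d y < d f3)%Re & A f1 f2 y].
Proof.
move=> [c0 cb ba] w0 ea eb h12 h23 Ax M ex Jx [sx sx'] Dx3.
have Gx : good x f2 f3 by split.
case: (cert_form charC base Gx Ax) => [B|[k [r [y [hA K]]]]|/EcertE [[y [Sy dy _]]|[k [y [Sy dy _]]]|[k [l [y [Sy dy _]]]]]].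
- by have [_ nb] := Ebase_num B; have [_ _ nn] := nb 3%N 4%N isT; case: nn; inr.
- have [_ Sy e [k1 k2 k3 k4 _]] := K.
  have g2 : d (f2 + cst k * f3) = d f2 by exact: d_add_lt.
  rewrite g2 in e k1 k2 k3; set P1 := x + evu f3 r in hA Sy e k1 k3 k4.
  (* The left side has degree at most [1/3 d f3]. The terms on the right, if present, have degrees
     [2/3 d f3 + D f2 f3] and [n d f3 + D f2 f3] with [n] natural, so they are larger and cannot
     cancel. Hence [k = 0] and [r - q] is constant: the exceptional reduction of [(x, f2, f3)]
     lowers [f3] in the original triple as well. *)
  have ew : wdg P1 (f2 + cst k * f3) - wdg f1 f2 = cst k *: wdg x f3 + evu f3 (r - q)^`() *: wdg f3 f2.
    have -> : f1 = x + (cst c * f2 + evu f3 q) by rewrite -ex; ring.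
    rewrite /P1 !(wdgDl, wdgDr, wdgZl, wdgZr, wdgxx, wdg_evu) derivB rmorphB /= !(scaler0, addr0, add0r).
    rewrite scalerBl; apply/rowP => i; rewrite !mxE; ring.
  have hv : (3 * dv X (wdg P1 (f2 + cst k * f3) - wdg f1 f2)%R <= d f3)%Re.
    have t := dvD X (wdg P1 (f2 + cst k * f3)) (- wdg f1 f2).
    rewrite dvN -/(D P1 (f2 + cst k * f3)) -/(D f1 f2) in t.
    by move: t; rmax; lra.
  rewrite ew in hv; have D3 := D_ge0 X f2 f3.
  have vk : k != 0 -> dv X (cst k *: wdg x f3) = D x f3 by move=> k0; rewrite dvZc.
  have [s1|s1] := leqP (size (r - q)%R) 1; last first.
    exfalso; have [n0 dn] := evu_deriv_deg charC c0 s1.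
    have vr : dv X (evu f3 (r - q)^`() *: wdg f3 f2) = (INR (size (r - q)%R).-2 * d f3 + D f2 f3)%Re.
      have w0' : wdg f3 f2 != 0 by rewrite wdgC oppr_eq0.
      by rewrite dvZ // dn -/(D f3 f2) D_sym.
    have p0 : (0 <= INR (size (r - q)%R).-2 * d f3)%Re by apply: Rmult_le_pos; [exact: pos_INR | lra].
    have [k0|k0] := eqVneq k 0.
      by move: hv; rewrite k0 rmorph0 scale0r add0r vr; lra.
    have := vk k0; move: vr; case: (mult_cases (a := INR (size (r - q)%R).-2 * d f3) c0 erefl) => [[|]|||] h vr vk'.
    + by move: hv; rewrite addrC dvD_lt ?vk' ?vr; lra.
    + by move: hv; rewrite dvD_lt ?vk' ?vr; lra.
    + by move: hv; rewrite dvD_lt ?vk' ?vr; lra.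
    + by move: hv; rewrite dvD_lt ?vk' ?vr; lra.
    + by move: hv; rewrite dvD_lt ?vk' ?vr; lra.
  have rc := size1_polyC s1.
  have k0 : k = 0.
    apply/eqP; apply/negP => /negP k0; have := vk k0; move: hv.
    by rewrite rc derivC rmorph0 scale0r addr0 => h1 h2; lra.
  have eP : P1 = f1 - cst c * f2 + cst (r - q)`_0.
    have -> : f1 = x + (cst c * f2 + evu f3 q) by rewrite -ex; ring.
    by rewrite /P1 -(evuC X f3 (r - q)`_0) -rc rmorphB /=; ring.
  have g2e : f2 + cst k * f3 = f2 by rewrite k0 rmorph0; ring.
  rewrite g2e in Sy hA k1 k3.
  exists y; split; last 2 first.
  + by lra.
  + apply: A_eqv hA _; rewrite eP; split; split.
    * by exists 1, c, 0, (- (r - q)`_0); rewrite rmorph1 rmorph0 rmorphN /=; ring.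
    * exact: aff3_2.
    * exact: aff3_3.
    * by exists 1, (- c), 0, ((r - q)`_0); rewrite rmorph1 rmorph0 rmorphN /=; ring.
    * exact: aff3_2.
    * exact: aff3_3.
  + apply: sub_trans Sy; last exact: sub_r.
    rewrite eP; apply: subD (sub_cst _ _ _ _); apply: subB; [exact: sub_l | apply: subZ; exact: sub_r].
- by case: (minimal_no M Sy dy).
- case: (E2num charC Jx Gx Sy dy) => [[_ [m m2 e]]|[m m2 e]|[_ [h _]]].
  + by case: (mult2_cases c0 m2 e); lra.
  + by case: (minimal_mult_r (m := m) c0 M (ltnW m2) e).
  + by have e := @D_add_gt x f2 f3 k ltac:(lra); rewrite e in h; lra.
- case: (E3num charC Jx Gx Sy dy) => [[m m2 e]|[e _]]; last lra.
  by case: (@minimal_mult_l f2 f3 x m ltac:(lra) M (ltnW m2) e).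
Qed.

Lemma SC_mid f2 f3 x : good f2 x f3 -> (3 * d f2 = 4 * d f3)%Re -> (2 * d f3 < 3 * D f2 f3)%Re ->
  A f2 x f3 -> minimal f2 f3 x -> (3 * D x f3 = 2 * d f3 + 3 * D f2 f3)%Re -> False.
Proof.
move=> G eb h23 hA M Dx3; have [c0 cx xb] := G; have J := A_jac base hA.
have nm m := minimal_mult_r (m := m) c0 M.
case: (cert_form charC base G hA) => [B|K|/EcertE [[y [Sy dy _]]|[k [y [Sy dy _]]]|[k [l [y [Sy dy _]]]]]].
- by have [_ nb] := Ebase_num B; have [_ nn _] := nb 3%N 4%N isT; case: nn; inr.
- by have [[k1 k2 k3 k4] k5] := Kcert_num G J K; lra.
- case: (E1num charC J G Sy dy) => [[i [j e]]|[m m2 e]|[p [q [p2 q2 _ e SUx]]]].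
  + have e' : (d f2 - INR j * d f3 = INR i * d x)%Re by lra.
    by case: (mult_cases (b := d x) ltac:(lra) e') => [[]|||]; case: (mult_cases (a := INR j * d f3) c0 erefl) => [[]|||]; lra.
  + by apply: (nm m) => //; exact: ltnW.
  + have h2 : (2 * d x <= INR q * d x)%Re by apply: INR2_mul_le => //; lra.
    by have := SUx.1; rewrite d_diff //; lra.
- case: (E2num charC J G Sy dy) => [[_ [m m2 e]]|[m m2 e]|[[p [op p3 e]] _]].
  + by apply: (nm m) => //; exact: ltnW.
  + by case: (mult2_cases c0 m2 e); lra.
  + by case: (odd_cases c0 op p3 e); lra.
- case: (E3num charC J G Sy dy) => [[m m2 e]|[e _]]; last lra.
  by case: (mult2_cases (b := d x) ltac:(lra) m2 e); lra.
Qed.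

Lemma SC_small_square f1 f2 f3 x : Nlt (sumd f1 f2 f3) -> good f2 f3 x -> (d f2 < d f1)%Re -> A f2 f3 x ->
  (3 * d f2 = 4 * d f3)%Re -> (2 * d x = d f3)%Re -> (2 * d f3 < 3 * D f2 f3)%Re ->
  D f2 x = (d f3 + D f2 f3)%Re -> (3 * D f3 x = 2 * d f3 + 3 * D f2 f3)%Re ->
  (exists y0, [/\ sub f2 x (y0 - f3), (d y0 < d f3)%Re & A f2 y0 x]) -> False.
Proof.
move=> N G21 ba hA eb es h23 D2x D3x [y0 [S0 dy0 hA0]]; have [x0 xc cb] := G21.
have E0 : A y0 f2 x by apply: A_eqv hA0 _; exact: eqv_213.
have N' : Nlt (sumd f3 f2 x) by apply: Nlt_le N; rewrite /degsum; lra.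
have [v [Av M S dvv Jv]] := minimal_in_A N' S0 dy0 E0.
have J := A_jac base hA; have b0 : (0 < d f2)%Re by lra.
have w2x : wdg f2 x != 0 by exact: jac_wdg (jac_rot (jac_rot (jac132 J))).
have S' : sub f2 x (f3 - v) by rewrite -opprB; exact: subN.
have dphi : d (f3 - v) = d f3 by rewrite -opprB dN d_diff.
(* Only a polynomial in [x] can occur; this determines the degrees of [dv /\ df2] and [dv /\ dx]. *)
have [q eq] : exists q, f3 - v = evu x q.
  case: (sub_cases charC b0 x0 w2x S') => [h|[m m1 e]|[m m1 e]|[p [q [p2 q2 _ e SUx]]]].
  - by apply: (NC_uni b0 x0 h); lra.
  - by exfalso; case: (mult_cases x0 e) => [[|]|||] h; lra.
  - by exfalso; case: (mult_cases b0 e) => [[|]|||] h; lra.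
  - exfalso; have h2 : (2 * d f2 <= INR q * d f2)%Re by apply: INR2_mul_le => //; lra.
    by have := SUx.1; rewrite dphi; lra.
have eq' : f3 - v = cst 0 * f2 + evu x q by rewrite rmorph0 mul0r add0r.
have dev : d (evu x q) = d f3 by rewrite -eq.
have Dv2 : D v f2 = (d f3 - d x + D f2 x)%Re.
  have sq : (1 < size q)%N.
    rewrite ltnNge; apply/negP => /size1_polyC eq1.
    by move: dev; rewrite eq1 evuC d_cst; lra.
  have := D_evu x0 sq w2x; rewrite -eq dphi => h.
  by rewrite -h; apply: D_sub1; rewrite h D_sym; lra.
have Dvx : D v x = D f3 x.
  apply: D_sub2; rewrite eq /dwdg wdg_evu wdgxx scaler0 dv0 -/(D f3 x); lra.
have hv := D_le X v f2.
have o1 : (5 * d f3 < 6 * d v)%Re by lra.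
have G : good f2 v x by split; lra.
have Ax : A f2 v x by apply: A_eqv Av _; exact: eqv_213.
have Jx := jac_swap Jv.
have nm m := minimal_mult_r (m := m) x0 M.
case: (cert_form charC base G Ax) => [B|K|/EcertE [[y [Sy dy _]]|[k [y [Sy dy _]]]|[k [l [y [Sy dy _]]]]]].
- by have [_ nb] := Ebase_num B; have [_ nn _] := nb 3%N 8%N isT; case: nn; inr.
- by have [[k1 k2 k3 k4] k5] := Kcert_num G Jx K; rewrite D_sym in k2; lra.
- case: (E1num charC Jx G Sy dy) => [[i [j e]]|[m m2 e]|[p [r [p2 r2 _ e SUx]]]].
  + have e' : (d f2 - INR j * d x = INR i * d v)%Re by lra.
    by case: (mult_cases (b := d v) ltac:(lra) e') => [[]|||]; case: (mult_cases (a := INR j * d x) x0 erefl) => [[]|||]; lra.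
  + by apply: (nm m) => //; exact: ltnW.
  + have h2 : (2 * d v <= INR r * d v)%Re by apply: INR2_mul_le => //; lra.
    by have := SUx.1; rewrite d_diff //; lra.
- case: (E2num charC Jx G Sy dy) => [[_ [m m2 e]]|[m m2 e]|[_ [h _]]].
  + by apply: (nm m) => //; exact: ltnW.
  + by case: (mult2_cases x0 m2 e); lra.
  + by have e := @D_add_gt f2 v x k ltac:(lra); rewrite e in h; lra.
- case: (E3num charC Jx G Sy dy) => [[m m2 e]|[e [h _]]].
  + by case: (mult2_cases (b := d v) ltac:(lra) m2 e); lra.
  + have e' := @D_shift3_big f2 v x k l; rewrite (D_sym X f2 v) in e'; rewrite e' in h; lra.
Qed.

Lemma SC_small_pow f1 f2 f3 x : Nlt (sumd f1 f2 f3) -> good f2 f3 x -> (d f2 < d f1)%Re -> A f2 f3 x ->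
  (3 * d f2 = 4 * d f3)%Re -> (3 * d x = 2 * d f3 \/ 9 * d x = 4 * d f3)%Re -> (2 * d f3 < 3 * D f2 f3)%Re ->
  D f2 x = (d f3 + D f2 f3)%Re -> (3 * D f3 x = 2 * d f3 + 3 * D f2 f3)%Re -> E1 f2 f3 x -> False.
Proof.
move=> N G21 ba hA eb es h23 D2x D3x [y0 [S0 dy0 hA0]]; have [x0 xc cb] := G21.
have N' : Nlt (sumd f2 f3 x) by apply: Nlt_le N; rewrite /degsum; lra.
have [u [Au M S du Ju]] := minimal_in_A N' S0 dy0 hA0.
have J := A_jac base hA; have c0 : (0 < d f3)%Re by lra.
have w3x : wdg f3 x != 0 by exact: jac_wdg J.
have S' : sub f3 x (f2 - u) by rewrite -opprB; exact: subN.
have dphi : d (f2 - u) = d f2 by rewrite -opprB dN d_diff.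
have [k0 [q [eq _]]] : exists c q, f2 - u = cst c * f3 + evu x q /\ (c != 0 -> (d f3 <= d (f2 - u)%R)%Re).
  case: (sub_cases charC c0 x0 w3x S') => [h|[m m1 e]|[m m1 e]|[p [q [p2 q2 _ e SUx]]]].
  - by apply: (NC_split c0 x0 h); lra.
  - by exfalso; case: (mult_cases x0 e) => [[|]|||] h; lra.
  - by exfalso; case: (mult_cases c0 e) => [[|]|||] h; lra.
  - exfalso; have h2 : (2 * d f3 <= INR q * d f3)%Re by apply: INR2_mul_le => //; lra.
    by have := SUx.1; rewrite dphi; lra.
have [|sq _ D3 Dx] := @D_aff_evu k0 f3 x q x0 w3x; first by rewrite -eq dphi; lra.
rewrite -eq dphi in D3 Dx.
have Du3 : D u f3 = (d f2 - d x + D f3 x)%Re by rewrite -D3; apply: D_sub1; rewrite D3; lra.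
have Dux : D u x = D f2 x by apply: D_sub2; lra.
have hu := D_le X u f3.
have G : good u f3 x by split; lra.
have nm m := minimal_mult_r (m := m) x0 M.
case: (cert_form charC base G Au) => [B|K|/EcertE [[y [Sy dy _]]|[k [y [Sy dy _]]]|[k [l [y [Sy dy _]]]]]].
- have [_ nb] := Ebase_num B; case: es => es.
  + by have [_ _ nn] := nb 2%N 3%N isT; case: nn; inr.
  + by have [_ _ nn] := nb 4%N 9%N isT; case: nn; inr.
- by have [[k1 k2 k3 k4] k5] := Kcert_num G Ju K; lra.
- by case: (minimal_no M Sy dy).
- case: (E2num charC Ju G Sy dy) => [[_ [m m2 e]]|[m m2 e]|[_ [h _]]].
  + by case: (mult2_cases x0 m2 e); lra.
  + by apply: (nm m) => //; exact: ltnW.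
  + by have e := @D_add_gt u f3 x k ltac:(lra); rewrite e in h; lra.
- case: (E3num charC Ju G Sy dy) => [[m m2 e]|[e _]]; last lra.
  by case: (mult2_cases c0 m2 e); lra.
Qed.

Lemma SC_small f1 f2 f3 x : Nlt (sumd f1 f2 f3) -> good f2 f3 x -> (d f2 < d f1)%Re -> A f2 f3 x ->
  (3 * d f2 = 4 * d f3)%Re -> (d f3 < 3 * d x)%Re -> (2 * d f3 < 3 * D f2 f3)%Re ->
  D f2 x = (d f3 + D f2 f3)%Re -> (3 * D f3 x = 2 * d f3 + 3 * D f2 f3)%Re -> False.
Proof.
move=> N G ba hA eb sx h23 D2x D3x; have [x0 xc cb] := G; have J := A_jac base hA.
have N' : Nlt (sumd f2 f3 x) by apply: Nlt_le N; rewrite /degsum; lra.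
case: (cert_form charC base G hA) => [B|K|/EcertE [E|E|[k [l [y [Sy dy _]]]]]].
- by have [_ nb] := Ebase_num B; have [nn _ _] := nb 3%N 4%N isT; case: nn; inr.
- by have [[k1 k2 k3 k4] k5] := Kcert_num G J K; lra.
- have [y [Sy dy hAy]] := E.
  (* [d f2 = 4/3 d f3] and [d x] lies strictly between [1/3 d f3] and [d f3]. So either [x^2]
     matches [f3] in degree, or [x^2] or [x^3] matches [f2]. *)
  have [es|es] : (2 * d x = d f3)%Re \/ (3 * d x = 2 * d f3 \/ 9 * d x = 4 * d f3)%Re.
    case: (E1num charC J G Sy dy) => [[i [j e]]|[m m2 e]|[p [r [p2 r2 _ e SUx]]]].
    + have e' : (d f2 - INR j * d x = INR i * d f3)%Re by lra.
      by case: (mult_cases (b := d f3) ltac:(lra) e') => [[]|||]; case: (mult_cases (a := INR j * d x) x0 erefl) => [[]|||]; lra.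
    + by case: (mult2_cases x0 m2 e); lra.
    + have h2 : (2 * d f3 <= INR r * d f3)%Re by apply: INR2_mul_le => //; lra.
      by have := SUx.1; rewrite d_diff //; lra.
  + apply: (SC_small_square N G ba hA eb es h23 D2x D3x).
    (* The multiple of [x^2] cancels the leading form of [f3]. Starting from the lower triple
       [(y, f3, x)], the induction hypothesis first changes [f3] and then restores [f2]. *)
    have [k hk] : exists k, (d (f3 - cst k * x ^+ 2)%R < d f3)%Re.
      by apply: lead_pow => //; inr.
    exists (f3 - cst k * x ^+ 2); split=> //.
      by apply: (_ : sub f2 x _); rewrite [_ - _ - _]addrC addKr; apply: subN; apply: subZ; apply: subX; exact: sub_r.
    have S3 z : sub z x (f3 - cst k * x ^+ 2 - f3).
      by rewrite [_ - _ - _]addrC addKr; apply: subN; apply: subZ; apply: subX; exact: sub_r.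
    have A1 : A y (f3 - cst k * x ^+ 2) x.
      by apply: (step2 N hAy) => //; rewrite /degsum; lra.
    apply: (step1 N A1); first by rewrite /degsum; lra.
    apply: sub_trans (_ : sub f3 x (f2 - y)); last by rewrite -opprB; exact: subN.
      have := sub_l X (f3 - cst k * x ^+ 2) x => /subD /(_ (subZ k (subX 2 (sub_r X _ x)))).
      by rewrite subrK.
    exact: sub_r.
  + exact: (SC_small_pow N G ba hA eb es h23 D2x D3x E).
- have [k [y [Sy dy hAy]]] := E.
  case: (E2num charC J G Sy dy) => [[[q eq] [m m2 e]]|[m m2 e]|[_ [h _]]].
  + have es : (2 * d x = d f3)%Re by case: (mult2_cases x0 m2 e); lra.
    apply: (SC_small_square N G ba hA eb es h23 D2x D3x); exists y; split=> //.
      by rewrite eq; apply: sub_evu; exact: sub_r.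
    apply: (step1 N hAy); first by rewrite /degsum d_add_lt //; lra.
    have -> : f2 - (f2 + cst k * f3) = - (cst k * (y - evu x q)) by rewrite -eq; ring.
    by apply: subN; apply: subZ; apply: subB; [exact: sub_l | apply: sub_evu; exact: sub_r].
  + have es : (3 * d x = 2 * d f3 \/ 9 * d x = 4 * d f3)%Re by case: (mult2_cases x0 m2 e); lra.
    by apply: (SC_small_pow N G ba hA eb es h23 D2x D3x); exact: (R13_E2_E1 G N' m2 e E).
  + by have e := @D_add_gt f2 f3 x k ltac:(lra); rewrite e in h; lra.
- case: (E3num charC J G Sy dy) => [[m m2 e]|[e _]]; last lra.
  by case: (mult2_cases (b := d f3) ltac:(lra) m2 e); lra.
Qed.

Lemma critical_SC f1 f2 f3 : good f1 f2 f3 -> A f1 f2 f3 -> Nlt (sumd f1 f2 f3) ->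
  (d f1 = 2 * d f3)%Re -> (3 * d f2 = 4 * d f3)%Re -> (d f1 - d f2 + D f1 f2 <= d f3)%Re ->
  (d f1 - d f2 < D f2 f3)%Re -> E1 f1 f2 f3 ->
  exists y, [/\ sub f1 f2 (y - f3), (d y < d f3)%Re & A f1 f2 y].
Proof.
move=> G hA N ea eb hk hD [y0 [S0 dy0 hA0]]; have [c0 cb ba] := G; have J := A_jac base hA.
have b0 : (0 < d f2)%Re by lra.
have w0 : wdg f2 f3 != 0 by exact: jac_wdg J.
have [x [Ax M S dx Jx]] := minimal_in_A N S0 dy0 hA0.
have S' : sub f2 f3 (f1 - x) by rewrite -opprB; exact: subN.
have dphi : d (f1 - x) = d f1 by rewrite -opprB dN d_diff.
have D12 := D_ge0 X f1 f2.
have [t1 t2 t3] := two_max_all J.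
have D13 : D f1 f3 = (d f1 - d f2 + D f2 f3)%Re by move: t1 t2; rmax; lra.
(* Cancellation between [f2] and [f3] would need a common multiple of at least [3 d f2 = 4 d f3],
   and then [SU] contradicts [hD]. *)
have [k0 [q [eq _]]] : exists c q, f1 - x = cst c * f2 + evu f3 q /\ (c != 0 -> (d f2 <= d (f1 - x)%R)%Re).
  case: (sub_cases charC b0 c0 w0 S') => [h|[m m1 e]|[m m1 e]|[p [r [p2 r2 _ e SUx]]]].
  - by apply: (NC_split b0 c0 h); lra.
  - by exfalso; case: (mult_cases c0 e) => [[|]|||] h; lra.
  - by exfalso; case: (mult_cases b0 e) => [[|]|||] h; lra.
  - exfalso; have h3 : (3 * d f2 <= INR r * d f2)%Re.
      apply: Rnot_lt_le => h; case: (mult2_cases b0 r2 erefl) => h'; try lra.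
      by case: (mult2_cases (a := INR p * d f3) c0 p2 erefl); lra.
    by have := SUx.1; rewrite dphi; lra.
have [|sq _ D2 D3] := @D_aff_evu k0 f2 f3 q c0 w0; first by rewrite -eq dphi; lra.
rewrite -eq dphi in D2 D3.
have Dx2 : D x f2 = (d f1 - d f3 + D f2 f3)%Re by rewrite -D2; apply: D_sub1; rewrite D2; lra.
have Dx3 : D x f3 = D f1 f3 by apply: D_sub2; lra.
have hx := D_le X x f2.
have nm m := minimal_mult_r (m := m) c0 M; have nm' m := minimal_mult_l (m := m) b0 M.
have n1 := nm' 1%N isT; have n2 := nm 1%N isT; rewrite /= in n1 n2.
have h23 : (2 * d f3 < 3 * D f2 f3)%Re by lra.
(* Three positions of [d x] relative to [d f2] and [d f3]; the last two are contradictory. *)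
case: (Rlt_le_dec (d f2) (d x)) => o1.
  by apply: (SC_large G w0 ea eb _ h23 Ax M eq Jx); lra.
exfalso; case: (Rlt_le_dec (d f3) (d x)) => o2.
  have Gx : good f2 x f3 by split=> //; lra.
  by apply: (SC_mid Gx eb h23 _ M); [apply: A_eqv Ax _; exact: eqv_213 | lra].
have Gx : good f2 f3 x by split=> //; lra.
apply: (SC_small N Gx ba _ eb _ h23); rewrite ?(D_sym X f2) ?(D_sym X f3 x) ?Dx2 -?(D_sym X f2) ; try lra.
  by apply: A_eqv Ax _; exact: eqv_231.
Qed.

(** The numerical data of a reduction of [f3] over the plane of [f1] and [f2] already imply that one
    exists. A certificate over another plane contradicts the degrees or the size of [D f2 f3],
    except for the proportions (9, 6, 4) and (12, 8, 6), which are settled by the lemmas above. *)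
Lemma critical f1 f2 f3 : good f1 f2 f3 -> A f1 f2 f3 -> Nlt (sumd f1 f2 f3) ->
  (2 * d f1 = 3 * d f2)%Re -> (d f1 - d f2 + D f1 f2 <= d f3)%Re -> (d f1 - d f2 < D f2 f3)%Re ->
  exists y, [/\ sub f1 f2 (y - f3), (d y < d f3)%Re & A f1 f2 y].
Proof.
move=> G hA N e32 hk hD; have [c0 cb ba] := G; have J := A_jac base hA.
have b0 : (0 < d f2)%Re by lra.
have D12 : (2 <= D f1 f2)%Re by apply: D_ge2_jac (jac_rot (jac_rot J)).
have [t1 t2 t3] := two_max_all J.
have D13 : D f1 f3 = (d f1 - d f2 + D f2 f3)%Re by move: t1 t2; rmax; lra.
have SC : (d f1 = 2 * d f3)%Re -> E1 f1 f2 f3 -> exists y, [/\ sub f1 f2 (y - f3), (d y < d f3)%Re & A f1 f2 y].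
  by move=> e; apply: (critical_SC G hA N) => //; lra.
case: (cert_form charC base G hA) => [B|K|/EcertE [E|E|[k [l [y [Sy dy Ay]]]]]].
- by have [_ nb] := Ebase_num B; have [nn _ _] := nb 2%N 3%N isT; case: nn; inr.
- by have [[k1 k2 k3 k4] k5] := Kcert_num G J K; lra.
- have [y [Sy dy _]] := E.
  case: (E1num charC J G Sy dy) => [[i [j e]]|[m m2 e]|[p [q [p2 q2 _ e SUx]]]].
  + apply: SC E; have e' : (d f1 - INR j * d f3 = INR i * d f2)%Re by lra.
    by case: (mult_cases b0 e') => [[]|||]; case: (mult_cases (a := INR j * d f3) c0 erefl) => [[]|||]; lra.
  + by exfalso; case: (mult2_cases c0 m2 e); lra.
  + have h := SUx.1; rewrite d_diff // in h.
    have [e2|e2] : (INR q * d f2 = 2 * d f2 \/ 3 * d f2 <= INR q * d f2)%Re.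
        by case: (mult2_cases b0 q2 erefl); lra.
      exfalso; apply: (critical_964 G hA N _ _ hk hD E);
        case: (mult2_cases (a := INR p * d f3) c0 p2 erefl); lra.
    by exfalso; lra.
- have [k [y [Sy dy _]]] := E.
  case: (E2num charC J G Sy dy) => [[_ [m m2 e]]|[m m2 e]|[_ [h _]]].
  + by exfalso; case: (mult2_cases c0 m2 e); lra.
  + apply: SC (R13_E2_E1 G N m2 e E).
    by case: (mult2_cases c0 m2 e); lra.
  + by exfalso; have e := @D_add_gt f1 f2 f3 k ltac:(lra); rewrite e in h; lra.
- case: (E3num charC J G Sy dy) => [[m m2 e]|[e [h _]]].
    by exfalso; case: (mult2_cases b0 m2 e); lra.
  (* A nontrivial shift along [f3] would make the wedge of the plane at least as large as [D f2 f3],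
     beyond the bound [h]; so the plane is the unshifted one. *)
  have [kl|[kl0 ll0]] : (k != 0 \/ l != 0) \/ (k = 0 /\ l = 0).
    have [->|] := eqVneq k 0; last by left; left.
    by have [->|] := eqVneq l 0; [right | left; right].
  + exfalso; have hs := @D_shift3 f1 f2 f3 k l ltac:(lra) ltac:(lra) kl; lra.
  + by exists y; move: Sy Ay; rewrite kl0 ll0 rmorph0 !mul0r !addr0.
Qed.

(** Iterates [critical] until the third degree is below the lower bound of [SU]. The Jacobian clause
    of [SU] for [psi], together with [mon_ge3], ensures [d f1 - d f2 < D f2 f3] at every stage. *)
Lemma critical_strong f1 f2 psi : (2 * d f1 = 3 * d f2)%Re -> (d psi < d f2)%Re -> SU f1 f2 psi (2 * d f1)%Re ->
  forall f3, good f1 f2 f3 -> A f1 f2 f3 -> Nlt (sumd f1 f2 f3) ->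
  exists y, [/\ sub f1 f2 (y - f3), (d y < d f1 - d f2 + D f1 f2)%Re, (d y <= d f3)%Re & A f1 f2 y].
Proof.
move=> e32 dpsi S; apply: (@d_ind _ _ X) => f3 IH G hA N.
have [c0 cb ba] := G; have J := A_jac base hA.
case: (Rlt_le_dec (d f3) (d f1 - d f2 + D f1 f2)) => hc.
  by exists f3; split=> //; [rewrite subrr; exact: sub0 | lra].
have hD : (d f1 - d f2 < D f2 f3)%Re.
  have [|_ _ h3] := S.2; first lra.
  by have [h _] := h3 _ J; have hm := mon_ge3 X; lra.
have [y [Sy dy Ay]] := critical G hA N e32 hc hD.
have Gy : good f1 f2 y by split=> //; [exact: jac_pos (jac_rot (jac_rot (A_jac base Ay))) | lra].
have [|z [Sz dz dz' Az]] := IH y dy Gy Ay; first by apply: Nlt_le N; rewrite /degsum; lra.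
exists z; split=> //; last lra.
have -> : z - f3 = (z - y) + (y - f3) by ring.
exact: subD.
Qed.

(** * Weak moves *)

Lemma A_aff u1 u2 u3 y : A u1 u2 u3 -> aff2 u1 u2 (y - u3) -> A u1 u2 y.
Proof.
move=> hA [k [l [e eq]]]; have {}eq : y = cst k * u1 + cst l * u2 + cst e + u3 by rewrite -eq subrK.
apply: A_eqv hA _; split; split; try exact: aff3_1; try exact: aff3_2.
  by exists k, l, 1, e; rewrite rmorph1 eq; ring.
by exists (- k), (- l), 1, (- e); rewrite rmorph1 !rmorphN eq /=; ring.
Qed.

Lemma evu_lin g (q : {poly C}) : (size q <= 2)%N -> evu g q = cst q`_1 * g + cst q`_0.
Proof.
move=> s; have {1}-> : q = q`_1 *: 'X + (q`_0)%:P.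
  apply/polyP => i; rewrite coefD coefZ coefX coefC.
  by case: i => [|[|i]]; rewrite /= ?mulr0 ?mulr1 ?add0r ?addr0 // nth_default // (leq_trans s).
by rewrite -mul_polyC rmorphD rmorphM evuX !evuC.
Qed.

Lemma size_le g (q : {poly C}) n : (0 < d g)%Re -> (d (evu g q) < INR n * d g)%Re -> (size q <= n)%N.
Proof.
move=> g0; rewrite d_evu // => h; have h' := Rmult_lt_reg_r _ _ _ g0 h.
have /ssrnat.ltP := INR_lt _ _ h'; by case: (size q).
Qed.

Lemma A_evu_lin u1 u2 u3 y c q : A u1 u2 u3 -> y - u3 = cst c * u1 + evu u2 q -> (size q <= 2)%N -> A u1 u2 y.
Proof.
move=> hA eq s; apply: (A_aff hA); rewrite eq evu_lin //.
by exists c, q`_1, q`_0; ring.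
Qed.

Lemma eqv_shift1 f1 f2 f3 k : eqv f1 f2 f3 (f1 + cst k * f2) f2 f3.
Proof.
split; split; try exact: aff3_2; try exact: aff3_3.
  by exists 1, k, 0, 0; rewrite rmorph1 rmorph0; ring.
by exists 1, (- k), 0, 0; rewrite rmorph1 rmorph0 rmorphN /=; ring.
Qed.

Lemma eqv_shift3 f1 f2 f3 k l : eqv f1 f2 f3 (f1 + cst k * f3) (f2 + cst l * f3) f3.
Proof.
split; split; try exact: aff3_3.
- by exists 1, 0, k, 0; rewrite rmorph1 rmorph0; ring.
- by exists 0, 1, l, 0; rewrite rmorph1 rmorph0; ring.
- by exists 1, 0, (- k), 0; rewrite rmorph1 rmorph0 rmorphN /=; ring.
- by exists 0, 1, (- l), 0; rewrite rmorph1 rmorph0 rmorphN /=; ring.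
Qed.

Lemma good_shift1 f1 f2 f3 k : good f1 f2 f3 -> good (f1 + cst k * f2) f2 f3.
Proof. by case=> c0 cb ba; split; rewrite ?d_add_lt. Qed.

Lemma good_shift3 f1 f2 f3 k l : good f1 f2 f3 -> good (f1 + cst k * f3) (f2 + cst l * f3) f3.
Proof. by case=> c0 cb ba; split; rewrite ?d_add_lt //; lra. Qed.

Lemma sub_shift_l f g f' q p : f' - f = evu g q -> sub f g p -> sub f' g p.
Proof.
move=> e; apply: sub_trans; last exact: sub_r.
have -> : f = f' - evu g q by rewrite -e opprB addrC subrK.
apply: subB; [exact: sub_l | apply: sub_evu; exact: sub_r].
Qed.

Lemma lead_pow_evu f g m : (0 < d g)%Re -> (2 <= m)%N -> d f = (INR m * d g)%Re ->
  exists f' q, f' - f = evu g q /\ (d f' < d f)%Re.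
Proof.
move=> g0 m2 e; have [k hk] := @lead_pow _ _ X g f m g0 (ltnW m2) e.
exists (f - cst k * g ^+ m), (- (k *: 'X^m)); split=> //.
by rewrite -pow_evu; ring.
Qed.

Lemma d_move x z : (d x <= d z -> d (x - z)%R <= d z)%Re.
Proof. by move=> h; have h1 := dB X x z; move: h1; rmax; lra. Qed.

Lemma base_moves f1 f2 f3 : good f1 f2 f3 -> A f1 f2 f3 -> Ebase f1 f2 f3 ->
  [/\ forall y, sub f1 f2 (y - f3) -> (d y <= d f3)%Re -> A f1 f2 y,
      forall y, sub f1 f3 (y - f2) -> (d y <= d f2)%Re -> A f1 y f3 &
      forall y, sub f2 f3 (y - f1) -> (d y <= d f1)%Re -> A y f2 f3].
Proof.
move=> G hA B; have [c0 cb ba] := G; have J := A_jac base hA.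
have [lt nb] := Ebase_num B.
have b0 : (0 < d f2)%Re by lra. have a0 : (0 < d f1)%Re by lra.
have no g h x : (0 < d g)%Re -> (0 < d h)%Re -> wdg g h != 0 ->
   (forall m n, (0 < m)%N -> (INR m * d g <> INR n * d h)%Re) ->
   (forall m n, (0 < m)%N -> (INR m * d h <> INR n * d g)%Re) -> sub g h x -> NC g h x.
  move=> g0 h0 w n1 n2 S; case: (sub_cases charC g0 h0 w S) => [//|[m m1 e]|[m m1 e]|[p [r [p2 r2 _ e _]]]]; exfalso.
  - by apply: (n1 1%N m) => //; rewrite e; inr.
  - by apply: (n2 1%N m) => //; rewrite e; inr.
  - by apply: (n1 r p); rewrite // ltnW.
have nb' m n : (0 < m)%N -> [/\ (INR m * d f2 <> INR n * d f1)%Re, (INR m * d f3 <> INR n * d f1)%Re & (INR m * d f3 <> INR n * d f2)%Re].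
  move=> m0; have m0' : (0 < INR m)%Re by apply: lt_0_INR; apply/ssrnat.ltP.
  case: n => [|n]; first by rewrite [INR 0]/=; split; nra.
  by have [n1 n2 n3] := nb n.+1 m isT; split=> e; [apply: n1|apply: n2|apply: n3].
split=> y S dy; have dphi := d_move dy.
- have h := no f1 f2 _ a0 b0 (jac_wdg (jac_rot (jac_rot J))) (fun m n m0 => let: And3 h _ _ := nb m n m0 in h) (fun m n m0 => let: And3 h _ _ := nb' m n m0 in h) S.
  have [||c ec] := NC_const a0 b0 h; [lra | lra |].
  by apply: (A_aff hA); rewrite ec; exact: aff2_c.
- have h := no f1 f3 _ a0 c0 (jac_wdg (jac_rot (jac_rot (jac132 J)))) (fun m n m0 => let: And3 _ h _ := nb m n m0 in h) (fun m n m0 => let: And3 _ h _ := nb' m n m0 in h) S.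
  have [|q eq] := NC_uni a0 c0 h; first lra.
  apply: A_eqv (eqv_132 _ _ _ _); apply: (@A_evu_lin _ _ f2 _ 0 q (A_eqv hA (eqv_132 X f1 f2 f3))).
    by rewrite eq rmorph0 mul0r add0r.
  by apply: (size_le c0); rewrite -eq; inr.
- have h := no f2 f3 _ b0 c0 (jac_wdg J) (fun m n m0 => let: And3 _ _ h := nb m n m0 in h) (fun m n m0 => let: And3 _ _ h := nb' m n m0 in h) S.
  have [||k [q [eq _]]] := NC_split b0 c0 h; [lra | lra |].
  apply: A_eqv (eqv_312 _ _ _ _); apply: (@A_evu_lin _ _ f1 _ k q (A_eqv hA (eqv_231 X f1 f2 f3))) => //.
  apply: (size_le c0); have e : evu f3 q = y - f1 - cst k * f2 by rewrite eq; ring.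
  have h1 := dB X (y - f1) (cst k * f2); have h2 := dZ_le X k f2.
  by rewrite e; move: h1; rewrite [INR 2]/=; rmax; lra.
Qed.

Lemma K_moves f1 f2 f3 : good f1 f2 f3 -> A f1 f2 f3 -> Kcert f1 f2 f3 -> Nlt (sumd f1 f2 f3) ->
  [/\ forall y, sub f1 f2 (y - f3) -> (d y <= d f3)%Re -> A f1 f2 y,
      forall y, sub f1 f3 (y - f2) -> (d y <= d f2)%Re -> A f1 y f3 &
      forall y, sub f2 f3 (y - f1) -> (d y <= d f1)%Re -> A y f2 f3].
Proof.
move=> G hA K N; have [c0 cb ba] := G; have J := A_jac base hA.
have [[k1 k2 k3 k4] k5] := Kcert_num G J K.
have D23 := D_ge2_jac J.
have a32 : (2 * d f1 <= 3 * d f2)%Re by lra.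
have b0 : (0 < d f2)%Re by lra. have a0 : (0 < d f1)%Re by lra.
split=> y S dy; have dphi := d_move dy.
- have w : wdg f1 f2 != 0 by exact: jac_wdg (jac_rot (jac_rot J)).
  case: (sub_cases charC a0 b0 w S) => [h|[m m1 e]|[m m1 e]|[p [r [p2 r2 _ e SUx]]]].
  + have [||c ec] := NC_const a0 b0 h; [lra | lra |].
    by apply: (A_aff hA); rewrite ec; exact: aff2_c.
  + by exfalso; case: (mult_cases b0 e) => [[|]|||]; lra.
  + by exfalso; case: (mult_cases a0 e) => [[|]|||]; lra.
  + exfalso; have h2 : (2 * d f1 <= INR r * d f1)%Re by apply: INR2_mul_le => //; lra.
    by have := SUx.1; lra.
- have w : wdg f1 f3 != 0 by exact: jac_wdg (jac_rot (jac_rot (jac132 J))).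
  case: (sub_cases charC a0 c0 w S) => [h|[m m1 e]|[m m1 e]|[p [r [p2 r2 _ e SUx]]]].
  + have [|q eq] := NC_uni a0 c0 h; first lra.
    apply: A_eqv (eqv_132 _ _ _ _); apply: (@A_evu_lin _ _ f2 _ 0 q (A_eqv hA (eqv_132 X f1 f2 f3))).
      by rewrite eq rmorph0 mul0r add0r.
    by apply: (size_le c0); rewrite -eq; inr.
  + by exfalso; case: (mult_cases c0 e) => [[|]|||]; lra.
  + by exfalso; case: (mult_cases a0 e) => [[|]|||]; lra.
  + exfalso; have h2 : (2 * d f1 <= INR r * d f1)%Re by apply: INR2_mul_le => //; lra.
    by have := SUx.1; lra.
- have w : wdg f2 f3 != 0 by exact: jac_wdg J.
  have [k [q [eq _]]] : exists c q, y - f1 = cst c * f2 + evu f3 q /\ (c != 0 -> (d f2 <= d (y - f1)%R)%Re).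
    case: (sub_cases charC b0 c0 w S) => [h|[m m1 e]|[m m1 e]|[p [r [p2 r2 _ e SUx]]]].
    + by apply: (NC_split b0 c0 h); lra.
    + by exfalso; case: (mult_cases c0 e) => [[|]|||]; lra.
    + by exfalso; case: (mult_cases b0 e) => [[|]|||]; lra.
    + exfalso; have h2 : (2 * d f2 <= INR r * d f2)%Re by apply: INR2_mul_le => //; lra.
      by have := SUx.1; lra.
  have e : evu f3 q = y - f1 - cst k * f2 by rewrite eq; ring.
  have dq : (d (evu f3 q) <= d f1)%Re.
    have h1 := dB X (y - f1) (cst k * f2); have h2 := dZ_le X k f2.
    by rewrite e; move: h1; rmax; lra.
  have s3 : (size q <= 3)%N by apply: (size_le c0); rewrite [INR 3]/=; lra.
  have [s2|s2] := leqP (size q) 2.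
    by apply: A_eqv (eqv_312 _ _ _ _); apply: (@A_evu_lin _ _ f1 _ k q (A_eqv hA (eqv_231 X f1 f2 f3))).
  have sq : size q = 3 by apply/eqP; rewrite eqn_leq s3.
  have d2 : (2 * d f3 <= d f1)%Re by move: dq; rewrite d_evu // sq /=; lra.
  have [b [r [y0 [Ay0 [s Sy e0 [q1 q2 q3 q4 q5]]]]]] := K.
  set P1 := f1 + evu f3 r in Ay0 Sy e0 q1 q3 q4 q5; set G2 := f2 + cst b * f3 in Ay0 Sy e0 q1 q2 q3 q5.
  have dG : d G2 = d f2 by exact: d_add_lt.
  have eP : P1 = f1 + evu f3 q + evu f3 (r - q) by rewrite rmorphB /P1; ring.
  have dx : (d (f1 + evu f3 q)%R <= d f1)%Re by have h1 := dD X f1 (evu f3 q); move: h1; rmax; lra.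
  (* Adding [q(f3)] to [f1] replaces the polynomial [r] of the exceptional reduction by [r - q]. If
     this is still quadratic, the new triple is again exceptional; if it is linear, the triple is
     reached through [y0] by the induction hypothesis. *)
  have AH : A (f1 + evu f3 q) G2 f3.
    have s3' : (size (r - q)%R <= 3)%N by apply: leq_trans (size_polyD _ _) _; rewrite size_polyN s sq.
    have [s2'|s2'] := leqP (size (r - q)%R) 2.
      have AP : A P1 G2 f3.
        apply: (step3 N Ay0); first by rewrite /degsum; lra.
        by rewrite -opprB; exact: subN.
      apply: A_eqv (eqv_312 _ _ _ _); apply: (@A_evu_lin _ _ P1 _ 0 (q - r) (A_eqv AP (eqv_231 X _ _ _))).
        by rewrite eP !rmorphB rmorph0 /=; ring.
      by rewrite -opprB size_polyN.
    have s' : size (r - q) = 3 by apply/eqP; rewrite eqn_leq s3'.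
    apply: (@A_K C P X x1 x2 x3 (f1 + evu f3 q) G2 f3 (r - q) y0); first by rewrite -eP.
    by split; rewrite -?eP //; split=> //; [lra | right; lra].
  apply: A_eqv AH _; rewrite /G2; split; split; try exact: aff3_3.
  + exists 1, k, (- (k * b)), 0; rewrite rmorph1 rmorph0 rmorphN rmorphM /=.
    by have -> : y = cst k * f2 + evu f3 q + f1; [rewrite -eq; ring | ring].
  + by exists 0, 1, (- b), 0; rewrite rmorph1 rmorph0 rmorphN /=; ring.
  + exists 1, (- k), 0, 0; rewrite rmorph1 rmorph0 rmorphN /=.
    by have -> : y = cst k * f2 + evu f3 q + f1; [rewrite -eq; ring | ring].
  + by exists 0, 1, b, 0; rewrite rmorph1 rmorph0 /=; ring.
Qed.

(** If a power of [f2] or [f3] matches the leading form of [f1], then lowering [f1] can always be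
    taken as the certificate. The hard case is a reduction of [f3] over a plane with
    [2 d g1 = 3 d g2] while [d f1 = 2 d f3]: there no square closes, and the triple with lowered
    [f1] is obtained from the rule [A_K]. *)
Lemma to_E1 f1 f2 f3 m : good f1 f2 f3 -> A f1 f2 f3 -> Nlt (sumd f1 f2 f3) -> (2 <= m)%N ->
  (d f1 = INR m * d f2 \/ d f1 = INR m * d f3)%Re -> Ecert f1 f2 f3 -> E1 f1 f2 f3.
Proof.
move=> G hA N m2 e E; have J := A_jac base hA; have [c0 cb ba] := G.
have b0 : (0 < d f2)%Re by lra.
case: e => e.
  by case/EcertE: E => [//|E|E]; apply: (R12toE1 G J N m2 e); [left | right].
case/EcertE: E => [//|E|E]; first exact: (R13_E2_E1 G N m2 e E).
have [k [l [y [Sy dy Ay]]]] := E.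
case: (E3num charC J G Sy dy) => [[n n2 e']|[e32 [h S]]].
  by apply: (R12toE1 G J N n2 e'); right.
set g1 := f1 + cst k * f3 in Sy Ay h S; set g2 := f2 + cst l * f3 in Sy Ay h S.
have G' : good g1 g2 f3 by exact: good_shift3.
have d1 : d g1 = d f1 by apply: d_add_lt; lra.
have d2 : d g2 = d f2 by apply: d_add_lt; lra.
have E' := eqv_shift3 f1 f2 f3 k l.
have A' : A g1 g2 f3 by apply: A_eqv hA E'.
have N' : Nlt (sumd g1 g2 f3) by rewrite /degsum d1 d2.
have dpsi : d (y - f3) = d f3 by exact: d_diff.
have eg : (2 * d g1 = 3 * d g2)%Re by rewrite d1 d2.
have hs : (d (y - f3)%R < d g2)%Re by rewrite dpsi d2; lra.
rewrite -d1 in S.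
have [y0 [Sy0 dy0 _ Ay0]] := critical_strong eg hs S G' A' N'.
have D0 := D_ge2_jac (jac_rot (jac_rot (A_jac base A'))); rewrite -/(D g1 g2) in D0.
have e2 : (d f1 = 2 * d f3)%Re by case: (mult2_cases c0 m2 e); lra.
have [f' [q [eq df']]] : exists f' q, f' - g1 = evu f3 q /\ (d f' < d g1)%Re.
  by apply: (@lead_pow_evu g1 f3 2%N) => //; rewrite d1 e2.
have sq : size q = 3.
  have dq : d (evu f3 q) = (2 * d f3)%Re by rewrite -eq d_diff // d1.
  apply/eqP; rewrite eqn_leq (size_le (n := 3) c0) /=; last by rewrite dq; inr.
  rewrite ltnNge; apply/negP => s2; move: dq; rewrite d_evu //.
  by case: (size q) s2 => [|[|[|]]] //= _; lra.
have AK : A f' g2 f3.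
  have e1 : f' + evu f3 (- q) = g1 by rewrite rmorphN -eq; ring.
  apply: (@A_K C P X x1 x2 x3 f' g2 f3 (- q) y0); first by rewrite e1.
  by split; rewrite ?e1 ?size_polyN //; split; rewrite ?d1 ?d2 //; try lra; left; lra.
exists f'; split; last 2 first.
- by lra.
- by apply: A_eqv AK _; have := eqv_shift3 f' f2 f3 0 l; rewrite rmorph0 mul0r addr0; exact: eqv_sym.
have -> : f' - f1 = evu f3 q + cst k * f3 by rewrite -eq /g1; ring.
by apply: subD; [apply: sub_evu; exact: sub_r | apply: subZ; exact: sub_r].
Qed.

(** The move is affine, or [d f1] is a multiple of [d f2] and [square1] applies, or the plane is
    critical and [f3] and [y] can both be joined to the same element [y0] of smaller degree. *)
Lemma weak3 f1 f2 f3 y : good f1 f2 f3 -> A f1 f2 f3 -> Nlt (sumd f1 f2 f3) -> Ecert f1 f2 f3 ->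
  sub f1 f2 (y - f3) -> (d y <= d f3)%Re -> A f1 f2 y.
Proof.
move=> G hA N E S dy; have J := A_jac base hA; have [c0 cb ba] := G.
have b0 : (0 < d f2)%Re by lra. have a0 : (0 < d f1)%Re by lra.
have dphi := d_move dy.
have w : wdg f1 f2 != 0 by exact: jac_wdg (jac_rot (jac_rot J)).
have D12 := D_ge2_jac (jac_rot (jac_rot J)).
have sq m : (2 <= m)%N -> d f1 = (INR m * d f2)%Re -> A f1 f2 y.
  move=> m2 e; have [y1 [S1 dy1 A1]] := to_E1 G hA N m2 (or_introl e) E.
  have [f' [q [eq df']]] := lead_pow_evu b0 m2 e.
  apply: A_eqv (eqv_213 _ _ _ _); apply: (@square1 _ _ _ _ _ _ _ N f2 f1 f' f3 y q) => //.
  - apply: A_eqv (eqv_213 _ _ _ _); apply: (step1 N A1); first by rewrite /degsum; lra.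
    have -> : f' - y1 = evu f2 q - (y1 - f1) by rewrite -eq; ring.
    by apply: subB => //; apply: sub_evu; exact: sub_l.
  - by rewrite /degsum; lra.
  - exact: sub_sym.
  - by rewrite /degsum; lra.
case: (half_case charC b0 ba w S) => [|[q eq]|[m m2 e]|[p [op p3 e SUx]]]; first by lra.
- apply: (@A_evu_lin _ _ f3 y 0 q hA); first by rewrite eq rmorph0 mul0r add0r.
  by apply: (size_le b0); rewrite -eq; inr.
- exact: sq m2 e.
- have h := SUx.1; have p3' : (2 * d f1 = 3 * d f2)%Re by case: (odd_cases b0 op p3 e); lra.
  have hs : (d (y - f3)%R < d f2)%Re by lra.
  have [y0 [Sy0 dy0 _ Ay0]] := critical_strong p3' hs SUx G hA N.
  apply: (step3 N Ay0); first by rewrite /degsum; lra.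
  have -> : y - y0 = (y - f3) - (y0 - f3) by ring.
  exact: subB.
Qed.

Lemma parity_no (c0 : R) p m : (0 < c0)%Re -> odd p -> (INR p * c0 = 2 * (INR m * c0))%Re -> False.
Proof.
move=> h op e; have : INR p = INR (2 * m).
  by rewrite mult_INR [INR 2]/=; apply: (Rmult_eq_reg_r c0); lra.
by move/INR_eq => ep; move: op; rewrite ep mul2n odd_double.
Qed.

(** The odd numbers [p] and [p'] would differ by more than 0 and less than 2. *)
Lemma parity_close p p' (b0 c0 a0 : R) : (0 < c0)%Re -> odd p -> odd p' ->
  (2 * a0 = INR p * c0)%Re -> (2 * b0 = INR p' * c0)%Re -> (b0 < a0 < b0 + c0)%Re -> False.
Proof.
move=> h op op' e e' [h1 h2].
have l1 : (p' < p)%N.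
  by apply/ssrnat.ltP/INR_lt; apply: (Rmult_lt_reg_r c0); lra.
have l2 : (p < p' + 2)%N.
  by apply/ssrnat.ltP/INR_lt; apply: (Rmult_lt_reg_r c0) => //; rewrite plus_INR [INR 2]/=; lra.
have ep : p = p'.+1 by lia.
by move: op; rewrite ep /= op'.
Qed.

(* Reductions of [f2] along two different planes [<f1, f3>] and [<f1 + k f2, f3>] exclude each
   other. *)
Lemma cross13 f1 f2 f3 k p : good f1 f2 f3 -> A f1 f2 f3 -> Nlt (sumd f1 f2 f3) -> odd p -> (3 <= p)%N ->
  (2 * d f1 = INR p * d f3)%Re -> (d f1 - d f3 + D f1 f3 <= d f2)%Re -> k != 0 ->
  (d f1 - d f3 + D (f1 + cst k * f2)%R f3 <= d f2)%Re ->
  (exists y, [/\ sub f1 f3 (y - f2), (d y < d f2)%Re & A f1 y f3]) ->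
  exists y q, [/\ A f1 y f3, y - f2 = evu f3 q & (d y < d f2)%Re].
Proof.
move=> G hA N op p3 ep h13 k0 h13' [y0 [S0 dy0 hA0]]; have [c0 cb ba] := G; have J := A_jac base hA.
have D13 := D_ge2_jac (jac_rot (jac_rot (jac132 J))).
(* [k df2 /\ df3] is the difference of the wedges of the two planes, so it obeys the same bound. *)
have D23 : (d f1 - d f3 + D f2 f3 <= d f2)%Re.
  have h : D (cst k * f2) f3 = D f2 f3 by rewrite /dwdg wdgZl dvZc.
  have e : wdg (cst k * f2) f3 = wdg (f1 + cst k * f2) f3 - wdg f1 f3 by rewrite wdgDl addrC addKr.
  have := dvD X (wdg (f1 + cst k * f2) f3) (- wdg f1 f3).
  rewrite dvN -e -/(D (cst k * f2) f3) -/(D f1 f3) -/(D (f1 + cst k * f2) f3) h; rmax; lra.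
have [x [Ax M S dx Jx]] : exists x, [/\ A x f1 f3, minimal f1 f3 x, sub f1 f3 (x - f2), (d x < d f2)%Re & jac x f1 f3].
  apply: (minimal_in_A _ S0 dy0); first by apply: Nlt_le N; rewrite /degsum; lra.
  by apply: A_eqv hA0 _; exact: eqv_213.
have {}Ax : A f1 x f3 by apply: A_eqv Ax _; exact: eqv_213.
have {}Jx := jac_swap Jx.
have S' : sub (f1 + cst 0 * f2) f3 (x - f2) by rewrite rmorph0 mul0r addr0.
case: (E2num charC J G S' dx) => [[[q eq] _]|[m m2 e]|[_ [_ SUx]]].
- by exists x, q.
- by exfalso; apply: (parity_no (m := m) c0 op); lra.
exfalso; rewrite rmorph0 mul0r addr0 in SUx.
have dpsi : d (x - f2) = d f2 by exact: d_diff.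
have [|hD _ _] := SUx.2; first by rewrite dpsi; lra.
have Dx3 : D (x - f2) f3 = D x f3.
  have {2}-> : x = f2 + (x - f2) by rewrite addrC subrK.
  by rewrite [RHS]/dwdg wdgDl dvD_lt // -/(D f2 f3) -/(D (x - f2) f3); lra.
rewrite Dx3 in hD.
have hx := D_le X x f3.
have a0 : (0 < d f1)%Re by lra.
have nm m := minimal_mult_r (m := m) c0 M; have nm' m := minimal_mult_l (m := m) a0 M.
have n1 := nm 1%N isT; rewrite /= in n1.
have p32 : (d f1 < 2 * d f3)%Re -> (2 * d f1 = 3 * d f3)%Re.
  by case: (odd_cases c0 op p3 ep); lra.
(* If [x] has fallen below [f3], the triple [(f1, f3, x)] is critical and [x] could be lowered
   again; otherwise every certificate of [(f1, x, f3)] fails. *)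
case: (Rlt_le_dec (d x) (d f3)) => o1.
  have e32 : (2 * d f1 = 3 * d f3)%Re by apply: p32; lra.
  have G' : good f1 f3 x by split=> //; [exact: jac_pos (jac_rot Jx) | lra].
  have A' : A f1 f3 x by apply: A_eqv Ax _; exact: eqv_132.
  have N' : Nlt (sumd f1 f3 x) by apply: Nlt_le N; rewrite /degsum; lra.
  have [||z [Sz dz _]] := critical G' A' N' e32; [lra | rewrite D_sym; lra |].
  exact: (minimal_no M Sz dz).
have G' : good f1 x f3 by split=> //; lra.
have [t1 t2 t3] := two_max_all Jx.
case: (cert_form charC base G' Ax) => [B|K|/EcertE [[y [Sy dy _]]|[l [y [Sy dy _]]]|[l [r [y [Sy dy _]]]]]].
- have [_ nb] := Ebase_num B; have [_ n _] := nb 2%N p isT; apply: n; rewrite [INR 2]/=; lra.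
- by have [[k1 k2 k3 k4] k5] := Kcert_num G' Jx K; lra.
- case: (E1num charC Jx G' Sy dy) => [[i [j e]]|[m m2 e]|[u [r [u2 r2 _ e SUy]]]].
  + have e' : (d f1 - INR j * d f3 = INR i * d x)%Re by lra.
    have j0 : (0 <= INR j * d f3)%Re by apply: Rmult_le_pos; [exact: pos_INR | lra].
    case: (mult_cases (b := d x) ltac:(lra) e') => [[|]|||] h.
    * by apply: (parity_no (m := j) c0 op); lra.
    * by case: (mult_cases (a := INR j * d f3) c0 erefl) => [[]|||]; lra.
    * by have := p32; lra.
    * by have := p32; lra.
    * by have := p32; lra.
  + by apply: (nm m) => //; exact: ltnW.
  + have h2 : (2 * d x <= INR r * d x)%Re by apply: INR2_mul_le => //; lra.
    by have := SUy.1; rewrite d_diff //; lra.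
- case: (E2num charC Jx G' Sy dy) => [[_ [m m2 e]]|[m m2 e]|[_ [h _]]].
  + by apply: (nm m) => //; exact: ltnW.
  + by apply: (parity_no (m := m) c0 op); lra.
  + have [l0|l0] := eqVneq l 0.
      by apply: (minimal_no M _ dy); move: Sy; rewrite l0 rmorph0 mul0r addr0.
    have hh : D (f1 + cst l * x) f3 = D x f3.
      rewrite /dwdg wdgDl wdgZl dvD_lt dvZc //.
      by rewrite -/(D f1 f3) -/(D x f3); lra.
    by rewrite hh in h; lra.
- case: (E3num charC Jx G' Sy dy) => [[m m2 e]|[e [h _]]].
    by case: (mult2_cases (b := d x) ltac:(lra) m2 e); have := p32; lra.
  have Jg := jac_shift3 Jx l r; have [u1 u2 u3] := two_max_all Jg.
  have da : d (f1 + cst l * f3) = d f1 by apply: d_add_lt; lra.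
  have db : d (x + cst r * f3) = d x by apply: d_add_lt; lra.
  have w1 z s : D (z + cst s * f3) f3 = D z f3 by rewrite /dwdg wdgDl wdgZl wdgxx scaler0 addr0.
  rewrite da db !w1 in u1.
  by move: u1; rmax; lra.
Qed.

Lemma weak2 f1 f2 f3 y : good f1 f2 f3 -> A f1 f2 f3 -> Nlt (sumd f1 f2 f3) -> Ecert f1 f2 f3 ->
  sub f1 f3 (y - f2) -> (d y <= d f2)%Re -> A f1 y f3.
Proof.
move=> G hA N E S dy; have J := A_jac base hA; have [c0 cb ba] := G.
have b0 : (0 < d f2)%Re by lra. have a0 : (0 < d f1)%Re by lra.
have dphi := d_move dy; have ca : (d f3 < d f1)%Re by lra.
have w : wdg f1 f3 != 0 by exact: jac_wdg (jac_rot (jac_rot (jac132 J))).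
have D13 := D_ge2_jac (jac_rot (jac_rot (jac132 J))).
have D23 := D_ge2_jac J.
have sumy : (d y + d f3 <= d f2 + d f3)%Re by lra.
case: (half_case charC c0 ca w S) => [|[q eq]|[m m2 e]|[p [op p3 e SUx]]]; first by lra.
- have inE1 : E1 f1 f2 f3 -> A f1 y f3.
    move=> [y1 [S1 dy1 A1]]; apply: A_eqv (eqv_321 _ _ _ _).
    apply: (@square2 _ _ _ _ _ _ _ N f3 f2 y f1 y1 q) => //.
    + by apply: A_eqv A1 _; exact: eqv_321.
    + by rewrite /degsum; lra.
    + exact: sub_sym.
    + by rewrite /degsum; lra.
  case/EcertE: (E) => [|[k [y1 [S1 dy1 A1]]]|[k [l [y1 [S1 dy1 A1]]]]]; first exact: inE1.
  + have eP : cst k * evu f3 q = evu f3 (k%:P * q) by rewrite rmorphM evuC.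
    set g1 := f1 + cst k * f2 in S1 A1; have dg : d g1 = d f1 by exact: d_add_lt.
    have dP : (d (cst k * evu f3 q)%R <= d f2)%Re.
      by apply: Rle_trans (dZ_le _ _ _) _; rewrite -eq.
    have dg' : (d (g1 + cst k * evu f3 q)%R = d f1)%Re by rewrite addrC dD_lt ?dg //; lra.
    have B1 : A (g1 + cst k * evu f3 q) y1 f3.
      apply: (step1 N A1); first by rewrite /degsum; lra.
      by rewrite addrC addKr eP; apply: sub_evu; exact: sub_r.
    have B2 : A (g1 + cst k * evu f3 q) y f3.
      apply: (step2 N B1); first by rewrite /degsum; lra.
      apply: (@sub_shift_l g1 f3 _ (k%:P * q)); first by rewrite -eP addrC addKr.
      have -> : y - y1 = evu f3 q - (y1 - f2) by rewrite -eq; ring.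
      by apply: subB => //; apply: sub_evu; exact: sub_r.
    have e1 : g1 + cst k * evu f3 q = f1 + cst k * y by rewrite -eq /g1; ring.
    by rewrite e1 in B2; apply: A_eqv B2 (eqv_sym (eqv_shift1 f1 y f3 k)).
  + case: (E3num charC J G S1 dy1) => [[m m2 e]|[e [h _]]].
      by apply: inE1; exact: (to_E1 G hA N m2 (or_introl e) E).
    have Dg := D_ge2_jac (jac_rot (jac_rot (jac_shift3 J k l))).
    apply: A_eqv (eqv_132 _ _ _ _); apply: (@A_evu_lin f1 f3 f2 y 0 q (A_eqv hA (eqv_132 X f1 f2 f3))).
      by rewrite eq rmorph0 mul0r add0r.
    by apply: (size_le c0); rewrite -eq; inr.
- have [y1 [S1 dy1 A1]] := to_E1 G hA N m2 (or_intror e) E.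
  have [f' [q [eq df']]] := lead_pow_evu c0 m2 e.
  apply: A_eqv (eqv_231 _ _ _ _); apply: (@square1 _ _ _ _ _ _ _ N f3 f1 f' f2 y q) => //.
  + apply: A_eqv (_ : A f' f2 f3) (eqv_312 _ _ _ _); apply: (step1 N A1); first by rewrite /degsum; lra.
    have -> : f' - y1 = evu f3 q - (y1 - f1) by rewrite -eq; ring.
    by apply: subB => //; apply: sub_evu; exact: sub_r.
  + by rewrite /degsum; lra.
  + exact: sub_sym.
  + by rewrite /degsum; lra.
have h := SUx.1.
(* It suffices to lower [f2] by a polynomial in [f3] alone: the lower triple is within reach of the
   induction hypothesis, and the given move factors through it. *)
have viaf2 z q : A f1 z f3 -> z - f2 = evu f3 q -> (d z < d f2)%Re -> A f1 y f3.
  move=> Az eq dz; apply: (step2 N Az); first by rewrite /degsum; lra.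
  have -> : y - z = (y - f2) - evu f3 q by rewrite -eq; ring.
  by apply: subB => //; apply: sub_evu; exact: sub_r.
have inE1 : E1 f1 f2 f3 -> A f1 y f3.
  move=> [y1 [S1 dy1 A1]].
  case: (E1num charC J G S1 dy1) => [[i [j e']]|[m m2 e']|[p' [q' [p2 q2 cop e' SUy]]]].
  - exfalso; have j0 : (0 <= INR j * d f3)%Re by apply: Rmult_le_pos; [exact: pos_INR | lra].
    have e'' : (d f1 - INR j * d f3 = INR i * d f2)%Re by lra.
    case: (mult_cases b0 e'') => [[|]|||] h'; try lra.
    + by apply: (parity_no (m := j) c0 op); lra.
    + by case: (mult_cases (a := INR j * d f3) c0 erefl) => [[]|||]; lra.
  - have [f' [q [eq df']]] := lead_pow_evu c0 m2 e'.
    apply: (viaf2 f' q) => //.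
    have B1 : A y1 f' f3.
      apply: (step2 N A1); first by rewrite /degsum; lra.
      by rewrite eq; apply: sub_evu; exact: sub_r.
    apply: (step1 N B1); first by rewrite /degsum; lra.
    by rewrite -opprB; apply: subN; exact: (sub_shift_l eq S1).
  - exfalso; have dth : d (y1 - f1) = d f1 by exact: d_diff.
    have h2 : (2 * d f2 <= INR q' * d f2)%Re by apply: INR2_mul_le => //; lra.
    have [|_ _ h3] := SUy.2; first by rewrite dth; lra.
    (* The Jacobian clause of [SU] bounds [D f1 f3] from below, the given move bounds it from above.
       This leaves [q' = 2], and then [2 d f1] and [2 d f2] are odd multiples of [d f3] that are too
       close together. *)
    have [h3' _] := h3 _ (jac_rot J); rewrite dth (D_sym X f3 f1) in h3'.
    have hm := mon_ge3 X.
    have {}q2 : q' = 2%N.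
      apply/eqP; rewrite eqn_leq q2 andbT; apply/negPn/negP; rewrite -ltnNge => q3.
      have h3q := INR_mul_ge (Rlt_le _ _ b0) q3; rewrite [INR 3]/= in h3q; lra.
    rewrite q2 [INR 2]/= in e'; rewrite q2 coprimen2 in cop.
    apply: (parity_close c0 op cop e (b0 := d f2)); lra.
case/EcertE: (E) => [|[k [y1 [S1 dy1 A1]]]|[k [l [y1 [S1 dy1 A1]]]]]; first exact: inE1.
- case: (E2num charC J G S1 dy1) => [[[q eq] _]|[m m2 e']|[_ [h' _]]].
  + apply: (viaf2 y1 q) => //; apply: (step1 N A1); first by rewrite /degsum d_add_lt //; lra.
    have -> : f1 - (f1 + cst k * f2) = - (cst k * (y1 - evu f3 q)) by rewrite -eq; ring.
    by apply: subN; apply: subZ; apply: subB; [exact: sub_l | apply: sub_evu; exact: sub_r].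
  + by exfalso; apply: (parity_no (m := m) c0 op); lra.
  + have [k0|k0] := eqVneq k 0.
      rewrite k0 rmorph0 mul0r addr0 in S1 A1.
      apply: (step2 N A1); first by rewrite /degsum; lra.
      have -> : y - y1 = (y - f2) - (y1 - f2) by ring.
      exact: subB.
    set g1 := f1 + cst k * f2 in S1 A1 h'.
    have dg : d g1 = d f1 by exact: d_add_lt.
    have e1 : f1 = g1 + cst (- k) * f2 by rewrite rmorphN /g1; ring.
    have [||||||||z [q [Az eq dz]]] := @cross13 g1 f2 f3 (- k) p (good_shift1 k G) (A_eqv hA (eqv_shift1 f1 f2 f3 k)); rewrite ?dg ?oppr_eq0 //.
    * by rewrite /degsum dg.
    * by rewrite -e1; lra.
    * by exists y1.
    apply: (viaf2 z q) => //; apply: (step1 N Az); first by rewrite /degsum dg; lra.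
    have -> : f1 - g1 = - (cst k * (z - evu f3 q)) by rewrite -eq /g1; ring.
    by apply: subN; apply: subZ; apply: subB; [exact: sub_l | apply: sub_evu; exact: sub_r].
- case: (E3num charC J G S1 dy1) => [[m m2 e']|[e' [h' _]]].
    by apply: inE1; exact: (to_E1 G hA N m2 (or_introl e') E).
  exfalso; have Jg := jac_shift3 J k l; have [u1 u2 u3] := two_max_all Jg.
  have da : d (f1 + cst k * f3) = d f1 by apply: d_add_lt; lra.
  have db : d (f2 + cst l * f3) = d f2 by apply: d_add_lt; lra.
  have w1 z s : D (z + cst s * f3) f3 = D z f3 by rewrite /dwdg wdgDl wdgZl wdgxx scaler0 addr0.
  rewrite da db !w1 in u1.
  by move: u1; rmax; lra.
Qed.

Lemma weak1_E1 f1 f2 f3 y : Nlt (sumd f1 f2 f3) -> E1 f1 f2 f3 -> sub f2 f3 (y - f1) -> A y f2 f3.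
Proof.
move=> N [y1 [S1 dy1 A1]] S; apply: (step1 N A1); first by rewrite /degsum; lra.
have -> : y - y1 = (y - f1) - (y1 - f1) by ring.
exact: subB.
Qed.

Lemma weak1_E2 f1 f2 f3 y y1 : good f1 f2 f3 -> A f1 f2 f3 -> Nlt (sumd f1 f2 f3) -> Ecert f1 f2 f3 ->
  sub f1 f3 (y1 - f2) -> (d y1 < d f2)%Re -> A f1 y1 f3 ->
  sub f2 f3 (y - f1) -> (d y <= d f1)%Re -> A y f2 f3.
Proof.
move=> G hA N E S1 dy1 A1 S dy; have J := A_jac base hA; have [c0 cb ba] := G.
have b0 : (0 < d f2)%Re by lra. have dphi := d_move dy.
have D13 := D_ge2_jac (jac_rot (jac_rot (jac132 J))). have D23 := D_ge2_jac J.
have hm := mon_ge3 X.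
have viaf2 z q : A f1 z f3 -> z - f2 = evu f3 q -> (d z < d f2)%Re -> A y f2 f3.
  move=> Az eq dz; apply: A_eqv (eqv_312 _ _ _ _).
  apply: A_eqv (eqv_213 _ _ _ _); apply: (@square1 _ _ _ _ _ _ _ N f3 f2 z f1 y q) => //.
  + by apply: A_eqv Az _; exact: eqv_321.
  + by rewrite /degsum; lra.
  + exact: sub_sym.
  + by rewrite /degsum; lra.
have S1' : sub (f1 + cst 0 * f2) f3 (y1 - f2) by rewrite rmorph0 mul0r addr0.
case: (E2num charC J G S1' dy1) => [[[q eq] _]|[m m2 e]|[[p [op p3 e]] [h _]]].
- exact: (viaf2 y1 q).
- by apply: weak1_E1 S => //; exact: (to_E1 G hA N m2 (or_intror e) E).
rewrite rmorph0 mul0r addr0 in h.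
case: (sub_cases charC b0 c0 (jac_wdg J) S) => [hn|[m m1 e']|[m m1 e']|[p' [q' [p2 q2 cop e' SUy]]]].
- have [||k [q [eq _]]] := NC_split b0 c0 hn; [lra | lra |].
  have eq' : evu f3 q = y - f1 - cst k * f2 by rewrite eq; ring.
  have dq : (d (evu f3 q) <= d f1)%Re.
    have h1 := dB X (y - f1) (cst k * f2); have h2 := dZ_le X k f2.
    by rewrite eq'; move: h1; rmax; lra.
  have dx : (d (f1 + evu f3 q)%R <= d f1)%Re by have h1 := dD X f1 (evu f3 q); move: h1; rmax; lra.
  have B1 : A (f1 + evu f3 q) y1 f3.
    apply: (step1 N A1); first by rewrite /degsum; lra.
    by rewrite addrC addKr; apply: sub_evu; exact: sub_r.
  have B2 : A (f1 + evu f3 q) f2 f3.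
    apply: (step2 N B1); first by rewrite /degsum; lra.
    apply: (@sub_shift_l f1 f3 _ q); first by rewrite addrC addKr.
    by rewrite -opprB; exact: subN.
  have -> : y = f1 + evu f3 q + cst k * f2 by rewrite eq'; ring.
  exact: A_eqv B2 (eqv_shift1 _ _ _ _).
- have m2 : (2 <= m)%N by case: m m1 e' => [|[|m]] // _; rewrite /=; lra.
  have [f' [q [eq df']]] := lead_pow_evu c0 m2 e'.
  apply: (viaf2 f' q) => //.
  apply: (step2 N A1); first by rewrite /degsum; lra.
  have -> : f' - y1 = evu f3 q - (y1 - f2) by rewrite -eq; ring.
  by apply: subB => //; apply: sub_evu; exact: sub_r.
- by exfalso; case: (mult_cases b0 e') => [[|]|||]; lra.
exfalso; have h2 : (2 * d f2 <= INR q' * d f2)%Re by apply: INR2_mul_le => //; lra.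
have [|_ _ h3] := SUy.2; first lra.
have [h3' _] := h3 _ (jac_rot J); rewrite (D_sym X f3 f1) in h3'.
have {}q2 : q' = 2%N.
  apply/eqP; rewrite eqn_leq q2 andbT; apply/negPn/negP; rewrite -ltnNge => q3.
  have h3q := INR_mul_ge (Rlt_le _ _ b0) q3; rewrite [INR 3]/= in h3q; lra.
rewrite q2 [INR 2]/= in e'; rewrite q2 coprimen2 in cop.
apply: (parity_close c0 op cop e (b0 := d f2)); lra.
Qed.

(** In the critical situation with [d f1] different from [2 d f3], the only non-affine change of
    [f1] is by a quadratic polynomial in [f3]. [critical_strong] lowers [f3] far enough for the
    changed triple to satisfy [Kcond]. *)
Lemma weak1_E3 f1 f2 f3 y y1 : good f1 f2 f3 -> A f1 f2 f3 -> Nlt (sumd f1 f2 f3) -> Ecert f1 f2 f3 ->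
  sub f1 f2 (y1 - f3) -> (d y1 < d f3)%Re -> A f1 f2 y1 ->
  sub f2 f3 (y - f1) -> (d y <= d f1)%Re -> A y f2 f3.
Proof.
move=> G hA N E S1 dy1 A1 S dy; have J := A_jac base hA; have [c0 cb ba] := G.
have b0 : (0 < d f2)%Re by lra. have dphi := d_move dy.
have D12 := D_ge2_jac (jac_rot (jac_rot J)). have D23 := D_ge2_jac J.
have numE3 z : sub f1 f2 (z - f3) -> (d z < d f3)%Re -> (exists2 m, (2 <= m)%N & d f1 = (INR m * d f2)%Re) \/
    [/\ (2 * d f1 = 3 * d f2)%Re, (d f1 - d f2 + D f1 f2 <= d f3)%Re & SU f1 f2 (z - f3) (2 * d f1)].
  move=> Sz dz; have Sz' : sub (f1 + cst 0 * f3) (f2 + cst 0 * f3) (z - f3) by rewrite rmorph0 !mul0r !addr0.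
  case: (E3num charC J G Sz' dz) => [|[e [h SUz]]]; [by left | right].
  by rewrite !rmorph0 !mul0r !addr0 in h SUz.
case: (numE3 _ S1 dy1) => [[m m2 e]|[e32 h SU1]].
  by apply: weak1_E1 S => //; exact: (to_E1 G hA N m2 (or_introl e) E).
have dpsi z : (d z < d f3)%Re -> d (z - f3) = d f3 by exact: d_diff.
have hs : (d (y1 - f3)%R < d f2)%Re by rewrite dpsi.
have [y0 [Sy0 dy0 _ Ay0]] := critical_strong e32 hs SU1 G hA N.
have dy0' : (d y0 < d f3)%Re by lra.
have hD : (d f1 + D f1 f2 <= D f2 f3)%Re.
  case: (numE3 _ Sy0 dy0') => [[m m2 e]|[_ _ SU0]]; first by exfalso; case: (mult2_cases b0 m2 e); lra.
  have [|h1 _ _] := SU0.2; first by rewrite dpsi //; lra.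
  have hy := D_le X y0 f2.
  have ew : wdg f3 f2 = wdg y0 f2 - wdg (y0 - f3) f2.
    by rewrite -wdgNl -wdgDl; congr (wdg _ f2); ring.
  rewrite (D_sym X f2 f3) /(D f3 f2) ew dvD_lt dvN; first by rewrite -/(D (y0 - f3) f2); lra.
  by rewrite -/(D (y0 - f3) f2) -/(D y0 f2); lra.
have [e2|e2] : (d f1 = 2 * d f3 \/ d f1 <> 2 * d f3)%Re by lra.
  by apply: weak1_E1 S => //; apply: (to_E1 G hA N (m := 2%N) isT _ E); right; rewrite [INR 2]/=; lra.
have [k [q [eq _]]] : exists c q, y - f1 = cst c * f2 + evu f3 q /\ (c != 0 -> (d f2 <= d (y - f1)%R)%Re).
  case: (sub_cases charC b0 c0 (jac_wdg J) S) => [hn|[m m1 e]|[m m1 e]|[p [r [p2 r2 _ e SUx]]]].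
  - by apply: (NC_split b0 c0 hn); lra.
  - by exfalso; case: (mult_cases c0 e) => [[|]|||]; lra.
  - by exfalso; case: (mult_cases b0 e) => [[|]|||]; lra.
  - exfalso; have h2 : (2 * d f2 <= INR r * d f2)%Re by apply: INR2_mul_le => //; lra.
    by have := SUx.1; lra.
have eq' : evu f3 q = y - f1 - cst k * f2 by rewrite eq; ring.
have dq : (d (evu f3 q) <= d f1)%Re.
  have h1 := dB X (y - f1) (cst k * f2); have h2 := dZ_le X k f2.
  by rewrite eq'; move: h1; rmax; lra.
have [s2|s2] := leqP (size q) 2.
  by apply: A_eqv (eqv_312 _ _ _ _); apply: (@A_evu_lin _ _ f1 _ k q (A_eqv hA (eqv_231 X f1 f2 f3))).
have sq : size q = 3.
  apply/eqP; rewrite eqn_leq s2 andbT; apply: (size_le c0); rewrite [INR 3]/=; lra.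
have d2 : (2 * d f3 <= d f1)%Re by move: dq; rewrite d_evu // sq /=; lra.
have dx : (d (f1 + evu f3 q)%R <= d f1)%Re by have h1 := dD X f1 (evu f3 q); move: h1; rmax; lra.
have AH : A (f1 + evu f3 q) f2 f3.
  have e1 : f1 + evu f3 q + evu f3 (- q) = f1 by rewrite rmorphN addrK.
  apply: (@A_K C P X x1 x2 x3 (f1 + evu f3 q) f2 f3 (- q) y0); first by rewrite e1.
  by split; rewrite ?e1 ?size_polyN //; split=> //; [lra | right; lra].
have -> : y = f1 + evu f3 q + cst k * f2 by rewrite eq'; ring.
exact: A_eqv AH (eqv_shift1 _ _ _ _).
Qed.

(** Shifting [f1] along [f2], or [f1] and [f2] along [f3], changes neither the degrees nor the
    induction hypothesis; this reduces everything to the unshifted planes. *)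
Lemma weak1 f1 f2 f3 y : good f1 f2 f3 -> A f1 f2 f3 -> Nlt (sumd f1 f2 f3) -> Ecert f1 f2 f3 ->
  sub f2 f3 (y - f1) -> (d y <= d f1)%Re -> A y f2 f3.
Proof.
move=> G hA N E S dy; have J := A_jac base hA; have [c0 cb ba] := G.
case/EcertE: (E) => [E'|[k [y1 [S1 dy1 A1]]]|[k [l [y1 [S1 dy1 A1]]]]]; first exact: weak1_E1 N E' S.
- have d1 : d (f1 + cst k * f2) = d f1 by exact: d_add_lt.
  have G' := good_shift1 k G; have A' := A_eqv hA (eqv_shift1 f1 f2 f3 k).
  have N' : Nlt (sumd (f1 + cst k * f2) f2 f3) by rewrite /degsum d1.
  have E' : Ecert (f1 + cst k * f2) f2 f3.
    exists (f1 + cst k * f2), f3, f2, y1; split=> //.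
    by constructor 2; exists 0; rewrite rmorph0 mul0r addr0.
    by apply: A_eqv A1 _; exact: eqv_132.
  have B : A (y + cst k * f2) f2 f3.
    apply: (weak1_E2 G' A' N' E' S1 dy1 A1).
      by have -> : y + cst k * f2 - (f1 + cst k * f2) = y - f1 by ring.
    rewrite d1; have h1 := dD X y (cst k * f2); have h2 := dZ_le X k f2; move: h1; rmax; lra.
  exact: A_eqv B (eqv_sym (eqv_shift1 y f2 f3 k)).
have d1 : d (f1 + cst k * f3) = d f1 by apply: d_add_lt; lra.
have d2 : d (f2 + cst l * f3) = d f2 by apply: d_add_lt; lra.
have G' := good_shift3 k l G; have A' := A_eqv hA (eqv_shift3 f1 f2 f3 k l).
have N' : Nlt (sumd (f1 + cst k * f3) (f2 + cst l * f3) f3) by rewrite /degsum d1 d2.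
have E' : Ecert (f1 + cst k * f3) (f2 + cst l * f3) f3.
  exists (f1 + cst k * f3), (f2 + cst l * f3), f3, y1; split=> //.
  by constructor 1; exists 0, 0; rewrite rmorph0 !mul0r !addr0.
have B : A (y + cst k * f3) (f2 + cst l * f3) f3.
  apply: (weak1_E3 G' A' N' E' S1 dy1 A1).
    have -> : y + cst k * f3 - (f1 + cst k * f3) = y - f1 by ring.
    apply: sub_trans S; last exact: sub_r.
    have {2}-> : f2 = f2 + cst l * f3 - cst l * f3 by ring.
    by apply: subB; [exact: sub_l | apply: subZ; exact: sub_r].
  rewrite d1; have h1 := dD X y (cst k * f3); have h2 := dZ_le X k f3; move: h1; rmax; lra.
exact: A_eqv B (eqv_sym (eqv_shift3 y f2 f3 k l)).
Qed.

Lemma weak_moves f1 f2 f3 : good f1 f2 f3 -> A f1 f2 f3 -> Nlt (sumd f1 f2 f3) ->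
  [/\ forall y, sub f1 f2 (y - f3) -> (d y <= d f3)%Re -> A f1 f2 y,
      forall y, sub f1 f3 (y - f2) -> (d y <= d f2)%Re -> A f1 y f3 &
      forall y, sub f2 f3 (y - f1) -> (d y <= d f1)%Re -> A y f2 f3].
Proof.
move=> G hA N; case: (cert_form charC base G hA) => [B|K|E].
- exact: (base_moves G hA B).
- exact: (K_moves G hA K N).
split=> y; [exact: (weak3) | exact: (weak2) | exact: weak1].
Qed.

(** * Closure under elementary moves *)

(** Two basis elements of equal degree are separated by subtracting a multiple of one from the
    other. This lowers the sum of degrees, which is well founded. *)
Lemma good_basis : forall (v : R) f g h, jac f g h -> sumd f g h = v ->
  exists f1 f2 f3, [/\ eqv f g h f1 f2 f3, good f1 f2 f3 & (sumd f1 f2 f3 <= v)%Re].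
Proof.
apply: (@d_wf _ _ X) => v IH f g h J es.
have [p1 p2 p3] : [/\ (0 < d f)%Re, (0 < d g)%Re & (0 < d h)%Re].
  by split; [exact: jac_pos J | exact: jac_pos (jac_rot J) | exact: jac_pos (jac_rot (jac_rot J))].
have low f' g' h' : eqv f g h f' g' h' -> sumd f' g' h' = v -> d f' = d g' -> (0 < d f')%Re ->
    exists f1 f2 f3, [/\ eqv f g h f1 f2 f3, good f1 f2 f3 & (sumd f1 f2 f3 <= v)%Re].
  move=> E' es' ed q1; have [c c0 dc] := dlead ed q1.
  have E2 : eqv f' g' h' (f' - cst c * g') g' h'.
    have -> : f' - cst c * g' = f' + cst (- c) * g' by rewrite rmorphN; ring.
    exact: eqv_shift1.
  have E3 := eqv_trans E' E2.
  have lt : (sumd (f' - cst c * g')%R g' h' < v)%Re by rewrite -es' /degsum; lra.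
  have [|f1 [f2 [f3 [Ef Gf sf]]]] := IH _ _ lt _ _ _ (jac_eqv E3 J) erefl.
    by exists (f' - cst c * g'), g', h'.
  by exists f1, f2, f3; split=> //; [exact: eqv_trans E3 Ef | lra].
have [e1|e1] : (d f = d g \/ d f <> d g)%Re by lra.
  by apply: (low f g h) => //; exact: eqv_refl.
have [e2|e2] : (d f = d h \/ d f <> d h)%Re by lra.
  by apply: (low f h g) => //; [exact: eqv_132 | rewrite -es /degsum; lra].
have [e3|e3] : (d g = d h \/ d g <> d h)%Re by lra.
  by apply: (low g h f) => //; [exact: eqv_231 | rewrite -es /degsum; lra].
have s f1 f2 f3 : sumd f1 f2 f3 = v -> eqv f g h f1 f2 f3 -> good f1 f2 f3 ->
    exists f1 f2 f3, [/\ eqv f g h f1 f2 f3, good f1 f2 f3 & (sumd f1 f2 f3 <= v)%Re].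
  by move=> e E' G; exists f1, f2, f3; split=> //; lra.
case: (sort3 e1 e2 e3) => -[] o.
- by apply: (s f g h) => //; [exact: eqv_refl | split; lra].
- by apply: (s g f h); [rewrite -es /degsum; lra | exact: eqv_213 | split; lra].
- by apply: (s f h g); [rewrite -es /degsum; lra | exact: eqv_132 | split; lra].
- by apply: (s g h f); [rewrite -es /degsum; lra | exact: eqv_231 | split; lra].
- by apply: (s h f g); [rewrite -es /degsum; lra | exact: eqv_312 | split; lra].
- by apply: (s h g f); [rewrite -es /degsum; lra | exact: eqv_321 | split; lra].
Qed.

Lemma plane_basis f g h : jac f g h -> exists g1 g2,
  [/\ aff2 f g g1 /\ aff2 f g g2, aff2 g1 g2 f /\ aff2 g1 g2 g, (0 < d g2)%Re & (d g2 < d g1)%Re].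
Proof.
move=> J; have p1 := jac_pos J; have p2 := jac_pos (jac_rot J).
case: (Rtotal_order (d f) (d g)) => [lt|[e|lt]].
- exists g, f; split=> //; split; by [exact: aff2_1 | exact: aff2_2].
- have [c c0 dc] := dlead e p1.
  have eg : f - cst c * g = f + cst (- c) * g by rewrite rmorphN; ring.
  exists g, (f - cst c * g); split.
  + split; first exact: aff2_2.
    by exists 1, (- c), 0; rewrite rmorph1 rmorph0 rmorphN /=; ring.
  + split; last exact: aff2_1.
    by exists c, 1, 0; rewrite rmorph1 rmorph0; ring.
  + rewrite eg; apply: (@jac_pos _ _ X _ g h); apply: jac_eqv (J); exact: eqv_shift1.
  + by rewrite -e.
- exists f, g; split=> //; split; by [exact: aff2_1 | exact: aff2_2].
Qed.

Lemma plane_reduce g1 g2 z : (0 < d g2)%Re -> (d g2 < d g1)%Re ->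
  exists w, [/\ aff2 g1 g2 w, d (z - w) <> d g1 & d (z - w) <> d g2].
Proof.
move=> p2 lt.
have low u : (d u < d g1)%Re -> exists w, [/\ aff2 g1 g2 w, d (u - w) <> d g1 & d (u - w) <> d g2].
  move=> hu; have [e|e] : (d u = d g2 \/ d u <> d g2)%Re by lra.
    have [c c0 dc] : exists2 c, c != 0 & (d (u - cst c * g2)%R < d u)%Re by apply: dlead; rewrite ?e.
    exists (cst c * g2); split; [|lra|lra].
    by exists 0, c, 0; rewrite rmorph0; ring.
  exists 0; rewrite subr0; split=> //; last lra.
  by exists 0, 0, 0; rewrite rmorph0; ring.
have [e|e] : (d z = d g1 \/ d z <> d g1)%Re by lra.
  have [c c0 dc] : exists2 c, c != 0 & (d (z - cst c * g1)%R < d z)%Re by apply: dlead; rewrite ?e //; lra.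
  have [|w [Sw h1 h2]] := low (z - cst c * g1); first lra.
  exists (cst c * g1 + w); rewrite opprD addrA; split=> //.
  by apply: aff2D => //; apply: aff2Z; exact: aff2_1.
have [e'|e'] : (d z = d g2 \/ d z <> d g2)%Re by lra.
  by apply: low; lra.
exists 0; rewrite subr0; split=> //.
by exists 0, 0, 0; rewrite rmorph0; ring.
Qed.

Lemma canon_eqv f1 f2 f3 u1 u2 u3 : canon f1 f2 f3 u1 u2 u3 -> eqv f1 f2 f3 u1 u2 u3.
Proof.
case=> [[k [l [-> -> ->]]]|[k [-> -> ->]]|[-> -> ->]].
- exact: eqv_shift3.
- apply: eqv_trans (eqv_shift1 _ _ _ k) _; exact: eqv_132.
- exact: eqv_231.
Qed.

(** Subtracting an affine element of the plane makes the degree of [y] different from [d u1] and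
    [d u2]. If the result lies above [u3], it is reducible by [A_red], with [u3] as its reduction;
    otherwise the move does not raise the degree. *)
Lemma canon_move f1 f2 f3 u1 u2 u3 y : good f1 f2 f3 -> A f1 f2 f3 -> Nlt (sumd f1 f2 f3) ->
  canon f1 f2 f3 u1 u2 u3 -> sub u1 u2 (y - u3) -> A u1 u2 y.
Proof.
move=> G hA N Cn S; have [c0 cb ba] := G.
have Au := A_eqv hA (canon_eqv Cn).
have [dne pu1 pu2] : [/\ d u1 <> d u2, (0 < d u1)%Re & (0 < d u2)%Re].
  case: Cn => [[k [l [e1 e2 _]]]|[k [e1 e2 _]]|[e1 e2 _]]; rewrite e1 e2 ?d_add_lt //; try split; lra.
have weak z : sub u1 u2 (z - u3) -> (d z <= d u3)%Re -> A u1 u2 z.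
  case: Cn => [[k [l [-> -> ->]]]|[k [-> -> ->]]|[-> -> ->]] Sz dz.
  - have N' : Nlt (sumd (f1 + cst k * f3)%R (f2 + cst l * f3)%R f3).
      by apply: Nlt_le N; rewrite /degsum !d_add_lt //; lra.
    have [h _ _] := weak_moves (good_shift3 k l G) (A_eqv hA (eqv_shift3 f1 f2 f3 k l)) N'.
    exact: h.
  - have N' : Nlt (sumd (f1 + cst k * f2)%R f2 f3) by rewrite /degsum d_add_lt.
    have [_ h _] := weak_moves (good_shift1 k G) (A_eqv hA (eqv_shift1 f1 f2 f3 k)) N'.
    by apply: A_eqv (eqv_132 _ _ _ _); exact: h.
  - have [_ _ h] := weak_moves G hA N.
    by apply: A_eqv (eqv_231 _ _ _ _); exact: h.
have [w [Sw n1 n2]] : exists w, [/\ aff2 u1 u2 w, d (y - w) <> d u1 & d (y - w) <> d u2].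
  case: (Rlt_le_dec (d u2) (d u1)) => o; first exact: plane_reduce.
  have [||w [Sw n1 n2]] := @plane_reduce u2 u1 y; [lra | lra |].
  by exists w; split=> //; exact: aff2_swap.
have S' : sub u1 u2 (y - w - u3).
  have -> : y - w - u3 = (y - u3) - w by ring.
  by apply: subB => //; exact: aff2_sub.
have B : A u1 u2 (y - w).
  case: (Rle_lt_dec (d (y - w)%R) (d u3)) => o; first exact: weak.
  apply: (A_red Au) => //; last 2 first.
  - exact: not_eq_sym n1.
  - exact: not_eq_sym n2.
  by rewrite -opprB; exact: subN.
by apply: (A_aff B); rewrite opprB addrC subrK.
Qed.

Lemma close_step f g h : A f g h -> Nlt (sumd f g h) -> closed f g h.
Proof.
move=> hA N f' g' h' y E S; have J := A_jac base hA.
have [f1 [f2 [f3 [Ef G ls]]]] := good_basis J erefl.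
have N' : Nlt (sumd f1 f2 f3) := Nlt_le ls N.
have A1 := A_eqv hA Ef.
have J' := jac_eqv E J.
have [g1 [g2 [[a1 a2] [b1 b2] p2 lt]]] := plane_basis J'.
have [w [Sw n1 n2]] := plane_reduce h' p2 lt.
have Ew : eqv f' g' h' g1 g2 (h' - w).
  apply: eqv_sym; apply: (@eqv_center _ _ X g1 g2 (h' - w) f' g' h' 1 (- w)) => //.
  - exact: oner_neq0.
  - have -> : - w = cst (- 1) * w by rewrite rmorphN rmorph1; ring.
    apply: aff2Z; exact: aff2_trans Sw.
  - by rewrite rmorph1 mul1r.
have E1 : eqv f1 f2 f3 g1 g2 (h' - w).
  by apply: eqv_trans Ew; apply: eqv_trans E; exact: eqv_sym.
have lt' : d g1 <> d g2 by lra.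
have [u1 [u2 [u3 [Cn _ H]]]] := transfer (jac_eqv Ef J) G E1 lt' (not_eq_sym n1) (not_eq_sym n2).
have Sy : sub g1 g2 (y - (h' - w)).
  have -> : y - (h' - w) = (y - h') + w by ring.
  apply: subD; last exact: aff2_sub.
  by apply: sub_trans S; exact: aff2_sub.
have [y' [Sy' Ey _]] := H _ Sy.
have B := A_eqv (canon_move G A1 N' Cn Sy') (eqv_sym Ey).
apply: A_eqv B _.
apply: eqv_sym; apply: (@eqv_center _ _ X f' g' y g1 g2 y 1 0) => //.
- exact: oner_neq0.
- by exists 0, 0, 0; rewrite rmorph0; ring.
- by rewrite rmorph1 mul1r addr0.
Qed.

Lemma A_closed f g h : A f g h -> closed f g h.
Proof.
have H (mu : R) : Nlt mu.
  apply: (@d_wf _ _ X Nlt) => nu IH f' g' h' hA' lt; apply: close_step => //.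
  by apply: (IH _ _ lt); exists f', g', h'.
by move=> hA; exact: close_step.
Qed.

Lemma A_step f g h y : A f g h -> sub f g (y - h) -> A f g y.
Proof. by move=> hA S; apply: (A_closed hA (eqv_refl _ _ _ _) S). Qed.

End Peaks.

(** * Composition of polynomial maps and total degrees *)

Lemma poly_rmorph_eq (A : comNzRingType) (B : nzRingType) (phi psi : {rmorphism {poly A} -> B}) :
  (forall c, phi c%:P = psi c%:P) -> phi 'X = psi 'X -> forall p, phi p = psi p.
Proof.
move=> hc hX; elim/poly_ind => [|p c IH]; first by rewrite !rmorph0.
by rewrite !rmorphD !rmorphM IH hX hc.
Qed.

Section Eval3.
Variable C : fieldType.
Local Notation P := (P3 C).
Implicit Types a b c g h : P.

Definition C3m : {rmorphism C -> P} := polyC \o (polyC \o polyC).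

(** [e1], [e2] and [e3] rebuild the nested evaluation [eval3] as ring morphisms; [e3] is convertible
    to it. *)
Definition e1 a : {rmorphism {poly C} -> P} := (horner_eval a \o map_poly C3m : {rmorphism {poly C} -> P}).
Definition e2 a b : {rmorphism {poly {poly C}} -> P} :=
  (horner_eval b \o map_poly (e1 a) : {rmorphism {poly {poly C}} -> P}).
Definition e3 a b c : {rmorphism P -> P} := (horner_eval c \o map_poly (e2 a b) : {rmorphism P -> P}).

Lemma e1C a k : e1 a k%:P = C3 k.
Proof. by rewrite /e1 /= map_polyC /= /horner_eval hornerC. Qed.
Lemma e1X a : e1 a 'X = a.
Proof. by rewrite /e1 /= map_polyX /horner_eval hornerX. Qed.
Lemma e2C a b q : e2 a b q%:P = e1 a q.
Proof. by rewrite /e2 [LHS]/= map_polyC /horner_eval hornerC. Qed.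
Lemma e2X a b : e2 a b 'X = b.
Proof. by rewrite /e2 /= map_polyX /horner_eval hornerX. Qed.
Lemma e3C a b c q : e3 a b c q%:P = e2 a b q.
Proof. by rewrite /e3 [LHS]/= map_polyC /horner_eval hornerC. Qed.

Lemma e3_1 a b c : e3 a b c (X1 C) = a.
Proof. by rewrite e3C e2C e1X. Qed.
Lemma e3_2 a b c : e3 a b c (X2 C) = b.
Proof. by rewrite e3C e2X. Qed.
Lemma e3_3 a b c : e3 a b c (X3 C) = c.
Proof. by rewrite /e3 /= map_polyX /horner_eval hornerX. Qed.
Lemma e3_C a b c k : e3 a b c (C3 k) = C3 k.
Proof. by rewrite e3C e2C e1C. Qed.

Lemma P3_rmorph_eq (phi psi : {rmorphism P -> P}) : (forall k, phi (C3 k) = psi (C3 k)) ->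
  phi (X1 C) = psi (X1 C) -> phi (X2 C) = psi (X2 C) -> phi (X3 C) = psi (X3 C) -> forall p, phi p = psi p.
Proof.
move=> hC h1 h2 h3; apply: poly_rmorph_eq => // q.
apply: (poly_rmorph_eq (phi := phi \o polyC) (psi := psi \o polyC)) => // r.
by apply: (poly_rmorph_eq (phi := phi \o (polyC \o polyC)) (psi := psi \o (polyC \o polyC))).
Qed.

Lemma e3_comp a b c a' b' c' p :
  e3 a' b' c' (e3 a b c p) = e3 (e3 a' b' c' a) (e3 a' b' c' b) (e3 a' b' c' c) p.
Proof.
apply: (P3_rmorph_eq (phi := e3 a' b' c' \o e3 a b c)) => [k|||].
- by rewrite -[LHS]/(e3 a' b' c' (e3 a b c (C3 k))) !e3_C.
- by rewrite -[LHS]/(e3 a' b' c' (e3 a b c (X1 C))) !e3_1.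
- by rewrite -[LHS]/(e3 a' b' c' (e3 a b c (X2 C))) !e3_2.
- by rewrite -[LHS]/(e3 a' b' c' (e3 a b c (X3 C))) !e3_3.
Qed.

Lemma e3_id p : e3 (X1 C) (X2 C) (X3 C) p = p.
Proof.
apply: (P3_rmorph_eq (psi := idfun)) => [k|||]; [exact: e3_C|exact: e3_1|exact: e3_2|exact: e3_3].
Qed.

Local Notation i1 := (inord 1 : 'I_3).
Local Notation i2 := (inord 2 : 'I_3).

Lemma i1E : i1 = 1. Proof. by apply: val_inj; rewrite /= inordK. Qed.
Lemma i2E : i2 = 1 + 1. Proof. by apply: val_inj; rewrite /= inordK. Qed.

Lemma pcompE (F G : Defs.pmap C) i : Defs.pcomp F G i = e3 (G ord0) (G i1) (G i2) (F i).
Proof. by rewrite ffunE. Qed.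

Lemma pcompA (F G H : Defs.pmap C) : Defs.pcomp (Defs.pcomp F G) H = Defs.pcomp F (Defs.pcomp G H).
Proof. by apply/ffunP => i; rewrite !pcompE e3_comp. Qed.

Lemma ord3 (i : 'I_3) : [\/ i = ord0, i = i1 | i = i2].
Proof.
case: i => [[|[|[|i]]] hi] //; [constructor 1|constructor 2|constructor 3]; apply: val_inj;
  by rewrite /= ?inordK.
Qed.

Lemma Xv_0 : Xv C ord0 = X1 C. Proof. by []. Qed.
Lemma Xv_1 : Xv C i1 = X2 C. Proof. by rewrite /Xv /= inordK. Qed.
Lemma Xv_2 : Xv C i2 = X3 C. Proof. by rewrite /Xv /= inordK. Qed.

Lemma pid_l (H : Defs.pmap C) : Defs.pcomp (Defs.pid C) H = H.
Proof.
apply/ffunP => i; rewrite pcompE ffunE.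
by case: (ord3 i) => ->; rewrite ?Xv_0 ?Xv_1 ?Xv_2 ?e3_1 ?e3_2 ?e3_3.
Qed.

Lemma pid_r (H : Defs.pmap C) : Defs.pcomp H (Defs.pid C) = H.
Proof. by apply/ffunP => i; rewrite pcompE !ffunE Xv_0 Xv_1 Xv_2 e3_id. Qed.

End Eval3.

Section Degree.
Variable C : fieldType.
Local Notation P := (P3 C).
Implicit Types p : P.

Lemma bigmax_attain n (Q : pred 'I_n) (F : 'I_n -> nat) (i : 'I_n) : Q i ->
  exists j, Q j /\ \max_(j | Q j) F j = F j.
Proof.
move=> qi; have [|j qj e] := @eq_bigmax_cond _ Q F; first by apply/card_gt0P; exists i.
by exists j.
Qed.

Lemma deg1_ge (r : {poly C}) i : r`_i != 0 -> (i <= deg1 r)%N.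
Proof.
by move=> h; rewrite /deg1 -ltnS; apply: leq_trans (leqSpred _); rewrite ltnNge; apply: contra h => h; rewrite nth_default.
Qed.

Lemma deg2_ge (q : {poly {poly C}}) i j : q`_j`_i != 0 -> (i + j <= deg2 q)%N.
Proof.
move=> h; have q0 : q`_j != 0 by apply: contraNneq h => ->; rewrite coef0.
have jl : (j < size q)%N by rewrite ltnNge; apply: contra q0 => h'; rewrite nth_default.
rewrite /deg2; apply: leq_trans (leq_bigmax_cond (Ordinal jl) q0).
by rewrite /= addnC leq_add2l deg1_ge.
Qed.

Lemma deg3_ge p i j k : p`_k`_j`_i != 0 -> (i + j + k <= deg3 p)%N.
Proof.
move=> h; have q0 : p`_k != 0 by apply: contraNneq h => ->; rewrite !coef0.
have jl : (k < size p)%N by rewrite ltnNge; apply: contra q0 => h'; rewrite nth_default.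
rewrite /deg3; apply: leq_trans (leq_bigmax_cond (Ordinal jl) q0).
by rewrite /= addnC leq_add2l deg2_ge.
Qed.

Lemma deg3_attain p : p != 0 -> exists i j k, p`_k`_j`_i != 0 /\ deg3 p = (i + j + k)%N.
Proof.
have lead (A : nzRingType) (q : {poly A}) : q != 0 -> exists i : 'I_(size q), q`_i != 0.
  move=> q0; have s : ((size q).-1 < size q)%N by rewrite prednK // size_poly_gt0.
  by exists (Ordinal s); rewrite /= -lead_coefE lead_coef_eq0.
move=> p0; have [k0 hk0] := lead _ _ p0.
have [k [hk ek]] := @bigmax_attain _ (fun i => p`_i != 0) (fun i => (i + deg2 (p`_i)%R)%N) _ hk0.
have [j0 hj0] := lead _ _ hk.
have [j [hj ej]] := @bigmax_attain _ (fun i => p`_k`_i != 0) (fun i => (i + deg1 (p`_k`_i)%R)%N) _ hj0.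
exists (deg1 p`_k`_j), j, k; split; first by rewrite /deg1 -lead_coefE lead_coef_eq0.
by rewrite /deg3 ek /deg2 ej; lia.
Qed.

Variables w1 w2 w3 : R.
Hypotheses (w1_ge1 : (1 <= w1)%Re) (w2_ge1 : (1 <= w2)%Re) (w3_ge1 : (1 <= w3)%Re).
Hypothesis w_indep : forall i j k i' j' k',
  (INR i * w1 + INR j * w2 + INR k * w3 = INR i' * w1 + INR j' * w2 + INR k' * w3)%Re ->
  [/\ i = i', j = j' & k = k'].

Lemma wdeg_ge p i j k : p`_k`_j`_i != 0 -> (INR i * w1 + INR j * w2 + INR k * w3 <= wdeg w1 w2 w3 p)%Re.
Proof.
move=> h; have q0 : p`_k != 0 by apply: contraNneq h => ->; rewrite !coef0.
have r0 : p`_k`_j != 0 by apply: contraNneq h => ->; rewrite !coef0.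
have h1 := pdeg_ge (fun _ : C => 0%Re) w1 h.
have h2 := pdeg_ge (pdeg (fun _ : C => 0%Re) w1) w2 r0.
have h3 := pdeg_ge (pdeg (pdeg (fun _ : C => 0%Re) w1) w2) w3 q0.
have H := Rle_trans _ _ _ (Rplus_le_compat_l (INR k * w3) _ _
  (Rle_trans _ _ _ (Rplus_le_compat_l (INR j * w2) _ _ h1) h2)) h3.
by apply: Rle_trans H; lra.
Qed.

Lemma wdeg_attain p : p != 0 -> exists i j k, p`_k`_j`_i != 0 /\
  wdeg w1 w2 w3 p = (INR i * w1 + INR j * w2 + INR k * w3)%Re.
Proof.
move=> p0; have [k [hk ek]] := pdeg_attain (w3_gt0 w3_ge1) (d2P C w1_ge1 w2_ge1 w_indep) p0.
have [j [hj ej]] := pdeg_attain (w2_gt0 w2_ge1) (d1P C w1_ge1 w_indep) hk.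
have [i [hi ei]] := pdeg_attain (w1_gt0 w1_ge1) (dCP C) hj.
exists i, j, k; split=> //; apply: etrans ek _.
have H := etrans ej (f_equal (Rplus (INR j * w2)) ei).
by apply: etrans (f_equal (Rplus (INR k * w3)) H) _; lra.
Qed.

(** Up to total degree [N], the excess of the weights over 1 adds less than 1 to the degree of a
    monomial, so a larger total degree means a larger weighted degree. *)
Lemma wdeg_deg3 p N : (deg3 p <= N)%N -> (w1 <= 2)%Re -> (w2 <= w1)%Re -> (w3 <= w1)%Re -> (INR N * (w1 - 1) < 1)%Re ->
  exists i j k, wdeg w1 w2 w3 p = (INR i * w1 + INR j * w2 + INR k * w3)%Re /\ deg3 p = (i + j + k)%N.
Proof.
move=> hN l1 l2 l3 hw; have [->|p0] := eqVneq p 0.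
  exists 0%N, 0%N, 0%N; rewrite /wdeg /deg3 size_poly0 big_ord0 pdeg0 /=; split=> //; lra.
have [i [j [k [h e]]]] := wdeg_attain p0; have [i' [j' [k' [h' e']]]] := deg3_attain p0.
exists i, j, k; split=> //; apply/eqP; rewrite eqn_leq deg3_ge // andbT.
have g := wdeg_ge h'; have := deg3_ge h; rewrite e' => hle.
rewrite leqNgt; apply/negP => lt.
have lt' : (INR (i + j + k) + 1 <= INR (i' + j' + k'))%Re by rewrite -S_INR; apply: INR_ge.
have nn : (INR (i + j + k) <= INR N)%Re by apply: INR_ge; lia.
have p1 := pos_INR i; have p2 := pos_INR j; have p3 := pos_INR k.
have p1' := pos_INR i'; have p2' := pos_INR j'; have p3' := pos_INR k'.
move: lt' nn; rewrite !plus_INR => lt' nn; nra.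
Qed.

End Degree.

(** * Tame maps give reducible triples *)

(** The [p]-adic valuation of [b^2 m] is odd for nonzero [b], that of a nonzero square is even. *)
Lemma sqrt_irrational (m p : nat) : prime p -> (0 < m)%N -> odd (logn p m) ->
  forall b c : BinNums.Z, (IZR b * sqrt (INR m) = IZR c)%Re -> b = BinNums.Z0.
Proof.
move=> pp m0 om b c e; have hs := sqrt_sqrt (INR m) (pos_INR m).
have e2 : (IZR b * IZR b * INR m = IZR c * IZR c)%Re.
  by rewrite -e -{1}hs; lra.
rewrite INR_IZR_INZ -!mult_IZR in e2; have {}e2 := eq_IZR _ _ e2.
have e3 : (BinInt.Z.abs_nat b ^ 2 * m = BinInt.Z.abs_nat c ^ 2)%N by nia.
have [b0|b0] := posnP (BinInt.Z.abs_nat b); first by lia.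
have : odd (logn p (BinInt.Z.abs_nat c ^ 2)).
  by rewrite -e3 lognM ?expn_gt0 ?b0 // lognX oddD oddM /= om.
by rewrite lognX oddM.
Qed.

(** The weights are [1 + sqrt 3 / n], [1 + sqrt 2 / n] and 1. Since [sqrt 3 < 2], the choice
    [n = 2 N + 2] gives the required closeness to 1, and independence is that of 1, [sqrt 2] and
    [sqrt 3]. *)
Lemma weights_exist (N : nat) : exists w1 w2 : R,
  [/\ (1 < w2)%Re, (w2 < w1)%Re, (w1 < 2)%Re, (INR N * (w1 - 1) < 1)%Re &
   forall i j k i' j' k',
   (INR i * w1 + INR j * w2 + INR k * 1 = INR i' * w1 + INR j' * w2 + INR k' * 1)%Re ->
   [/\ i = i', j = j' & k = k']].
Proof.
set n := INR (2 * N + 2).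
have n2 : (2 * INR N + 2 = n)%Re by rewrite /n plus_INR mult_INR [INR 2]/=; lra.
have N0 := pos_INR N.
set s2 := sqrt (INR 2); set s3 := sqrt (INR 3).
have h2 : (s2 * s2 = 2)%Re by apply: etrans (sqrt_sqrt _ (pos_INR _)) _; rewrite [INR 2]/=; lra.
have h3 : (s3 * s3 = 3)%Re by apply: etrans (sqrt_sqrt _ (pos_INR _)) _; rewrite [INR 3]/=; lra.
have p2 : (0 <= s2)%Re := sqrt_pos _; have p3 : (0 <= s3)%Re := sqrt_pos _.
have h6 : sqrt (INR 6) = (s2 * s3)%Re.
  by rewrite -(sqrt_mult _ _ (pos_INR _) (pos_INR _)) -mult_INR.
have l23 : (s2 < s3)%Re by nra.
have l3 : (s3 < 2)%Re by nra.
have l2 : (0 < s2)%Re by nra.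
have n0 : (0 < n)%Re by lra.
have q2 : (s2 / n * n = s2)%Re by rewrite /Rdiv Rmult_assoc Rinv_l; lra.
have q3 : (s3 / n * n = s3)%Re by rewrite /Rdiv Rmult_assoc Rinv_l; lra.
have t2 : (0 < s2 / n)%Re by exact: Rdiv_lt_0_compat.
have t23 : (s2 / n < s3 / n)%Re by apply: Rmult_lt_compat_r => //; exact: Rinv_0_lt_compat.
have t3 : (s3 / n * (2 * INR N + 2) < 2)%Re by rewrite n2 q3.
have tN : (0 <= s3 / n * INR N)%Re by apply: Rmult_le_pos; lra.
exists (1 + s3 / n)%Re, (1 + s2 / n)%Re; split; try lra.
move=> i j k i' j' k' e.
pose B := (BinInt.Z.of_nat i - BinInt.Z.of_nat i')%Zs; pose K := (BinInt.Z.of_nat j - BinInt.Z.of_nat j')%Zs.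
pose S := (BinInt.Z.of_nat (i + j + k) - BinInt.Z.of_nat (i' + j' + k'))%Zs.
have eS : (IZR B * s3 + IZR K * s2 = - (n * IZR S))%Re.
  rewrite /B /K /S !minus_IZR -!INR_IZR_INZ !plus_INR -q2 -q3.
  have := f_equal (Rmult n) e; move: (s3 / n)%Re (s2 / n)%Re => u v; lra.
(* Squaring the relation isolates the mixed term; irrationality of [sqrt 6] makes [B] or [K] vanish,
   and then a single square root is left. *)
have e6 : (IZR (2 * B * K)%Zs * sqrt (INR 6) = IZR (BinInt.Z.of_nat (2 * N + 2) * BinInt.Z.of_nat (2 * N + 2) * (S * S) - 3 * (B * B) - 2 * (K * K))%Zs)%Re.
  rewrite h6 !minus_IZR !mult_IZR -!INR_IZR_INZ -/n.
  have := f_equal (fun x => x * x)%Re eS; have := f_equal (Rmult (IZR B * IZR B)) h3.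
  by have := f_equal (Rmult (IZR K * IZR K)) h2; rewrite /=; lra.
have BK := @sqrt_irrational 6 2 isT isT isT _ _ e6.
have n_eq : n = IZR (BinInt.Z.of_nat (2 * N + 2)) by rewrite -INR_IZR_INZ.
have [B0 K0] : B = 0%Zs /\ K = 0%Zs.
  have [B0|K0] : B = 0%Zs \/ K = 0%Zs by nia.
  - split=> //; apply: (@sqrt_irrational 2 2 isT isT isT _ (- (BinInt.Z.of_nat (2 * N + 2) * S))%Zs).
    by rewrite opp_IZR mult_IZR -n_eq -/s2 -eS B0; lra.
  - split=> //; apply: (@sqrt_irrational 3 3 isT isT isT _ (- (BinInt.Z.of_nat (2 * N + 2) * S))%Zs).
    by rewrite opp_IZR mult_IZR -n_eq -/s3 -eS K0; lra.
have S0 : S = 0%Zs.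
  apply: eq_IZR; move: eS; rewrite B0 K0 => eS; nra.
by move: B0 K0 S0; rewrite /B /K /S => B0 K0 S0; split; lia.
Qed.

Lemma jac_diag (C : fieldType) (P : idomainType) (X : ctx C P) (x y z : P) : wmn X = x * y * z ->
  (forall i, wth X i x = if i == 0 then x else 0) -> (forall i, wth X i y = if i == 1 then y else 0) ->
  (forall i, wth X i z = if i == 1 + 1 then z else 0) -> jac X x y z.
Proof.
move=> e hx hy hz; exists 1; first exact: oner_neq0.
by rewrite det3E !hx !hy !hz /= e rmorph1; ring.
Qed.

Section TameTriples.
Variable C : fieldType.
Hypothesis charC : [pchar C] =i pred0.
Local Notation P := (P3 C).
Variables w1 w2 : R.
Hypotheses (w2_gt1 : (1 < w2)%Re) (w12 : (w2 < w1)%Re) (w1_lt2 : (w1 < 2)%Re).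
Hypothesis w_indep : forall i j k i' j' k',
  (INR i * w1 + INR j * w2 + INR k * 1 = INR i' * w1 + INR j' * w2 + INR k' * 1)%Re ->
  [/\ i = i', j = j' & k = k'].

Lemma w1_ge1' : (1 <= w1)%Re. Proof. lra. Qed.
Lemma w2_ge1' : (1 <= w2)%Re. Proof. lra. Qed.
Lemma w3_ge1' : (1 <= 1)%Re. Proof. lra. Qed.

Definition X0 : ctx C P := wctx charC w1_ge1' w2_ge1' w3_ge1' w_indep.
Local Notation d := (wd X0).
Local Notation cst := (wcst X0).
Local Notation A := (redtriple X0 (X1 C) (X2 C) (X3 C)).
Local Notation i1 := (inord 1 : 'I_3).
Local Notation i2 := (inord 2 : 'I_3).

Lemma d_X1 : d (X1 C) = w1. Proof. exact: (wdeg_X C w1_ge1' w2_ge1' w3_ge1' w_indep 0). Qed.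
Lemma d_X2 : d (X2 C) = w2. Proof. exact: (wdeg_X C w1_ge1' w2_ge1' w3_ge1' w_indep 1). Qed.
Lemma d_X3 : d (X3 C) = 1%Re. Proof. exact: (wdeg_X C w1_ge1' w2_ge1' w3_ge1' w_indep (1 + 1)). Qed.

Lemma th_X (i : 'I_3) : [/\ wth X0 i (X1 C) = if i == 0 then X1 C else 0,
   wth X0 i (X2 C) = if i == 1 then X2 C else 0 & wth X0 i (X3 C) = if i == 1 + 1 then X3 C else 0].
Proof.
have mX (B : nzRingType) (T : B -> B) : T 0 = 0 -> T 1 = 0 -> map_poly T 'X = 0.
  by move=> t0 t1; apply/polyP => k; rewrite coef_map_id0 // coefX coef0; case: (_ == _).
have t1 (B : comNzRingType) : theta (1 : {poly B}) = 0 by rewrite -polyC1 theta_const.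
have m0 : map_poly (@theta C) 0 = 0 by rewrite map_poly0.
have m1 : map_poly (@theta C) 1 = 0 by rewrite -polyC1 map_polyC0 ?theta0 // t1.
have e0 := theta0 C; have e1 := theta0 {poly C}.
case: (I3E i) => ->; rewrite /= /wtheta /X1 /X2 /X3 /=; split.
- by rewrite !map_polyC0 ?e0 ?polyC0 // /theta derivX mulr1.
- by rewrite map_polyC0 ?mX ?polyC0 ?m0 ?t1 ?theta0.
- by rewrite mX ?m0 ?m1 ?t1 ?theta0.
- by rewrite map_polyC0 ?theta0 // theta_const polyC0.
- by rewrite map_polyC0 ?theta0 // /theta derivX mulr1.
- by rewrite mX ?m0 ?m1 ?t1 ?theta0.
- by rewrite theta_const.
- by rewrite theta_const.
- by rewrite /theta derivX mulr1.
Qed.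

Lemma jac_X : jac X0 (X1 C) (X2 C) (X3 C).
Proof. by apply: jac_diag => // i; have [a b c] := th_X i. Qed.

Lemma base_X : base_ok X0 (X1 C) (X2 C) (X3 C).
Proof.
split; first exact: jac_X.
- by split; rewrite ?d_X1 ?d_X2 ?d_X3; lra.
- by rewrite d_X1 d_X3; lra.
move=> m n m0; rewrite d_X1 d_X2 d_X3; split=> e.
- by have [|h _ _] := w_indep (i := m) (j := 0) (k := 0) (i' := 0) (j' := n) (k' := 0); [rewrite [INR 0]/=; lra | rewrite h in m0].
- by have [|h _ _] := w_indep (i := m) (j := 0) (k := 0) (i' := 0) (j' := 0) (k' := n); [rewrite [INR 0]/=; lra | rewrite h in m0].
- by have [|_ h _] := w_indep (i := 0) (j := m) (k := 0) (i' := 0) (j' := 0) (k' := n); [rewrite [INR 0]/=; lra | rewrite h in m0].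
Qed.

Definition TA (H : Defs.pmap C) : Prop := A (H ord0) (H i1) (H i2).

Lemma lin_aff3 (H : Defs.pmap C) (a : 'I_3 -> C) e :
  aff3 X0 (H ord0) (H i1) (H i2) (\sum_j cst (a j) * H j + cst e).
Proof. by exists (a ord0), (a i1), (a i2), e; rewrite sum3 i1E i2E. Qed.

Lemma affine_TA F H : affine_aut F -> (TA H <-> TA (Defs.pcomp F H)).
Proof.
move=> [M [b [uM ->]]].
set FH := Defs.pcomp _ H.
have eF i : FH i = \sum_j cst (M i j) * H j + cst (b i ord0).
  rewrite pcompE ffunE rmorphD rmorph_sum e3_C; congr (_ + _).
  apply: eq_bigr => j _; rewrite rmorphM e3_C.
  by case: (ord3 j) => ->; rewrite ?Xv_0 ?Xv_1 ?Xv_2 ?e3_1 ?e3_2 ?e3_3.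
have eH i : H i = \sum_j cst (invmx M i j) * FH j + cst (- \sum_j invmx M i j * b j ord0).
  transitivity (\sum_k cst ((invmx M *m M) i k) * H k).
    rewrite mulVmx // (bigD1 i) //= big1 => [|k ki]; first by rewrite mxE eqxx rmorph1 mul1r addr0.
    by rewrite mxE eq_sym (negbTE ki) rmorph0 mul0r.
  rewrite rmorphN rmorph_sum -sumrB.
  under [RHS]eq_bigr => j _ do rewrite eF rmorphM mulrDr addrK mulr_sumr.
  rewrite exchange_big; apply: eq_bigr => k _.
  rewrite mxE rmorph_sum mulr_suml; apply: eq_bigr => j _.
  by rewrite rmorphM mulrA.
have E : eqv X0 (H ord0) (H i1) (H i2) (FH ord0) (FH i1) (FH i2).
  have f1 i : aff3 X0 (H ord0) (H i1) (H i2) (FH i) by rewrite eF; exact: lin_aff3.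
  have f2 i : aff3 X0 (FH ord0) (FH i1) (FH i2) (H i) by rewrite eH; exact: (lin_aff3 FH).
  by split; split.
split=> h; [exact: A_eqv h E | exact: A_eqv h (eqv_sym E)].
Qed.

Lemma elementary_TA f g h p : sub X0 f g p -> (A f g h <-> A f g (h + p)).
Proof.
move=> S; split=> hA; apply: (A_step charC base_X hA).
  by rewrite addrC addKr.
by rewrite opprD addrA subrr add0r; exact: subN.
Qed.

Lemma triangular_TA F H : triangular_aut F -> (TA H <-> TA (Defs.pcomp F H)).
Proof.
move=> [f2 [f3 eF]].
have F0 : F ord0 = X1 C by rewrite eF ffunE.
have F1 : F i1 = X2 C + f2%:P%:P by rewrite eF ffunE /= inordK.
have F2 : F i2 = X3 C + f3%:P by rewrite eF ffunE /= inordK.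
rewrite /TA !pcompE F0 F1 F2 !rmorphD !e3C !e2C e1X e2X e3_3.
set p2 := e1 (H ord0) f2; set p3 := e2 (H ord0) (H i1) f3.
have S3 : sub X0 (H ord0) (H i1) p3 by apply: sub_sym; exists f3.
have S2 h : sub X0 (H ord0) h p2 by apply: sub_sym; exists f2%:P; rewrite evC.
rewrite (elementary_TA (H i2) S3).
split=> hA; apply: A_eqv (eqv_132 _ _ _ _).
  by apply: (proj1 (elementary_TA (H i1) (S2 _))); apply: A_eqv hA _; exact: eqv_132.
by apply: (proj2 (elementary_TA (H i1) (S2 _))); apply: A_eqv hA _; exact: eqv_132.
Qed.

(** Invariance is stated as an equivalence for all [H], so that the rule for inverses goes
    through. *)
Lemma tame_TA F : tame F -> forall H, TA H <-> TA (Defs.pcomp F H).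
Proof.
elim=> {F} [F hF H|F hF H|F G _ IHF _ IHG H|F G _ IHF e1 e2 H].
- exact: affine_TA.
- exact: triangular_TA.
- by rewrite pcompA -IHF -IHG.
- by rewrite [X in _ <-> X]IHF -pcompA e1 pid_l.
Qed.

Lemma tame_A F : tame F -> TA F.
Proof.
move=> tF; rewrite -[F]pid_r; apply: (proj1 (tame_TA tF (Defs.pid C))).
by rewrite /TA !ffunE Xv_0 Xv_1 Xv_2; exact: A_base.
Qed.

(** [x] and [n] are the weighted and the total degree of one and the same monomial. *)
Definition rep (x : R) (n : nat) := exists i j k,
  x = (INR i * w1 + INR j * w2 + INR k * 1)%Re /\ n = (i + j + k)%N.

Lemma rep_deg3 p N : (deg3 p <= N)%N -> (INR N * (w1 - 1) < 1)%Re -> rep (d p) (deg3 p).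
Proof.
move=> h1 h2.
have [||||i [j [k [e e']]]] := wdeg_deg3 w1_ge1' w2_ge1' w3_ge1' w_indep h1; try lra.
by exists i, j, k.
Qed.

Lemma rep_bounds x n : rep x n -> (INR n <= x <= INR n * w1)%Re.
Proof.
move=> [i [j [k [-> ->]]]]; have p1 := pos_INR i; have p2 := pos_INR j; have p3 := pos_INR k.
rewrite !plus_INR; split; nra.
Qed.

(** Independence of the weights makes the relation hold for each exponent separately, hence for
    their sum. This brings in the arithmetic of the total degrees. *)
Lemma rep_lin a b c na nb nc m i j : rep a na -> rep b nb -> rep c nc ->
  (INR m * a = INR i * b + INR j * c)%Re -> (m * na = i * nb + j * nc)%N.
Proof.
move=> [a1 [a2 [a3 [-> ->]]]] [b1 [b2 [b3 [-> ->]]]] [c1 [c2 [c3 [-> ->]]]] e.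
have [|h1 h2 h3] := w_indep (i := (m * a1)%N) (j := (m * a2)%N) (k := (m * a3)%N)
   (i' := (i * b1 + j * c1)%N) (j' := (i * b2 + j * c2)%N) (k' := (i * b3 + j * c3)%N).
  by rewrite !plus_INR !mult_INR; lra.
by lia.
Qed.

Lemma rep_nat x n m : rep x n -> x = INR m -> n = m.
Proof.
move=> [i [j [k [-> ->]]]] e.
have [|-> -> ->] := w_indep (i := i) (j := j) (k := k) (i' := 0%N) (j' := 0%N) (k' := m); first by rewrite [INR 0]/=; lra.
by [].
Qed.

End TameTriples.

(** * Multidegrees (3, p, d) *)

Section Main.
Variable C : fieldType.
Hypothesis charC : [pchar C] =i pred0.
Local Notation P := (P3 C).
Local Notation i1 := (inord 1 : 'I_3).
Local Notation i2 := (inord 2 : 'I_3).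

(** * Excluded multidegrees *)

Section Forward.
Variable p2 : nat.
Hypothesis p2_prime : prime p2.
Hypothesis p2_gt3 : (3 < p2)%N.

Lemma p2_mod : exists t s, (p2 = 3 * t + 1 \/ p2 = 3 * t + 2)%N /\ (p2 = 2 * s + 1)%N.
Proof.
exists (p2 %/ 3)%N, (p2 %/ 2)%N; split.
  have : ~~ (3 %| p2)%N by rewrite dvdn_prime2 // neq_ltn p2_gt3.
  by rewrite /dvdn; lia.
have : ~~ (2 %| p2)%N by rewrite dvdn_prime2 // neq_ltn (ltn_trans _ p2_gt3).
by rewrite /dvdn; lia.
Qed.

Variable k : nat.
Hypothesis k_range : (1 <= k <= p2 %/ 3)%N.
Local Notation d3 := (2 * p2 - 3 * k)%N.

Lemma d3_mul_p m : (2 <= m)%N -> d3 <> (m * p2)%N.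
Proof. move=> m2; have : (2 * p2 <= m * p2)%N by rewrite leq_mul2r m2 orbT. by case/andP: k_range; lia. Qed.

(** Modulo 3, [i] would have to be congruent to 2, while [d3 < 2 p2] leaves only [i <= 1]. *)
Lemma d3_comb i j : d3 <> (i * p2 + j * 3)%N.
Proof.
have [t [s [ht hs]]] := p2_mod; case/andP: k_range => k1 k3.
case: i => [|[|i]]; first by lia.
  by lia.
have : (2 * p2 <= i.+2 * p2)%N by rewrite leq_mul2r orbT.
lia.
Qed.

Lemma no_tame (F : Defs.pmap C) : tame F -> mdeg F = (3%N, p2, d3) -> False.
Proof.
move=> tF [e0 e1 e2]; have [t [s [ht hs]]] := p2_mod; have [k1 k3] := andP k_range.
have lt3 : (p2 < d3)%N by lia.
have [w1 [w2 [w2_gt1 w12 w1_lt2 hN w_indep]]] := weights_exist d3.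
set X := @X0 C charC w1 w2 w2_gt1 w12 w_indep.
have hA := tame_A charC w2_gt1 w12 w1_lt2 w_indep tF.
rewrite /TA -/X in hA; have base := base_X charC w2_gt1 w12 w1_lt2 w_indep; rewrite -/X in base.
have hrep p n : deg3 p = n -> (n <= d3)%N -> rep w1 w2 (wd X p) n.
  by move=> en nN; rewrite -en; apply: (rep_deg3 charC w2_gt1 w12 w1_lt2 w_indep (N := d3)) => //; rewrite en.
have r0 := hrep _ _ e0 ltac:(lia); have r1 := hrep _ _ e1 ltac:(lia); have r2 := hrep _ _ e2 (leqnn _).
have dX3 : wd X (X3 C) = 1%Re by exact: d_X3.
clearbody X; clear hrep.
have rz : rep w1 w2 0 0 by exists 0%N, 0%N, 0%N; split=> //; rewrite [INR 0]/=; lra.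
have lin a b c na nb nc m i j := @rep_lin w1 w2 w_indep a b c na nb nc m i j.
set f3 := F ord0 in hA r0; set f2 := F i1 in hA r1; set f1 := F i2 in hA r2.
have b0 := rep_bounds w2_gt1 w12 r0; have b1 := rep_bounds w2_gt1 w12 r1; have b2 := rep_bounds w2_gt1 w12 r2.
have [u1 v1] := b1; have [u0 v0] := b0; have [u2 v2] := b2.
rewrite [INR 3]/= in u0 v0.
have kk : (INR p2 + 1 <= INR d3)%Re by rewrite -S_INR; apply: INR_ge.
have k4 : (3 + 2 <= INR p2)%Re.
  have : (5 <= p2)%N by lia. by move/INR_ge; rewrite [INR 5]/=; lra.
have d3le : (INR d3 + 3 <= 2 * INR p2)%Re.
  have : (d3 + 3 <= 2 * p2)%N by lia.
  by move/INR_ge; rewrite plus_INR mult_INR [INR 3]/= [INR 2]/=; lra.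
have we : (0 < w1 - 1)%Re by lra.
have we' : (INR p2 * (w1 - 1) <= INR d3 * (w1 - 1))%Re by apply: Rmult_le_compat_r; lra.
have we3 : (5 * (w1 - 1) <= INR d3 * (w1 - 1))%Re by apply: Rmult_le_compat_r; lra.
have G : good X f1 f2 f3 by split; nra.
have {}hA : redtriple X (X1 C) (X2 C) (X3 C) f1 f2 f3 by apply: A_eqv hA _; exact: eqv_321.
have J := A_jac base hA; have D23 := D_ge2_jac J.
have ne m n : (m * d3 <> n * p2)%N -> (INR m * wd X f1 <> INR n * wd X f2)%Re.
  move=> h e; apply: h; have := lin _ _ _ _ _ _ m n 0%N r2 r1 rz.
  by rewrite muln0 addn0; apply; rewrite e; lra.
have n13 m n : (m * d3 <> n * 3)%N -> (INR m * wd X f1 <> INR n * wd X f3)%Re.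
  move=> h e; apply: h; have := lin _ _ _ _ _ _ m n 0%N r2 r0 rz.
  by rewrite muln0 addn0; apply; rewrite e; lra.
have n23 m n : (m * p2 <> n * 3)%N -> (INR m * wd X f2 <> INR n * wd X f3)%Re.
  move=> h e; apply: h; have := lin _ _ _ _ _ _ m n 0%N r1 r0 rz.
  by rewrite muln0 addn0; apply; rewrite e; lra.
have m23 m : (wd X f2 <> INR m * wd X f3)%Re.
  by move=> e; apply: (n23 1%N m); [lia | rewrite [INR 1]/=; lra].
have m13 m : (wd X f1 <> INR m * wd X f3)%Re.
  by move=> e; apply: (n13 1%N m); [lia | rewrite [INR 1]/=; lra].
have m12 m : (2 <= m)%N -> (wd X f1 <> INR m * wd X f2)%Re.
  by move=> m2 e; apply: (ne 1%N m); [have := d3_mul_p m2; lia | rewrite [INR 1]/=; lra].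
have h32 : (2 * wd X f1 <> 3 * wd X f2)%Re.
  by move=> e; apply: (ne 2%N 3%N); [lia | rewrite [INR 2]/= [INR 3]/=; lra].
case: (cert_form charC base G hA) => [[_ _ B]|K|/EcertE [[y [Sy dy _]]|[a [y [Sy dy _]]]|[a [b [y [Sy dy _]]]]]].
- by move: B; rewrite dX3; lra.
- have [_ [[h _]|[_ [_ h]]]] := Kcert_num charC G J K; first exact: h32.
  by apply: (n23 3%N 4%N); [lia | rewrite [INR 3]/= [INR 4]/=; lra].
- case: (E1num charC J G Sy dy) => [[i [j e]]|[m m2 e]|[p' [q' [p2' q2 _ e SUx]]]].
  + apply: (@d3_comb i j); have := lin _ _ _ _ _ _ 1%N i j r2 r1 r0.
    by rewrite mul1n; apply; rewrite [INR 1]/=; lra.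
  + exact: m23 e.
  + have q3 : (3 <= q')%N.
      rewrite ltnNge; apply/negP => q2'; have eq2 : q' = 2%N by lia.
      by apply: (n23 2%N p'); [lia | rewrite -eq2].
    have h3 := INR_mul_ge (a := wd X f2) ltac:(lra) q3; rewrite [INR 3]/= in h3.
    (* For weights equal to 1 this would read [2 p2 - 3 + 2 <= d3], against [d3 <= 2 p2 - 3]. The
       true weights change the two sides by less than 2 altogether. *)
    have hS := SUx.1; rewrite d_diff // in hS.
    have : (3 * wd X f2 - (wd X f2 + wd X f3 - 2) <= wd X f1)%Re by lra.
    have u9 : (INR p2 - 3 * (w1 - 1) - 1 + INR p2 <= wd X f1)%Re.
      by apply: Rle_trans (_ : 2 * wd X f2 - wd X f3 + 2 <= _)%Re; lra.
    have v9 : (INR d3 * w1 = INR d3 + INR d3 * (w1 - 1))%Re by lra.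
    move: (INR d3 * (w1 - 1))%Re we3 hN v9 => z z1 z2 z3; lra.
- case: (E2num charC J G Sy dy) => [[_ [m _ e]]|[m _ e]|[[p' [_ _ e]] _]].
  + exact: m23 e.
  + exact: m13 e.
  + by apply: (n13 2%N p'); [lia | rewrite [INR 2]/=; lra].
- case: (E3num charC J G Sy dy) => [[m m2 e]|[e _]]; last exact: h32.
  exact: m12 m2 e.
Qed.

End Forward.

(** * Construction of the remaining multidegrees *)

Lemma perm_affine (s : 'S_3) : affine_aut [ffun i => Xv C (s i)].
Proof.
exists (perm_mx s), 0; split; first exact: unitmx_perm.
apply/ffunP => i; rewrite !ffunE mxE /C3 !polyC0 addr0 (bigD1 (s i)) //= big1 => [|j ji].
  by rewrite !mxE eqxx !polyC1 mul1r addr0.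
by rewrite !mxE eq_sym (negbTE ji) !polyC0 mul0r.
Qed.

(** A triangular map adds to a variable only polynomials in earlier ones. Powers of [X3] are
    therefore added to [X1] and [X2] by conjugating with the reversal [R] of the variables. *)
Lemma tame_example (i j p : nat) : exists F : Defs.pmap C, tame F /\
  [/\ F ord0 = X1 C + X3 C ^+ 3, F i1 = X2 C + X3 C ^+ p &
      F i2 = X3 C + (X1 C + X3 C ^+ 3) ^+ j * (X2 C + X3 C ^+ p) ^+ i].
Proof.
pose tri := fun (f : {poly C}) (g : {poly {poly C}}) => ([ffun i : 'I_3 =>
  if val i == 0%N then X1 C else if val i == 1%N then X2 C + f%:P%:P else X3 C + g%:P] : Defs.pmap C).
have tri0 f g : tri f g ord0 = X1 C by rewrite ffunE.
have tri1 f g : tri f g i1 = X2 C + f%:P%:P by rewrite ffunE /= inordK.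
have tri2 f g : tri f g i2 = X3 C + g%:P by rewrite ffunE /= inordK.
have tame_tri f g : tame (tri f g) by apply: tame_triangular; exists f, g.
pose s : 'S_3 := perm (@rev_ord_inj 3).
pose R : Defs.pmap C := [ffun i => Xv C (s i)].
have sE (k : 'I_3) : s k = rev_ord k by rewrite permE.
have s0 : s ord0 = i2 by apply: val_inj; rewrite sE /= inordK.
have s1 : s i1 = i1 by apply: val_inj; rewrite sE /= inordK.
have s2 : s i2 = ord0 by apply: val_inj; rewrite sE /= inordK.
have R0 : R ord0 = X3 C by rewrite ffunE s0 Xv_2.
have R1 : R i1 = X2 C by rewrite ffunE s1 Xv_1.
have R2 : R i2 = X1 C by rewrite ffunE s2 Xv_0.
have tR : tame R by apply: tame_affine; exact: perm_affine.
pose G := Defs.pcomp R (Defs.pcomp (tri 'X^p ('X^3)%:P) R).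
have G0 : G ord0 = X1 C + X3 C ^+ 3.
  by rewrite pcompE R0 e3_3 pcompE tri2 R0 R1 R2 rmorphD e3_3 e3C e2C rmorphXn e1X.
have G1 : G i1 = X2 C + X3 C ^+ p.
  by rewrite pcompE R1 e3_2 pcompE tri1 R0 R1 R2 rmorphD e3_2 e3C e2C rmorphXn e1X.
have G2 : G i2 = X3 C.
  by rewrite pcompE R2 e3_1 pcompE tri0 R0 R1 R2 e3_1.
exists (Defs.pcomp (tri 0 (('X^j)%:P * 'X^i)) G); split.
  by apply: tame_comp => //; apply: tame_comp => //; exact: tame_comp.
have tG k : Defs.pcomp (tri 0 (('X^j)%:P * 'X^i)) G k =
    e3 (X1 C + X3 C ^+ 3) (X2 C + X3 C ^+ p) (X3 C) (tri 0 (('X^j)%:P * 'X^i) k).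
  by rewrite pcompE G0 G1 G2.
rewrite !tG tri0 tri1 tri2; split; first by rewrite e3_1.
  by rewrite rmorphD e3_2 e3C e2C rmorph0 addr0.
by rewrite rmorphD e3_3 e3C rmorphM e2C !rmorphXn e1X e2X.
Qed.

(** [X3] has weight 1 and the other weights are below 2, so powers of [X3] dominate and the weighted
    degrees of the components are natural numbers; [rep_nat] identifies them with the total
    degrees. *)
Lemma mdeg_example (i j p : nat) : (3 < p)%N -> (1 < i * p + j * 3)%N ->
  in_mdeg_tame C (3%N, p, (i * p + j * 3)%N).
Proof.
move=> p3 n1; have [F [tF [e0 e1 e2]]] := tame_example i j p; exists F; split=> //.
have [w1 [w2 [w2_gt1 w12 w1_lt2 hN w_indep]]] := weights_exist (deg3 (F ord0) + deg3 (F i1) + deg3 (F i2)).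
set N := (_ + _ + _)%N in hN.
set X := @X0 C charC w1 w2 w2_gt1 w12 w_indep.
have dg (q : P) n : (deg3 q <= N)%N -> wd X q = INR n -> deg3 q = n.
  by move=> h e; apply: (rep_nat w_indep _ e); exact: (rep_deg3 charC w2_gt1 w12 w1_lt2 w_indep h hN).
have dx1 : wd X (X1 C) = w1 by exact: d_X1.
have dx2 : wd X (X2 C) = w2 by exact: d_X2.
have dx3 : wd X (X3 C) = 1%Re by exact: d_X3.
have x30 : X3 C != 0 by apply: (d_pos_neq0 (X := X)); lra.
have dpow n : wd X (X3 C ^+ n) = INR n by rewrite dX // dx3; lra.
have g3 n : (2 <= n)%N -> (2 <= INR n)%Re by exact: INR_ge2.
have d0 : wd X (X1 C + X3 C ^+ 3) = INR 3.
  by rewrite dD_lt dpow // dx1; have := g3 3%N isT; lra.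
have d1 : wd X (X2 C + X3 C ^+ p) = INR p.
  by rewrite dD_lt dpow // dx2; have := g3 p ltac:(lia); lra.
have u0 : X1 C + X3 C ^+ 3 != 0 by apply: (d_pos_neq0 (X := X)); rewrite d0 /=; lra.
have v0 : X2 C + X3 C ^+ p != 0 by apply: (d_pos_neq0 (X := X)); rewrite d1; have := g3 p ltac:(lia); lra.
have dp : wd X ((X1 C + X3 C ^+ 3) ^+ j * (X2 C + X3 C ^+ p) ^+ i) = INR (i * p + j * 3).
  by rewrite (@dM _ _ X) ?expf_neq0 // !dX // d0 d1 plus_INR !mult_INR; lra.
have d2 : wd X (X3 C + (X1 C + X3 C ^+ 3) ^+ j * (X2 C + X3 C ^+ p) ^+ i) = INR (i * p + j * 3).
  by rewrite dD_lt dp // dx3; have := g3 _ n1; lra.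
rewrite /mdeg; congr (_, _, _); apply: dg.
- by rewrite /N; lia.
- by rewrite e0.
- by rewrite /N; lia.
- by rewrite e1.
- by rewrite /N; lia.
- by rewrite e2.
Qed.

End Main.

Theorem mainTheorem2 (C : closedFieldType) (charC0 : [pchar C] =i pred0)
    (p2 d3 : nat) (p2_prime : prime p2) (p2_gt3 : (3 < p2)%N)
    (d3_ge : (p2 <= d3)%N) :
  in_mdeg_tame C (3%N, p2, d3) <->
  ~ (exists2 k : nat, (1 <= k <= p2 %/ 3)%N & d3 = (2 * p2 - 3 * k)%N).
Proof.
split=> [[F [tF eF]] [k hk ek]|h].
  by rewrite ek in eF; exact: (no_tame charC0 p2_prime p2_gt3 hk tF eF).
have [t [s [ht _]]] := p2_mod p2_prime p2_gt3.
(* As 3 does not divide [p2], some [i] among 0, 1, 2 satisfies [d3 = i p2] modulo 3. Then [j] is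
   nonnegative unless [i = 2] and [d3 < 2 p2], which is the excluded set. *)
have [i [j ed]] : exists i j, d3 = (i * p2 + j * 3)%N.
  have [m3|m3] : (d3 %% 3 = 0 \/ d3 %% 3 = p2 %% 3 \/ d3 %% 3 = (2 * p2) %% 3)%N by lia.
    by exists 0%N, (d3 %/ 3)%N; lia.
  case: m3 => m3; first by exists 1%N, ((d3 - p2) %/ 3)%N; lia.
  case: (leqP (2 * p2) d3) => l; first by exists 2%N, ((d3 - 2 * p2) %/ 3)%N; lia.
  by case: h; exists ((2 * p2 - d3) %/ 3)%N; lia.
by rewrite ed; apply: (mdeg_example charC0) => //; lia.
Qed.
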